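(* Let $0\le\alpha<1$. (a) If $\nu>0$, then $r_\alpha^\star(u_\nu)=\delta_{\nu,\alpha,1}$, where $\delta_{\nu,\alpha,1}$ is the smallest positive root of $$r\mathbf{\Pi}_\nu'(r)-2\alpha\nu\,\mathbf{\Pi}_\nu(r)=0.$$ Moreover, if $\nu\in(-1,0)$, then $r_\alpha^\star(u_\nu)=\delta_{\nu,\alpha}$, where $\delta_{\nu,\alpha}$ is the unique root in $(0,\infty)$ of the equation $$\sqrt{i}\,r\,\mathbf{\Pi}_\nu'(\sqrt{i}\,r)-2\alpha\nu\,\mathbf{\Pi}_\nu(\sqrt{i}\,r)=0.$$ (b) If $\nu>-1$, then $r_\alpha^\star(v_\nu)=\rho_{\nu,\alpha,1}$, where $\rho_{\nu,\alpha,1}$ is the smallest positive root of $$r\mathbf{\Pi}_\nu'(r)-(\alpha+2\nu-1)\mathbf{\Pi}_\nu(r)=0.$$ (c) If $\nu>-1$, then $r_\alpha^\star(w_\nu)=\sigma_{\nu,\alpha,1}$, where $\sigma_{\nu,\alpha,1}$ is the smallest positive root of $$r^{1/4}\mathbf{\Pi}_\nu'(r^{1/4})-2(2\alpha+\nu-2)\mathbf{\Pi}_\nu(r^{1/4})=0.$$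
   Context: For $\nu>-1$, with $J_\nu,I_\nu$ the Bessel and modified Bessel functions of the first kind (principal powers), $$\mathbf{\Pi}_\nu(z)=J_\nu(z)I_\nu(z)=\sum_{n\ge0}\frac{(-1)^n(z/2)^{2\nu+4n}}{n!\,\Gamma(\nu+n+1)\Gamma(\nu+2n+1)}.$$ The normalized functions are $$u_\nu(z)=\left(2^{2\nu}\Gamma^2(\nu+1)\mathbf{\Pi}_\nu(z)\right)^{\frac{1}{2\nu}}\ (\nu\ne0),\quad v_\nu(z)=2^{2\nu}z^{-2\nu+1}\Gamma^2(\nu+1)\mathbf{\Pi}_\nu(z),$$ $$w_\nu(z)=2^{2\nu}z^{-\frac{\nu}{2}+1}\Gamma^2(\nu+1)\mathbf{\Pi}_\nu(\sqrt[4]{z}),$$ with the branches chosen so that they are analytic near $0$ with value $0$ and derivative $1$ at $0$; in particular $zu_\nu'(z)/u_\nu(z)=\frac{1}{2\nu}\,z\mathbf{\Pi}_\nu'(z)/\mathbf{\Pi}_\nu(z)$. Here $\sqrt{i}=e^{i\pi/4}$. With $\mathbb{D}_r=\{z\in\mathbb{C}:|z|<r\}$, the radius of starlikeness of order $\alpha$ of a function $f$ is $$r_\alpha^\star(f)=\sup\left\{r>0:\ \operatorname{Re}\left(\frac{zf'(z)}{f(z)}\right)>\alpha\ \text{for all } z\in\mathbb{D}_r\right\}.$$ *)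

(* Defs.v *)
(* Stdlib reals with Coquelicot's complex numbers. *)
From Stdlib Require Import Reals Arith Factorial.
From Coquelicot Require Import Coquelicot.
Open Scope R_scope.

Definition Gamma (x : R) : R :=
  RInt_gen (fun t => Rpower t (x - 1) * exp (- t))
    (at_right 0) (Rbar_locally p_infty).

Definition Cexp (z : C) : C := (exp (Re z) * cos (Im z), exp (Re z) * sin (Im z)).

(* Principal argument, in (-PI, PI]; negative reals get PI. *)
Definition Carg (z : C) : R :=
  if Rle_dec 0 (Im z) then acos (Re z / Cmod z) else - acos (Re z / Cmod z).

Definition Clog (z : C) : C := (ln (Cmod z), Carg z).

(* Principal power with real exponent; 0 ^ 0 = 1 and 0 ^ p = 0 for p <> 0. *)
Definition Cpower (z : C) (p : R) : C :=
  if Ceq_dec z 0 then (if Req_EM_T p 0 then RtoC 1 else RtoC 0)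
  else Cexp (RtoC p * Clog z)%C.

Definition CSeries (a : nat -> C) : C :=
  (Series (fun n => Re (a n)), Series (fun n => Im (a n))).

Definition bessel_J (nu : R) (z : C) : C :=
  CSeries (fun n =>
    RtoC ((-1) ^ n / (INR (fact n) * Gamma (nu + INR n + 1)))
    * Cpower (z / 2) (2 * INR n + nu))%C.

Definition bessel_I (nu : R) (z : C) : C :=
  CSeries (fun n =>
    RtoC (1 / (INR (fact n) * Gamma (nu + INR n + 1)))
    * Cpower (z / 2) (2 * INR n + nu))%C.

Definition bessel_Pi (nu : R) (z : C) : C := (bessel_J nu z * bessel_I nu z)%C.

(* Complex differentiability at a point. *)
Definition ex_C_derive (f : C -> C) (z : C) : Prop :=
  @ex_derive C_AbsRing C_NormedModule f z.

(* f is, on the disc |z| < r, the analytic branch of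
   (2^(2 nu) Gamma(nu+1)^2 Pi_nu(z))^(1/(2 nu)) normalized by f(0) = 0 and
   f'(0) = 1.  The values of the multivalued power G^(1/(2 nu)) are the
   exp(l/(2 nu)) with l any logarithm of G; replacing z^(2 nu) inside Pi_nu by
   another of its branches does not change this set of values.  There is at
   most one such f on each disc. *)
Definition u_branch (nu r : R) (f : C -> C) : Prop :=
  (forall z, Cmod z < r -> ex_C_derive f z) /\
  f (RtoC 0) = RtoC 0 /\ C_derive f (RtoC 0) = RtoC 1 /\
  (forall z, 0 < Cmod z < r -> exists l : C,
     Cexp l = (RtoC (Rpower 2 (2 * nu) * (Gamma (nu + 1)) ^ 2)
               * bessel_Pi nu z)%C /\
     f z = Cexp (l / RtoC (2 * nu))%C).

(* The common value at z of the branches whose disc contains z; unspecified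
   where there is none, that is, from the modulus of the first zero of
   z^(-2 nu) Pi_nu on. *)
Definition u_fun (nu : R) (z : C) : C :=
  @iota C_CompleteNormedModule
    (fun y : C => exists (r : R) (f : C -> C),
       Cmod z < r /\ u_branch nu r f /\ f z = y).

(* With principal powers throughout, the powers of z in the next two functions
   combine to z times an entire function; both formulas give 0 at 0. *)
Definition v_fun (nu : R) (z : C) : C :=
  (RtoC (Rpower 2 (2 * nu)) * Cpower z (- 2 * nu + 1)
   * RtoC ((Gamma (nu + 1)) ^ 2) * bessel_Pi nu z)%C.

Definition w_fun (nu : R) (z : C) : C :=
  (RtoC (Rpower 2 (2 * nu)) * Cpower z (- nu / 2 + 1)
   * RtoC ((Gamma (nu + 1)) ^ 2) * bessel_Pi nu (Cpower z (1 / 4)))%C.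

(* z f'(z) / f(z) must be meaningful, with real part > alpha, at every point of
   the disc.  The centre is omitted: there the quotient is 0/0, and for the
   normalized functions its limit is 1 > alpha. *)
Definition starlike_on (alpha : R) (f : C -> C) (r : R) : Prop :=
  forall z : C, 0 < Cmod z < r ->
    ex_C_derive f z /\ f z <> RtoC 0 /\
    alpha < Re (z * C_derive f z / f z)%C.

Definition starlike_radius (alpha : R) (f : C -> C) : Rbar :=
  Lub_Rbar (fun r => 0 < r /\ starlike_on alpha f r).

Definition smallest_pos_root (F : R -> C) (x : R) : Prop :=
  0 < x /\ F x = RtoC 0 /\ (forall y, 0 < y -> F y = RtoC 0 -> x <= y).

Definition unique_pos_root (F : R -> C) (x : R) : Prop :=
  0 < x /\ F x = RtoC 0 /\ (forall y, 0 < y -> F y = RtoC 0 -> y = x).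

Definition sqrt_i : C := Cexp (Ci * RtoC (PI / 4))%C.

(* Main.v *)
Require Import Defs.
From Stdlib Require Import Reals Lra Lia Psatz Arith Classical.
From Coquelicot Require Import Coquelicot.
Open Scope R_scope.

(** With [j(x) = sum_n (-1)^n (x/4)^n / (n! (nu+1)_n)] one has
    [J_nu(z) = (z/2)^nu / Gamma(nu+1) * j(z^2)], and [I_nu] is the same with
    [j(-z^2)].  The product [j(x) j(-x)] is even, so it is [E(x^2)] for an entire
    function [E], and [Pi_nu(z)] is a constant times [z^(2 nu) E(z^4)].  Put
    [T(w) = - w E'(w) / E(w)].  Then [z f'(z) / f(z)] is [1 - (2/nu) T(z^4)] for
    [u_nu], [1 - 4 T(z^4)] for [v_nu] and [1 - T(z)] for [w_nu], while the root
    equations say that these quantities equal [alpha] on a ray.  The theorem is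
    therefore about the extrema of [Re T] on circles.  No zero of a Bessel
    function is ever computed or counted: only two facts on coefficients matter.

    Maximum.  Bessel's equation becomes a Riccati equation for
    [q = - x j'(x) / j(x)], whose recurrence makes the coefficients of [q] (the
    Rayleigh sums) positive ([rayleigh_pos]).  Averaging [q(x)] and [q(-x)] gives
    [T(x^2)], so [T] has nonnegative coefficients and [Re T(w) <= T(|w|)]
    ([Re_t_le]).  The truncations of [q] are subsolutions of the Riccati
    equation, hence stay below the true solution as long as [j > 0]
    ([q_sum_comparison]): the series of [T] converges on the disc up to the first
    positive zero of [E] ([t_radius_gt]).  On that disc [E = exp (- Q)] with
    [w Q' = T] ([CPSeries_e_coef_exp]), which gives the branch of [u_nu], the
    nonvanishing of [E], and the unboundedness of [T] on the positive radius
    ([t_unbounded]).  So [T] takes each positive value once there, and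
    [1 - k T(|w|)] decreases from [1] through [alpha]: this is the case [k > 0],
    where the extremal points are positive.

    Minimum, for [nu < 0].  The coefficients [e_n] of [E] satisfy a two-term
    recurrence ([jj_coef_rec]) and alternate in sign.  With
    [kappa = |nu| (1 - alpha) / 2 < 1/2] the condition is
    [Re (w E' / E) < kappa], that is [|w E'| < |w E' - 2 kappa E|].  As
    [n - 2 kappa > 0] for [n >= 1], the triangle inequality bounds both sides by
    sums of [|e_n| |w|^n], and what remains is exactly
    [sum_n (n - kappa) |e_n| |w|^n < 0], the sign of [w E' - kappa E] at [- |w|]
    ([Re_t_gt]).  That sum has a single negative coefficient, hence a single
    positive root ([excess_root], [excess_increasing]); at the root
    [sum_(n >= 1) |e_n| |w|^n < 1], so the root lies before the first zero of [E]
    ([excess_nonpos_e_coef_pos]).  The extremal point is on the ray of argument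
    [pi / 4], where [z^4] is negative.

    Finally [u_fun] is only determined through its branches: two branches have
    the same modulus, so their quotient has constant modulus, hence is constant,
    and it tends to [1] at the origin ([u_branch_unique]). *)

(** * Cauchy products of coefficient sequences *)

Fixpoint conv (a b : nat -> R) (n : nat) : R :=
  match n with
  | O => a O * b O
  | S m => a O * b (S m) + conv (fun k => a (S k)) b m
  end.

Lemma conv_succ (a b : nat -> R) (n : nat) :
  conv a b (S n) = a O * b (S n) + conv (fun k => a (S k)) b n.
Proof. reflexivity. Qed.

Definition theta (a : nat -> R) (n : nat) : R := INR n * a n.
Definition shift_up (a : nat -> R) (n : nat) : R :=
  match n with O => 0 | S m => a m end.
Definition alternate (a : nat -> R) (n : nat) : R := (-1) ^ n * a n.

Lemma conv_ext (n : nat) : forall a b c d : nat -> R,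
  (forall k, (k <= n)%nat -> a k = c k) -> (forall k, (k <= n)%nat -> b k = d k) ->
  conv a b n = conv c d n.
Proof.
  induction n as [|n IH]; intros a b c d Hac Hbd; simpl.
  - rewrite Hac, Hbd; auto.
  - rewrite (Hac O), (Hbd (S n)) by lia. f_equal.
    apply IH; intros k Hk; [apply Hac|apply Hbd]; lia.
Qed.

Lemma conv_succ_r (n : nat) : forall a b : nat -> R,
  conv a b (S n) = a (S n) * b O + conv a (fun k => b (S k)) n.
Proof.
  induction n as [|n IH]; intros a b; [simpl; ring|].
  change (conv a b (S (S n))) with (a O * b (S (S n)) + conv (fun k => a (S k)) b (S n)).
  rewrite IH. simpl. ring.
Qed.

Lemma conv_comm (n : nat) : forall a b : nat -> R, conv a b n = conv b a n.
Proof.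
  induction n as [|n IH]; intros a b; [simpl; ring|].
  rewrite conv_succ_r, IH. simpl. ring.
Qed.

Lemma conv_lin_l (n : nat) : forall (c : R) (a a' b : nat -> R),
  conv (fun k => c * a k + a' k) b n = c * conv a b n + conv a' b n.
Proof.
  induction n as [|n IH]; intros c a a' b; simpl; [ring|].
  rewrite (IH c (fun k => a (S k))). ring.
Qed.

Lemma conv_0_l (n : nat) : forall b : nat -> R, conv (fun _ => 0) b n = 0.
Proof. induction n as [|n IH]; intros b; simpl; rewrite ?IH; ring. Qed.

Lemma conv_scal_l (n : nat) (c : R) (a b : nat -> R) :
  conv (fun k => c * a k) b n = c * conv a b n.
Proof.
  rewrite (conv_ext n _ b (fun k => c * a k + (fun _ => 0) k) b);
    [|intros; ring|reflexivity].
  rewrite conv_lin_l, conv_0_l. ring.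
Qed.

Lemma conv_scal_r (n : nat) (c : R) (a b : nat -> R) :
  conv a (fun k => c * b k) n = c * conv a b n.
Proof. now rewrite conv_comm, conv_scal_l, conv_comm. Qed.

Lemma conv_lin_r (n : nat) (c : R) (a b b' : nat -> R) :
  conv a (fun k => c * b k + b' k) n = c * conv a b n + conv a b' n.
Proof. now rewrite conv_comm, conv_lin_l, !(conv_comm n a). Qed.

Lemma conv_assoc (n : nat) : forall a b c : nat -> R,
  conv (conv a b) c n = conv a (conv b c) n.
Proof.
  induction n as [|n IH]; intros a b c; [simpl; ring|].
  simpl. rewrite <- IH.
  rewrite (conv_lin_l n (a O) (fun i => b (S i)) (conv (fun i => a (S i)) b)). ring.
Qed.

Lemma conv_shift_up_l (n : nat) (a b : nat -> R) :
  conv (shift_up a) b (S n) = conv a b n.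
Proof.
  simpl. rewrite Rmult_0_l, Rplus_0_l. now apply conv_ext.
Qed.

Lemma conv_shift_up_r (n : nat) (a b : nat -> R) :
  conv a (shift_up b) (S n) = conv a b n.
Proof. now rewrite conv_comm, conv_shift_up_l, conv_comm. Qed.

(** Leibniz's rule: [theta] is [x d/dx] on coefficients. *)
Lemma theta_conv (n : nat) : forall a b : nat -> R,
  INR n * conv a b n = conv (theta a) b n + conv a (theta b) n.
Proof.
  induction n as [|n IH]; intros a b; [unfold theta; simpl; ring|].
  simpl conv.
  rewrite (conv_ext n (fun k => theta a (S k)) b
             (fun k => 1 * a (S k) + theta (fun i => a (S i)) k) b);
    [|intros; unfold theta; rewrite S_INR; ring|reflexivity].
  rewrite conv_lin_l.
  replace (conv (theta (fun i => a (S i))) b n)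
    with (INR n * conv (fun i => a (S i)) b n - conv (fun i => a (S i)) (theta b) n)
    by (rewrite IH; ring).
  unfold theta. rewrite S_INR. simpl. ring.
Qed.

Lemma conv_alternate (n : nat) : forall a b : nat -> R,
  conv (alternate a) (alternate b) n = (-1) ^ n * conv a b n.
Proof.
  induction n as [|n IH]; intros a b; [unfold alternate; simpl; ring|].
  simpl.
  rewrite (conv_ext n (fun k => alternate a (S k)) (alternate b)
             (fun k => (-1) * alternate (fun i => a (S i)) k) (alternate b));
    [|intros; unfold alternate; simpl; ring|reflexivity].
  rewrite conv_scal_l, IH. unfold alternate; simpl; ring.
Qed.

Lemma alternate_involutive (a : nat -> R) (n : nat) : alternate (alternate a) n = a n.
Proof.
  unfold alternate. rewrite <- Rmult_assoc, <- Rpow_mult_distr.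
  replace (-1 * -1) with 1 by ring. rewrite pow1. ring.
Qed.

Lemma conv_pos (n : nat) : forall a b : nat -> R,
  (forall k, (k <= n)%nat -> 0 < a k) -> (forall k, (k <= n)%nat -> 0 < b k) ->
  0 < conv a b n.
Proof.
  induction n as [|n IH]; intros a b Ha Hb; simpl.
  - apply Rmult_lt_0_compat; auto.
  - apply Rplus_lt_0_compat.
    + apply Rmult_lt_0_compat; [apply Ha|apply Hb]; lia.
    + apply IH; intros; [apply Ha|apply Hb]; lia.
Qed.

(** Products of even series are series in the square of the variable. *)
Lemma conv_even (n : nat) : forall a b : nat -> R,
  (forall k, a (S (2 * k)) = 0) ->
  conv a b (2 * n) = conv (fun k => a (2 * k)%nat) (fun k => b (2 * k)%nat) n.
Proof.
  induction n as [|n IH]; intros a b Ha; [reflexivity|].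
  replace (2 * S n)%nat with (S (S (2 * n))) by lia.
  rewrite !conv_succ.
  rewrite (IH (fun k => a (S (S k))) b);
    [|intros k; rewrite <- (Ha (S k)); f_equal; lia].
  pose proof (Ha O) as H1. simpl in H1. rewrite H1, Rmult_0_l, Rplus_0_l. f_equal.
  - do 2 f_equal; lia.
  - apply conv_ext; intros k _; [f_equal; lia|reflexivity].
Qed.

Lemma conv_PS_mult (n : nat) : forall a b : nat -> R, conv a b n = PS_mult a b n.
Proof.
  unfold PS_mult.
  induction n as [|n IH]; intros a b; [reflexivity|].
  rewrite decomp_sum by lia. simpl conv. rewrite IH.
  f_equal.
Qed.

(** A recurrence that needs all earlier values is solved by building the table of
    those values: [rec_table F n] is correct up to index [n]. *)
Fixpoint rec_table (F : nat -> (nat -> R) -> R) (n : nat) : nat -> R :=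
  match n with
  | O => fun _ => F O (fun _ => 0)
  | S m => fun k => if le_lt_dec k m then rec_table F m k else F (S m) (rec_table F m)
  end.

Definition rec_seq (F : nat -> (nat -> R) -> R) (n : nat) : R := rec_table F n n.

Lemma rec_seq_eq (F : nat -> (nat -> R) -> R) :
  (forall n a b, (forall k, (k < n)%nat -> a k = b k) -> F n a = F n b) ->
  forall n, rec_seq F n = F n (rec_seq F).
Proof.
  intros HF.
  assert (GS : forall m k, rec_table F (S m) k
     = if le_lt_dec k m then rec_table F m k else F (S m) (rec_table F m))
    by reflexivity.
  assert (GD : forall m, rec_table F (S m) (S m) = F (S m) (rec_table F m)).
  { intros m. rewrite GS. destruct (le_lt_dec (S m) m); [lia|reflexivity]. }
  assert (HG : forall n k, (k <= n)%nat -> rec_table F n k = rec_seq F k).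
  { induction n as [|n IH]; intros k Hk.
    - now replace k with O by lia.
    - destruct (Nat.eq_dec k (S n)) as [->|Hne]; [reflexivity|].
      rewrite GS. destruct (le_lt_dec k n) as [H|H]; [now apply IH|lia]. }
  intros [|n].
  - apply HF. lia.
  - unfold rec_seq at 1. rewrite GD. apply HF. intros k Hk. apply HG. lia.
Qed.

(** * Coefficients of the Bessel functions and of their product *)

Section BesselCoefficients.
Variable nu : R.
Hypothesis nu_gt : -1 < nu.

(** [J_nu(z) = (z/2)^nu / Gamma(nu+1) * sum_n j_n z^(2n)]; the recurrence avoids
    Pochhammer symbols. *)
Fixpoint j_coef (n : nat) : R :=
  match n with
  | O => 1
  | S m => - j_coef m / (4 * INR (S m) * (INR (S m) + nu))
  end.

Lemma index_plus_nu_pos (n : nat) : 0 < INR (S n) + nu.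
Proof. rewrite S_INR. pose proof (pos_INR n). lra. Qed.

(** Bessel's equation [theta^2 j + nu theta j + (x/4) j = 0]. *)
Lemma j_coef_ode (n : nat) :
  (INR n + nu) * theta j_coef n = - / 4 * shift_up j_coef n.
Proof.
  destruct n as [|n]; unfold theta; [simpl; ring|].
  pose proof (index_plus_nu_pos n). pose proof (lt_0_INR (S n) ltac:(lia)).
  change (j_coef (S n)) with (- j_coef n / (4 * INR (S n) * (INR (S n) + nu))).
  change (shift_up j_coef (S n)) with (j_coef n). field. lra.
Qed.

Lemma alternate_j_coef_ode (n : nat) :
  (INR n + nu) * theta (alternate j_coef) n = / 4 * shift_up (alternate j_coef) n.
Proof.
  transitivity ((-1) ^ n * ((INR n + nu) * theta j_coef n));
    [unfold theta, alternate; ring|].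
  rewrite j_coef_ode. destruct n; unfold alternate; simpl; ring.
Qed.

Definition jj_coef : nat -> R := conv j_coef (alternate j_coef).

(** The product is unchanged under [x -> - x]. *)
Lemma jj_coef_odd (n : nat) : jj_coef (S (2 * n)) = 0.
Proof.
  assert (H : jj_coef (S (2 * n)) = (-1) ^ S (2 * n) * jj_coef (S (2 * n))).
  { unfold jj_coef. rewrite <- conv_alternate, conv_comm.
    apply conv_ext; [reflexivity|]. intros; symmetry; apply alternate_involutive. }
  rewrite pow_1_odd in H. lra.
Qed.

(** With [U = theta A], [V = theta j . j~ - j . theta j~] and
    [W = theta j . theta j~], Bessel's equation gives
    [(theta + nu) U = 2 W], [(theta + 2 nu) W = (x/4) V] and
    [(theta + nu) V = - (x/2) A]; eliminating [U], [V], [W] leaves a two-term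
    recurrence for [A = j . j~]. *)
Lemma jj_coef_rec (m : nat) :
  INR (S (S m)) * (INR (S (S m)) + nu) * (INR (S (S m)) + 2 * nu)
  * (INR (S m) + nu) * jj_coef (S (S m)) = - / 4 * jj_coef m.
Proof.
  set (a := j_coef). set (b := alternate j_coef).
  set (B := conv (theta a) b). set (C := conv a (theta b)).
  set (W := conv (theta a) (theta b)).
  assert (Ha : forall n, theta (theta a) n = (- nu) * theta a n + - / 4 * shift_up a n).
  { intros n. pose proof (j_coef_ode n) as H. fold a in H.
    unfold theta at 1. lra. }
  assert (Hb : forall n, theta (theta b) n = (- nu) * theta b n + / 4 * shift_up b n).
  { intros n. pose proof (alternate_j_coef_ode n) as H. fold b in H.
    unfold theta at 1. lra. }
  assert (HU : forall n, INR n * jj_coef n = B n + C n) by (intros; apply theta_conv).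
  assert (HB : forall n, INR n * B n
      = (- nu * B n + - / 4 * conv (shift_up a) b n) + W n).
  { intros n. unfold B at 1. rewrite theta_conv. fold W. f_equal.
    rewrite (conv_ext n _ b _ b (fun k _ => Ha k) (fun k _ => eq_refl)).
    now rewrite conv_lin_l, conv_scal_l. }
  assert (HC : forall n, INR n * C n
      = W n + (- nu * C n + / 4 * conv a (shift_up b) n)).
  { intros n. unfold C at 1. rewrite theta_conv. fold W. f_equal.
    rewrite (conv_ext n a _ a _ (fun k _ => eq_refl) (fun k _ => Hb k)).
    now rewrite conv_lin_r, conv_scal_r. }
  assert (HW : forall n, INR (S n) * W (S n)
     = (- nu * W (S n) + - / 4 * C n) + (- nu * W (S n) + / 4 * B n)).
  { intros n. unfold W at 1. rewrite theta_conv. f_equal.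
    - rewrite (conv_ext _ _ (theta b) _ (theta b) (fun k _ => Ha k) (fun k _ => eq_refl)).
      now rewrite conv_lin_l, conv_scal_l, conv_shift_up_l.
    - rewrite (conv_ext _ (theta a) _ (theta a) _ (fun k _ => eq_refl) (fun k _ => Hb k)).
      now rewrite conv_lin_r, conv_scal_r, conv_shift_up_r. }
  pose proof (HU (S (S m))) as U2.
  pose proof (HB (S (S m))) as B2. pose proof (HC (S (S m))) as C2.
  pose proof (HW (S m)) as W2.
  pose proof (HB (S m)) as B1. pose proof (HC (S m)) as C1.
  rewrite conv_shift_up_l in B1, B2. rewrite conv_shift_up_r in C1, C2.
  change (conv a b m) with (jj_coef m) in *.
  change (conv a b (S m)) with (jj_coef (S m)) in *.
  transitivity ((INR (S (S m)) + nu) * (INR (S (S m)) + 2 * nu)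
    * (INR (S m) + nu) * (INR (S (S m)) * jj_coef (S (S m)))); [ring|].
  rewrite U2.
  transitivity ((INR (S (S m)) + 2 * nu) * (INR (S m) + nu) * (2 * W (S (S m)))).
  { replace (2 * W (S (S m))) with ((INR (S (S m)) + nu) * (B (S (S m)) + C (S (S m)))) by lra.
    ring. }
  transitivity (2 * (INR (S m) + nu) * ((INR (S (S m)) + 2 * nu) * W (S (S m)))); [ring|].
  replace ((INR (S (S m)) + 2 * nu) * W (S (S m))) with (/ 4 * (B (S m) - C (S m))) by lra.
  transitivity (/ 2 * ((INR (S m) + nu) * (B (S m) - C (S m)))); [field|].
  replace ((INR (S m) + nu) * (B (S m) - C (S m))) with (- / 2 * jj_coef m) by lra.
  field.
Qed.

(** [j(x) j(-x) = sum_n e_n x^(2n)]. *)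
Definition e_coef (n : nat) : R := jj_coef (2 * n).

Lemma e_coef_0 : e_coef 0 = 1.
Proof. unfold e_coef, jj_coef, alternate. simpl. ring. Qed.

Lemma e_coef_succ (n : nat) :
  e_coef (S n) = - e_coef n /
    (16 * INR (S n) * (INR (S n) + nu) * (2 * INR (S n) + nu) * (2 * INR (S n) + nu - 1)).
Proof.
  pose proof (jj_coef_rec (2 * n)) as H.
  pose proof (pos_INR n).
  unfold e_coef. replace (2 * S n)%nat with (S (S (2 * n))) by lia.
  rewrite !S_INR, mult_INR in H. simpl (INR 2) in H. rewrite S_INR.
  apply (Rmult_eq_reg_l ((2 * INR n + 1 + 1) * (2 * INR n + 1 + 1 + nu) *
    (2 * INR n + 1 + 1 + 2 * nu) * (2 * INR n + 1 + nu))).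
  - transitivity (- / 4 * jj_coef (2 * n)); [exact H|]. field. repeat split; lra.
  - repeat apply Rmult_integral_contrapositive_currified; lra.
Qed.

Lemma alternate_e_coef_pos (n : nat) : 0 < alternate e_coef n.
Proof.
  induction n as [|n IH]; unfold alternate in *.
  - rewrite e_coef_0. simpl. lra.
  - rewrite e_coef_succ. simpl pow.
    pose proof (index_plus_nu_pos n). pose proof (lt_0_INR (S n) ltac:(lia)).
    pose proof (pos_INR n). rewrite S_INR in *.
    match goal with |- 0 < -1 * ?u * (- ?v / ?d) =>
      replace (-1 * u * (- v / d)) with (u * v / d) by (unfold Rdiv; ring) end.
    apply Rdiv_lt_0_compat; [assumption|].
    repeat apply Rmult_lt_0_compat; lra.
Qed.

Definition unit_seq (n : nat) : R := match n with O => 1 | _ => 0 end.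

Lemma conv_unit_seq (a : nat -> R) (n : nat) : conv unit_seq a n = a n.
Proof.
  destruct n; simpl; [ring|].
  rewrite conv_0_l. ring.
Qed.

(** The Rayleigh sums [sum_k j_(nu,k)^(-2 (n+1))], through the recurrence that
    the Riccati equation of [- x j'(x) / j(x)] imposes on its coefficients. *)
Definition rayleigh : nat -> R :=
  rec_seq (fun n p => (/ 4 * unit_seq n + shift_up (conv p p) n) / (INR (S n) + nu)).

Lemma rayleigh_eq (n : nat) :
  rayleigh n = (/ 4 * unit_seq n + shift_up (conv rayleigh rayleigh) n) / (INR (S n) + nu).
Proof.
  unfold rayleigh at 1. rewrite rec_seq_eq; [reflexivity|].
  intros m a b H. do 2 f_equal. destruct m as [|m]; [reflexivity|].
  apply conv_ext; intros; apply H; lia.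
Qed.

Lemma rayleigh_pos (n : nat) : 0 < rayleigh n.
Proof.
  assert (H : forall m k, (k <= m)%nat -> 0 < rayleigh k).
  2: now apply (H n).
  clear n. induction m as [|m IH]; intros k Hk.
  all: rewrite rayleigh_eq; apply Rdiv_lt_0_compat; [|apply index_plus_nu_pos].
  - replace k with O by lia. simpl. lra.
  - destruct k as [|k]; simpl; [lra|].
    rewrite Rmult_0_r, Rplus_0_l.
    apply conv_pos; intros; apply IH; lia.
Qed.

Definition q_coef : nat -> R := shift_up rayleigh.

Lemma q_coef_nonneg (n : nat) : 0 <= q_coef n.
Proof. destruct n; simpl; [lra|]. left; apply rayleigh_pos. Qed.

(** Riccati's equation [theta q + nu q = x/4 + q^2]. *)
Lemma q_coef_riccati (n : nat) :
  theta q_coef n + nu * q_coef n = / 4 * shift_up unit_seq n + conv q_coef q_coef n.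
Proof.
  destruct n as [|n]; unfold theta; [simpl; ring|].
  unfold q_coef at 3. rewrite conv_shift_up_l.
  change (q_coef (S n)) with (rayleigh n).
  pose proof (index_plus_nu_pos n).
  transitivity ((INR (S n) + nu) * rayleigh n); [ring|].
  rewrite rayleigh_eq.
  replace (conv rayleigh q_coef n) with (shift_up (conv rayleigh rayleigh) n).
  - simpl shift_up at 2. field. lra.
  - destruct n as [|n]; [simpl; ring|].
    unfold q_coef. now rewrite conv_shift_up_r.
Qed.

(** [q] is [- x j'(x) / j(x)]: the defect [g = theta j + q j] satisfies
    [theta g + nu g = q g], whose only power series solution is zero since
    [q] has no constant term. *)
Lemma theta_j_coef (n : nat) : theta j_coef n = - conv q_coef j_coef n.
Proof.
  pose (g := fun n => 1 * theta j_coef n + conv q_coef j_coef n).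
  assert (Hg : forall n, (INR n + nu) * g n = conv q_coef g n).
  { intros m. unfold g at 2. rewrite conv_lin_r, Rmult_1_l.
    transitivity ((INR m + nu) * theta j_coef m
      + (conv (theta q_coef) j_coef m + conv q_coef (theta j_coef) m
         + nu * conv q_coef j_coef m)).
    { rewrite <- theta_conv. unfold g. ring. }
    rewrite j_coef_ode.
    assert (HR : conv (theta q_coef) j_coef m + nu * conv q_coef j_coef m
      = / 4 * shift_up j_coef m + conv q_coef (conv q_coef j_coef) m).
    { rewrite <- conv_assoc.
      transitivity (conv (fun k => nu * q_coef k + theta q_coef k) j_coef m);
        [rewrite conv_lin_l; ring|].
      rewrite (conv_ext m _ j_coef
        (fun k => / 4 * shift_up unit_seq k + conv q_coef q_coef k) j_coef);
        [|intros; rewrite <- q_coef_riccati; ring|reflexivity].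
      rewrite conv_lin_l. do 2 f_equal.
      destruct m; [simpl; ring|]. now rewrite conv_shift_up_l, conv_unit_seq. }
    lra. }
  assert (H0 : forall m k, (k <= m)%nat -> g k = 0).
  { induction m as [|m IH]; intros k Hk.
    - replace k with O by lia. unfold g, theta. simpl. ring.
    - destruct (Nat.eq_dec k (S m)) as [->|]; [|apply IH; lia].
      pose proof (Hg (S m)) as H. unfold q_coef in H. rewrite conv_shift_up_l in H.
      rewrite (conv_ext m rayleigh g rayleigh (fun _ => 0)) in H;
        [|reflexivity|intros; now apply IH].
      rewrite conv_comm, conv_0_l in H.
      pose proof (index_plus_nu_pos m).
      apply Rmult_integral in H as [H|H]; [lra|exact H]. }
  specialize (H0 n n (le_n n)). unfold g in H0. lra.
Qed.

(** The coefficients of [T(w) = - w E'(w) / E(w)], see [theta_e_coef]. *)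
Definition t_coef (n : nat) : R := q_coef (2 * n).

(** Averaging the logarithmic derivatives of [j(x)] and [j(-x)] keeps the even
    part of [q]. *)
Lemma theta_e_coef (n : nat) : theta e_coef n = - conv t_coef e_coef n.
Proof.
  assert (H : forall m, INR m * jj_coef m
     = - conv (fun k => 1 * q_coef k + alternate q_coef k) jj_coef m).
  { intros m. unfold jj_coef at 1. rewrite theta_conv, conv_lin_l.
    rewrite (conv_ext m _ (alternate j_coef)
      (fun k => (-1) * conv q_coef j_coef k) (alternate j_coef));
      [|intros; rewrite theta_j_coef; ring|reflexivity].
    rewrite (conv_ext m _ (theta (alternate j_coef)) j_coef
      (fun k => (-1) * conv (alternate q_coef) (alternate j_coef) k)).
    - rewrite conv_scal_l, conv_scal_r, conv_assoc.
      fold jj_coef.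
      rewrite (conv_comm m j_coef), conv_assoc.
      rewrite (conv_ext m (alternate q_coef) (conv (alternate j_coef) j_coef)
         (alternate q_coef) jj_coef); [ring|reflexivity|].
      intros; apply conv_comm.
    - reflexivity.
    - intros k _. rewrite conv_alternate.
      transitivity ((-1) ^ k * theta j_coef k);
        [unfold theta, alternate; ring|rewrite theta_j_coef; ring]. }
  specialize (H (2 * n)%nat).
  rewrite conv_even in H.
  - rewrite mult_INR in H. simpl (INR 2) in H.
    rewrite (conv_ext n _ (fun k => jj_coef (2 * k))
      (fun k => 2 * t_coef k) e_coef) in H.
    + rewrite conv_scal_l in H. unfold theta, e_coef at 1. lra.
    + intros k _. unfold alternate, t_coef. rewrite pow_1_even. ring.
    + reflexivity.
  - intros k. unfold alternate. rewrite pow_1_odd. ring.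
Qed.

End BesselCoefficients.

(** * Complex derivatives *)

Notation is_Cder f z l := (@is_derive C_AbsRing C_NormedModule f z l).

Lemma is_Cder_intro (f : C -> C) (z l : C) :
  (forall eps : R, 0 < eps -> exists delta : R, 0 < delta /\
     forall y : C, Cmod (y - z)%C < delta ->
       Cmod (f y - f z - (y - z) * l)%C <= eps * Cmod (y - z)%C) ->
  is_Cder f z l.
Proof.
  intros H. split; [apply is_linear_scal_l|].
  intros x Hx eps.
  assert (Hz : z = x).
  { apply (is_filter_lim_locally_unique (K:=C_AbsRing) (V:=AbsRing_NormedModule C_AbsRing)).
    exact Hx. }
  subst x.
  destruct (H eps (cond_pos eps)) as [d [Hd Hy]].
  exists (mkposreal d Hd). intros y Hb.
  exact (Hy y Hb).
Qed.

Lemma is_Cder_elim (f : C -> C) (z l : C) :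
  is_Cder f z l ->
  forall eps : R, 0 < eps -> exists delta : R, 0 < delta /\
     forall y : C, Cmod (y - z)%C < delta ->
       Cmod (f y - f z - (y - z) * l)%C <= eps * Cmod (y - z)%C.
Proof.
  intros [_ H] eps Heps.
  specialize (H z (fun P HP => HP) (mkposreal eps Heps)).
  destruct H as [d Hd]. exists d. split; [apply cond_pos|].
  intros y Hy. exact (Hd y Hy).
Qed.

(** The product and chain rules are available for the field as a module over
    itself; both module structures have the same norm. *)
Lemma is_Cder_AbsRing (f : C -> C) (z l : C) :
  is_Cder f z l <-> @is_derive C_AbsRing (AbsRing_NormedModule C_AbsRing) f z l.
Proof.
  split.
  - intros H. split; [apply (is_linear_scal_l (K:=C_AbsRing) (V:=AbsRing_NormedModule C_AbsRing))|]. apply H.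
  - intros H. split; [apply (is_linear_scal_l (K:=C_AbsRing) (V:=C_NormedModule))|]. apply H.
Qed.

Lemma is_Cder_mult (f g : C -> C) (z df dg : C) :
  is_Cder f z df -> is_Cder g z dg ->
  is_Cder (fun y => f y * g y)%C z (df * g z + f z * dg)%C.
Proof.
  rewrite !is_Cder_AbsRing. intros Hf Hg.
  apply (is_derive_mult (K:=C_AbsRing) f g z df dg Hf Hg). intros; apply Cmult_comm.
Qed.

Lemma is_Cder_comp (f g : C -> C) (z df dg : C) :
  is_Cder f (g z) df -> is_Cder g z dg -> is_Cder (fun y => f (g y)) z (dg * df)%C.
Proof.
  intros Hf Hg. apply is_Cder_AbsRing in Hg.
  exact (is_derive_comp (K:=C_AbsRing) (V:=C_NormedModule) f g z df dg Hf Hg).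
Qed.

Lemma is_Cder_ext_loc (f g : C -> C) (z l : C) (d : R) :
  0 < d -> (forall y, Cmod (y - z)%C < d -> f y = g y) ->
  is_Cder f z l -> is_Cder g z l.
Proof.
  intros Hd H.
  apply (is_derive_ext_loc (K:=C_AbsRing) (V:=C_NormedModule)).
  exists (mkposreal d Hd). intros y Hy. exact (H y Hy).
Qed.

Lemma is_Cder_ext (f g : C -> C) (z l : C) :
  (forall y, f y = g y) -> is_Cder f z l -> is_Cder g z l.
Proof. intros H. apply is_Cder_ext_loc with 1; [lra|auto]. Qed.

Lemma is_Cder_eq (f : C -> C) (z l l' : C) :
  is_Cder f z l -> l = l' -> is_Cder f z l'.
Proof. now intros H <-. Qed.

Lemma is_Cder_const (c z : C) : is_Cder (fun _ => c) z (RtoC 0).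
Proof. apply (is_derive_const (K:=C_AbsRing) (V:=C_NormedModule)). Qed.

Lemma is_Cder_id (z : C) : is_Cder (fun y => y) z (RtoC 1).
Proof. apply is_Cder_AbsRing, (is_derive_id (K:=C_AbsRing)). Qed.

Lemma is_Cder_scal (c : C) (f : C -> C) (z l : C) :
  is_Cder f z l -> is_Cder (fun y => c * f y)%C z (c * l)%C.
Proof.
  intros H. eapply is_Cder_eq.
  - apply is_Cder_mult; [apply is_Cder_const|exact H].
  - cbv beta. ring.
Qed.

Lemma is_Cder_pow (n : nat) (z : C) : is_Cder (fun y => y ^ S n)%C z (INR (S n) * z ^ n)%C.
Proof.
  induction n as [|n IH].
  - replace (INR 1 * z ^ 0)%C with (RtoC 1) by (simpl; ring).
    apply is_Cder_ext with (fun y => y); [intros; simpl; now rewrite Cmult_1_r|].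
    apply is_Cder_id.
  - replace (INR (S (S n)) * z ^ S n)%C with (1 * z ^ S n + z * (INR (S n) * z ^ n))%C.
    + apply is_Cder_ext with (fun y => y * y ^ S n)%C; [reflexivity|].
      apply is_Cder_mult; [apply is_Cder_id|exact IH].
    + rewrite !S_INR, !RtoC_plus. simpl. ring.
Qed.

(** This carries the real mean value theorem over to complex functions. *)
Lemma is_Cder_radial (f : C -> C) (z l : C) (t : R) :
  is_Cder f (t * z)%C l ->
  is_derive (fun s : R => Re (f (s * z)%C)) t (Re (z * l)%C) /\
  is_derive (fun s : R => Im (f (s * z)%C)) t (Im (z * l)%C).
Proof.
  intros H.
  assert (K : forall part : C -> R, (forall u v, part (u - v)%C = part u - part v) ->
      (forall u, Rabs (part u) <= Cmod u) -> (forall r u, part (RtoC r * u)%C = r * part u) ->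
      is_derive (fun s : R => part (f (s * z)%C)) t (part (z * l)%C)).
  { intros part Hm Hn Hs. split; [apply is_linear_scal_l|].
    intros x Hx eps.
    apply (is_filter_lim_locally_unique t x) in Hx. subst x.
    pose proof (Cmod_ge_0 z) as Hz.
    assert (He : 0 < eps / (1 + Cmod z)).
    { apply Rdiv_lt_0_compat; [apply cond_pos|lra]. }
    destruct (is_Cder_elim f _ l H _ He) as [d [Hd Hy]].
    assert (Hdz : 0 < d / (1 + Cmod z)) by (apply Rdiv_lt_0_compat; lra).
    exists (mkposreal _ Hdz). intros s Hsb.
    assert (Hst : Rabs (s - t) < d / (1 + Cmod z)) by exact Hsb.
    assert (Hsz : (s * z - t * z = RtoC (s - t) * z)%C) by (rewrite RtoC_minus; ring).
    assert (Hcm : Cmod (s * z - t * z)%C = Rabs (s - t) * Cmod z).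
    { rewrite Hsz, Cmod_mult, Cmod_R. reflexivity. }
    specialize (Hy (s * z)%C).
    assert (Hlt : Cmod (s * z - t * z)%C < d).
    { rewrite Hcm. apply Rle_lt_trans with (Rabs (s - t) * (1 + Cmod z)).
      - pose proof (Rabs_pos (s - t)). nra.
      - apply (Rmult_lt_compat_r (1 + Cmod z)) in Hst; [|lra].
        replace (d / (1 + Cmod z) * (1 + Cmod z)) with d in Hst by (field; lra). exact Hst. }
    specialize (Hy Hlt).
    change (Rabs (part (f (s * z)%C) - part (f (t * z)%C) - (s - t) * part (z * l)%C)
      <= eps * Rabs (s - t)).
    rewrite <- Hs, <- !Hm.
    eapply Rle_trans; [apply Hn|].
    replace (f (s * z) - f (t * z) - RtoC (s - t) * (z * l))%C
      with (f (s * z) - f (t * z) - (s * z - t * z) * l)%C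
      by (rewrite Hsz; ring).
    eapply Rle_trans; [exact Hy|]. rewrite Hcm.
    pose proof (Rabs_pos (s - t)). pose proof (cond_pos eps).
    replace (eps / (1 + Cmod z) * (Rabs (s - t) * Cmod z))
      with (eps * Rabs (s - t) * (Cmod z / (1 + Cmod z))) by (field; lra).
    rewrite <- (Rmult_1_r (eps * Rabs (s - t))) at 2.
    apply Rmult_le_compat_l; [apply Rmult_le_pos; lra|].
    apply Rle_div_l; lra. }
  split; apply K.
  - intros [u1 u2] [v1 v2]; simpl; ring.
  - apply re_le_Cmod.
  - intros r [u1 u2]; simpl; ring.
  - intros [u1 u2] [v1 v2]; simpl; ring.
  - intros u. eapply Rle_trans; [|apply Rmax_Cmod]. apply Rmax_r.
  - intros r [u1 u2]; simpl; ring.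
Qed.

Lemma Cmod_scal_le (t : R) (z : C) : 0 <= t <= 1 -> Cmod (t * z)%C <= Cmod z.
Proof.
  intros Ht. rewrite Cmod_mult, Cmod_R, Rabs_pos_eq by lra.
  pose proof (Cmod_ge_0 z). nra.
Qed.

(** The segment may start away from the origin, so that a singularity at [0] can
    be avoided. *)
Lemma Cder_zero_segment (f : C -> C) (z : C) (t0 : R) :
  0 <= t0 <= 1 ->
  (forall t, t0 <= t <= 1 -> is_Cder f (t * z)%C (RtoC 0)) ->
  f z = f (t0 * z)%C.
Proof.
  intros Ht0 H.
  assert (K : forall part : C -> R,
     (forall t, t0 <= t <= 1 -> is_derive (fun s : R => part (f (s * z)%C)) t 0) ->
     part (f (1 * z)%C) = part (f (t0 * z)%C)).
  { intros part Hp.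
    destruct (MVT_gen (fun s : R => part (f (s * z)%C)) t0 1 (fun _ => 0)) as [c [_ Hc]].
    - intros x Hx. apply Hp. rewrite Rmin_left, Rmax_right in Hx by lra. lra.
    - intros x Hx. rewrite Rmin_left, Rmax_right in Hx by lra.
      apply continuity_pt_filterlim.
      apply (ex_derive_continuous (fun s : R => part (f (s * z)%C))).
      exists 0. now apply Hp.
    - lra. }
  rewrite <- (Cmult_1_l z) at 1.
  apply injective_projections; apply K; intros t Ht;
    destruct (is_Cder_radial f z (RtoC 0) t (H t Ht)) as [HR HI];
    rewrite Cmult_0_r in HR, HI; assumption.
Qed.

(** * The complex exponential and the principal logarithm *)

Lemma Cmod_le_Rabs_sum (z : C) : Cmod z <= Rabs (Re z) + Rabs (Im z).
Proof.
  replace z with ((RtoC (Re z)) + (0, Im z))%C at 1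
    by (destruct z; unfold Cplus; simpl; f_equal; ring).
  eapply Rle_trans; [apply Cmod_triangle|]. rewrite Cmod_R.
  apply Rplus_le_compat_l. unfold Cmod; simpl.
  replace (0 * (0 * 1) + Im z * (Im z * 1)) with (Rsqr (Im z)) by (unfold Rsqr; ring).
  rewrite sqrt_Rsqr_abs. lra.
Qed.

Lemma im_le_Cmod (z : C) : Rabs (Im z) <= Cmod z.
Proof. eapply Rle_trans; [|apply Rmax_Cmod]. apply Rmax_r. Qed.

Lemma Cexp_add (a b : C) : Cexp (a + b)%C = (Cexp a * Cexp b)%C.
Proof.
  destruct a as [a1 a2], b as [b1 b2]. unfold Cexp, Cplus, Cmult; simpl.
  rewrite exp_plus, cos_plus, sin_plus. f_equal; ring.
Qed.

Lemma Cexp_0 : Cexp (RtoC 0) = RtoC 1.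
Proof. unfold Cexp, RtoC; simpl. rewrite exp_0, cos_0, sin_0. f_equal; ring. Qed.

Lemma Cmod_Cexp (z : C) : Cmod (Cexp z) = exp (Re z).
Proof.
  unfold Cexp, Cmod; simpl.
  replace (_ + _) with (Rsqr (exp (Re z)) * (Rsqr (sin (Im z)) + Rsqr (cos (Im z))))
    by (unfold Rsqr; ring).
  rewrite sin2_cos2, Rmult_1_r. apply sqrt_Rsqr. left; apply exp_pos.
Qed.

Lemma Cexp_neq_0 (z : C) : Cexp z <> RtoC 0.
Proof. apply Cmod_gt_0. rewrite Cmod_Cexp. apply exp_pos. Qed.

Lemma Cexp_RtoC (x : R) : Cexp (RtoC x) = RtoC (exp x).
Proof. unfold Cexp, RtoC; simpl. rewrite cos_0, sin_0. f_equal; ring. Qed.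

Lemma is_derive_0_elim (g : R -> R) (l : R) : is_derive g 0 l ->
  forall eps, 0 < eps -> exists d, 0 < d /\
    forall x, Rabs x < d -> Rabs (g x - g 0 - x * l) <= eps * Rabs x.
Proof.
  intros [_ H] eps Heps.
  destruct (H 0 (fun P HP => HP) (mkposreal eps Heps)) as [d Hd].
  exists d. split; [apply cond_pos|]. intros x Hx.
  assert (Hb : ball 0 d x) by (change (Rabs (x - 0) < d); now rewrite Rminus_0_r).
  specialize (Hd x Hb).
  change (Rabs (g x - g 0 - (x - 0) * l) <= eps * Rabs (x - 0)) in Hd.
  now rewrite Rminus_0_r in Hd.
Qed.

Lemma is_Cder_Cexp_0 : is_Cder Cexp (RtoC 0) (RtoC 1).
Proof.
  apply is_Cder_intro. intros e0 He0.
  set (e := Rmin (e0 / 7) (1 / 2)).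
  assert (He : 0 < e) by (apply Rmin_pos; lra).
  assert (He1 : e <= 1 / 2) by apply Rmin_r.
  assert (He7 : 7 * e <= e0) by (pose proof (Rmin_l (e0 / 7) (1 / 2)); fold e in H; lra).
  assert (De : is_derive exp 0 1) by (auto_derive; [auto|now rewrite exp_0, Rmult_1_r]).
  assert (Dc : is_derive cos 0 0) by (auto_derive; [auto|rewrite sin_0; ring]).
  assert (Ds : is_derive sin 0 1) by (auto_derive; [auto|rewrite cos_0; ring]).
  destruct (is_derive_0_elim exp 1 De e He) as [d1 [Hd1 H1]].
  destruct (is_derive_0_elim cos 0 Dc e He) as [d2 [Hd2 H2]].
  destruct (is_derive_0_elim sin 1 Ds e He) as [d3 [Hd3 H3]].
  exists (Rmin (Rmin d1 d2) (Rmin d3 e)).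
  split; [repeat apply Rmin_pos; lra|].
  intros [a b] Hy. rewrite Cexp_0.
  replace ((a, b) - RtoC 0)%C with (a, b) in * by (unfold Cminus, Cplus; simpl; f_equal; ring).
  pose proof (re_le_Cmod (a, b)) as Ha. pose proof (im_le_Cmod (a, b)) as Hb.
  simpl in Ha, Hb. set (m := Cmod (a, b)) in *.
  pose proof (Rmin_l (Rmin d1 d2) (Rmin d3 e)).
  pose proof (Rmin_r (Rmin d1 d2) (Rmin d3 e)).
  pose proof (Rmin_l d1 d2). pose proof (Rmin_r d1 d2).
  pose proof (Rmin_l d3 e). pose proof (Rmin_r d3 e).
  specialize (H1 a ltac:(lra)). specialize (H2 b ltac:(lra)). specialize (H3 b ltac:(lra)).
  rewrite exp_0 in H1. rewrite cos_0 in H2. rewrite sin_0 in H3.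
  assert (E1 : Rabs (exp a - 1) <= 2 * Rabs a).
  { replace (exp a - 1) with ((exp a - 1 - a * 1) + a) by ring.
    eapply Rle_trans; [apply Rabs_triang|]. pose proof (Rabs_pos a). nra. }
  assert (E2 : exp a <= 2).
  { pose proof (Rle_abs (exp a - 1)). pose proof (Rabs_pos a). lra. }
  pose proof (exp_pos a) as E0.
  eapply Rle_trans; [apply Cmod_le_Rabs_sum|].
  unfold Cexp; simpl.
  match goal with |- Rabs ?u + Rabs ?v <= _ =>
    replace u with ((exp a - 1 - a * 1) + exp a * (cos b - 1 - b * 0)) by ring;
    replace v with (exp a * (sin b - 0 - b * 1) + (exp a - 1) * b) by ring end.
  pose proof (Rabs_triang (exp a - 1 - a * 1) (exp a * (cos b - 1 - b * 0))) as T1.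
  pose proof (Rabs_triang (exp a * (sin b - 0 - b * 1)) ((exp a - 1) * b)) as T2.
  rewrite Rabs_mult, (Rabs_pos_eq (exp a)) in T1 by lra.
  rewrite !Rabs_mult, (Rabs_pos_eq (exp a)) in T2 by lra.
  pose proof (Rabs_pos a). pose proof (Rabs_pos b).
  pose proof (Rabs_pos (cos b - 1 - b * 0)). pose proof (Rabs_pos (sin b - 0 - b * 1)).
  assert (P1 : exp a * Rabs (cos b - 1 - b * 0) <= 2 * (e * m)).
  { apply Rmult_le_compat; try lra. nra. }
  assert (P2 : exp a * Rabs (sin b - 0 - b * 1) <= 2 * (e * m)).
  { apply Rmult_le_compat; try lra. nra. }
  assert (P3 : Rabs (exp a - 1) * Rabs b <= (2 * e) * m).
  { apply Rmult_le_compat; try lra. apply Rabs_pos. }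
  assert (P4 : e * Rabs a <= e * m) by nra.
  assert (0 <= m) by (apply Cmod_ge_0).
  nra.
Qed.

Lemma is_Cder_Cexp (z : C) : is_Cder Cexp z (Cexp z).
Proof.
  apply is_Cder_eq with (Cexp z * (1 * 1))%C; [|ring].
  apply is_Cder_ext with (fun y => Cexp z * Cexp (y - z))%C.
  - intros y. rewrite <- Cexp_add. f_equal. ring.
  - apply is_Cder_scal.
    apply (is_Cder_comp Cexp (fun y => y - z)%C).
    + replace (z - z)%C with (RtoC 0) by ring. apply is_Cder_Cexp_0.
    + apply is_Cder_intro. intros eps Heps. exists 1. split; [lra|]. intros y _.
      replace (y - z - (z - z) - (y - z) * 1)%C with (RtoC 0) by ring.
      rewrite Cmod_0. apply Rmult_le_pos; [lra|apply Cmod_ge_0].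
Qed.

Lemma Cexp_comp_der (f : C -> C) (z l : C) :
  is_Cder f z l -> is_Cder (fun y => Cexp (f y)) z (l * Cexp (f z))%C.
Proof. intros H. apply is_Cder_comp; [apply is_Cder_Cexp|exact H]. Qed.

Lemma Cexp_Clog (z : C) : z <> RtoC 0 -> Cexp (Clog z) = z.
Proof.
  intros Hz. pose proof (proj1 (Cmod_gt_0 z) Hz) as Hm.
  assert (Hb : -1 <= Re z / Cmod z <= 1).
  { pose proof (re_le_Cmod z) as H. apply Rabs_le_between in H.
    split; [apply Rle_div_r|apply Rle_div_l]; lra. }
  assert (Hs : sin (acos (Re z / Cmod z)) = Rabs (Im z) / Cmod z).
  { rewrite sin_acos by exact Hb.
    replace (1 - (Re z / Cmod z)²) with (Rsqr (Im z / Cmod z)).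
    - rewrite sqrt_Rsqr_abs. unfold Rdiv.
      rewrite Rabs_mult, (Rabs_pos_eq (/ Cmod z)); [reflexivity|].
      left; now apply Rinv_0_lt_compat.
    - pose proof (Cmod2_alt z) as H2.
      unfold Rsqr. apply (Rmult_eq_reg_r (Cmod z ^ 2)); [|apply pow_nonzero; lra].
      transitivity (Im z ^ 2); [field; lra|].
      replace (Im z ^ 2) with (Cmod z ^ 2 - Re z ^ 2) by (rewrite H2; ring).
      field; lra. }
  destruct z as [x y] eqn:E. rewrite <- E in *.
  transitivity (Re z, Im z); [|now rewrite E].
  unfold Cexp, Clog; simpl. rewrite exp_ln by exact Hm.
  unfold Carg. destruct (Rle_dec 0 (Im z)) as [Hi|Hi].
  - rewrite cos_acos, Hs, Rabs_pos_eq by assumption. f_equal; field; lra.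
  - rewrite cos_neg, sin_neg, cos_acos, Hs, Rabs_left by lra. f_equal; field; lra.
Qed.

Lemma Clog_Cexp (l : C) : - PI < Im l <= PI -> Clog (Cexp l) = l.
Proof.
  intros Hl. unfold Clog. rewrite Cmod_Cexp, ln_exp.
  transitivity (Re l, Im l); [|now destruct l]. f_equal.
  unfold Carg. rewrite Cmod_Cexp. unfold Cexp; simpl.
  pose proof (exp_pos (Re l)).
  replace (exp (Re l) * cos (Im l) / exp (Re l)) with (cos (Im l)) by (field; lra).
  destruct (Rle_dec 0 (exp (Re l) * sin (Im l))) as [Hs|Hs].
  - destruct (Rle_lt_dec 0 (Im l)) as [Hi|Hi]; [apply acos_cos; lra|exfalso].
    assert (0 < sin (- Im l)) by (apply sin_gt_0; lra).
    rewrite sin_neg in H0. nra.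
  - destruct (Rle_lt_dec 0 (Im l)) as [Hi|Hi].
    + exfalso. apply Hs. apply Rmult_le_pos; [lra|]. apply sin_ge_0; lra.
    + rewrite <- cos_neg, acos_cos by lra. ring.
Qed.

(** The arctangent form makes continuity visible; the arccosine form of the
    argument hides it near the real axis. *)
Lemma Clog_right_half_plane (z : C) : 0 < Re z ->
  Clog z = (ln (Cmod z), atan (Im z / Re z)).
Proof.
  intros Hx.
  assert (Hz : z <> RtoC 0) by (intros ->; simpl in Hx; lra).
  pose proof (proj1 (Cmod_gt_0 z) Hz) as Hm.
  pose proof (atan_bound (Im z / Re z)) as Ha. pose proof PI_RGT_0.
  set (l := (ln (Cmod z), atan (Im z / Re z))).
  rewrite <- (Clog_Cexp l) by (simpl; lra). f_equal.
  unfold l, Cexp; simpl. rewrite exp_ln, cos_atan, sin_atan by exact Hm.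
  assert (Hq : Cmod z = Re z * sqrt (1 + (Im z / Re z)²)).
  { rewrite <- (sqrt_Rsqr (Re z)) at 1 by lra.
    rewrite <- sqrt_mult_alt by apply Rle_0_sqr.
    unfold Cmod. f_equal. unfold Rsqr, Re, Im. field. unfold Re in Hx; lra. }
  assert (Hp : 0 < sqrt (1 + (Im z / Re z)²)).
  { apply sqrt_lt_R0. pose proof (Rle_0_sqr (Im z / Re z)). lra. }
  rewrite Hq. transitivity (Re z, Im z); [now destruct z|]. f_equal; field; lra.
Qed.

Lemma Cmod_sub_lipschitz (y z : C) : Rabs (Cmod y - Cmod z) <= Cmod (y - z)%C.
Proof.
  apply Rabs_le. split.
  - pose proof (Cmod_triangle y (z - y)%C) as H.
    replace (y + (z - y))%C with z in H by ring.
    replace (z - y)%C with (- (y - z))%C in H by ring. rewrite Cmod_opp in H. lra.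
  - pose proof (Cmod_triangle z (y - z)%C) as H.
    replace (z + (y - z))%C with y in H by ring. lra.
Qed.

Lemma Clog_continuous (z : C) : 0 < Re z ->
  forall eps, 0 < eps -> exists d, 0 < d /\
    forall y, Cmod (y - z)%C < d -> Cmod (Clog y - Clog z)%C < eps.
Proof.
  intros Hx eps Heps.
  assert (Hz : z <> RtoC 0) by (intros ->; simpl in Hx; lra).
  pose proof (proj1 (Cmod_gt_0 z) Hz) as Hm.
  assert (C1 : continuous ln (Cmod z)).
  { apply (ex_derive_continuous ln). exists (/ Cmod z). now apply is_derive_ln. }
  assert (C2 : continuous (fun y : R * R => atan (snd y * / fst y)) z).
  { apply (continuous_comp (fun y : R * R => snd y * / fst y) atan).
    - apply (continuous_mult (K:=R_AbsRing) (fun y : R * R => snd y) (fun y => / fst y)).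
      + apply continuous_snd.
      + apply (continuous_comp (fun y : R * R => fst y) Rinv); [apply continuous_fst|].
        apply (ex_derive_continuous Rinv). auto_derive. unfold Re in Hx; lra.
    - apply (ex_derive_continuous atan). eexists. apply is_derive_atan. }
  assert (He : 0 < eps / 2) by lra.
  pose proof (proj1 (filterlim_locally (F:=locally (Cmod z)) _ _) C1 (mkposreal _ He))
    as [d1 H1].
  pose proof (proj1 (filterlim_locally (F:=locally z) _ _) C2 (mkposreal _ He)) as [d2 H2].
  exists (Rmin (Rmin d1 d2) (Re z)).
  split; [repeat apply Rmin_pos; [apply cond_pos|apply cond_pos|lra]|].
  intros y Hy.
  pose proof (Rmin_l (Rmin d1 d2) (Re z)). pose proof (Rmin_r (Rmin d1 d2) (Re z)).
  pose proof (Rmin_l d1 d2). pose proof (Rmin_r d1 d2).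
  pose proof (re_le_Cmod (y - z)%C) as HR. pose proof (im_le_Cmod (y - z)%C) as HI.
  assert (Hre : Re (y - z)%C = Re y - Re z) by reflexivity.
  assert (Him : Im (y - z)%C = Im y - Im z) by reflexivity.
  rewrite Hre in HR. rewrite Him in HI.
  assert (Hyx : 0 < Re y).
  { pose proof (Rle_abs (-(Re y - Re z))) as HA. rewrite Rabs_Ropp in HA. lra. }
  rewrite !Clog_right_half_plane by assumption.
  eapply Rle_lt_trans; [apply Cmod_le_Rabs_sum|].
  assert (B1 : Rabs (ln (Cmod y) - ln (Cmod z)) < eps / 2).
  { apply (H1 (Cmod y)). change (Rabs (Cmod y - Cmod z) < d1).
    pose proof (Cmod_sub_lipschitz y z). lra. }
  assert (B2 : Rabs (atan (Im y / Re y) - atan (Im z / Re z)) < eps / 2).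
  { apply (H2 y). split.
    - change (Rabs (Re y - Re z) < d2). lra.
    - change (Rabs (Im y - Im z) < d2). lra. }
  simpl. unfold Rminus in B1, B2. lra.
Qed.

(** [Clog] is a continuous right inverse of [Cexp], whose derivative at [Clog z]
    is [z]. *)
Lemma is_Cder_Clog (z : C) : 0 < Re z -> is_Cder Clog z (/ z)%C.
Proof.
  intros Hx.
  assert (Hz : z <> RtoC 0) by (intros ->; simpl in Hx; lra).
  pose proof (proj1 (Cmod_gt_0 z) Hz) as Hm.
  apply is_Cder_intro. intros eps Heps. set (m := Cmod z) in *.
  set (e := Rmin (m / 2) (eps * m ^ 2 / 2)).
  assert (Hm2 : 0 < m ^ 2) by (apply pow_lt; exact Hm).
  assert (He : 0 < e) by (apply Rmin_pos; [lra|]; nra).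
  pose proof (Rmin_l (m / 2) (eps * m ^ 2 / 2)) as He1. fold e in He1.
  pose proof (Rmin_r (m / 2) (eps * m ^ 2 / 2)) as He2. fold e in He2.
  destruct (is_Cder_elim _ _ _ (is_Cder_Cexp (Clog z)) e He) as [d1 [Hd1 H1]].
  destruct (Clog_continuous z Hx d1 Hd1) as [d2 [Hd2 H2]].
  exists (Rmin d2 m). split; [now apply Rmin_pos|].
  intros y Hy. pose proof (Rmin_l d2 m). pose proof (Rmin_r d2 m).
  assert (Hy0 : y <> RtoC 0).
  { intros ->. replace (0 - z)%C with (- z)%C in Hy by ring.
    rewrite Cmod_opp in Hy. fold m in Hy. lra. }
  specialize (H1 (Clog y) (H2 y ltac:(lra))).
  rewrite !Cexp_Clog in H1 by assumption.
  set (dl := (Clog y - Clog z)%C) in *.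
  assert (Hr : Cmod (dl - (y - z) * / z)%C <= e / m * Cmod dl).
  { replace (dl - (y - z) * / z)%C with (- ((y - z - dl * z) * / z))%C
      by (field; exact Hz).
    rewrite Cmod_opp, Cmod_mult, Cmod_inv by exact Hz. fold m.
    unfold Rdiv. rewrite (Rmult_comm e), Rmult_assoc, (Rmult_comm (Cmod _)).
    apply Rmult_le_compat_l; [left; now apply Rinv_0_lt_compat|exact H1]. }
  assert (Hd : Cmod dl <= 2 / m * Cmod (y - z)%C).
  { assert (Cmod dl <= e / m * Cmod dl + / m * Cmod (y - z)%C).
    { replace dl with ((dl - (y - z) * / z) + (y - z) * / z)%C at 1 by ring.
      eapply Rle_trans; [apply Cmod_triangle|]. apply Rplus_le_compat; [exact Hr|].
      rewrite Cmod_mult, Cmod_inv by exact Hz. fold m. rewrite Rmult_comm. lra. }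
    assert (e / m <= 1 / 2) by (apply Rle_div_l; lra).
    pose proof (Cmod_ge_0 dl).
    assert (Cmod dl <= 1 / 2 * Cmod dl + / m * Cmod (y - z)%C) by nra.
    unfold Rdiv. lra. }
  eapply Rle_trans; [exact Hr|].
  apply Rle_trans with (e / m * (2 / m * Cmod (y - z)%C)).
  { apply Rmult_le_compat_l; [|exact Hd]. left. now apply Rdiv_lt_0_compat. }
  replace (e / m * (2 / m * Cmod (y - z)%C)) with ((2 * e / m ^ 2) * Cmod (y - z)%C)
    by (field; lra).
  apply Rmult_le_compat_r; [apply Cmod_ge_0|].
  apply Rle_div_l; lra.
Qed.

(** * Power series with real coefficients at complex points *)

Definition is_Cseries (u : nat -> C) (l : C) : Prop :=
  is_series (fun n => Re (u n)) (Re l) /\ is_series (fun n => Im (u n)) (Im l).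

Lemma is_Cseries_unique (u : nat -> C) (l : C) : is_Cseries u l -> CSeries u = l.
Proof.
  intros [H1 H2]. unfold CSeries.
  rewrite (is_series_unique _ _ H1), (is_series_unique _ _ H2). now destruct l.
Qed.

Lemma is_Cseries_ext (u v : nat -> C) (l : C) :
  (forall n, u n = v n) -> is_Cseries u l -> is_Cseries v l.
Proof.
  intros H [H1 H2]. split; [apply is_series_ext with (2 := H1)|apply is_series_ext with (2 := H2)];
    intros n; now rewrite H.
Qed.

Lemma Cseries_absolute (u : nat -> C) :
  ex_series (fun n => Cmod (u n)) -> is_Cseries u (CSeries u).
Proof.
  intros H. split; apply Series_correct; apply ex_series_Rabs.
  - apply (ex_series_le (V:=R_CompleteNormedModule) _ (fun n => Cmod (u n))); [|exact H].
    intros n. change (Rabs (Rabs (Re (u n))) <= Cmod (u n)).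
    rewrite Rabs_Rabsolu. apply re_le_Cmod.
  - apply (ex_series_le (V:=R_CompleteNormedModule) _ (fun n => Cmod (u n))); [|exact H].
    intros n. change (Rabs (Rabs (Im (u n))) <= Cmod (u n)).
    rewrite Rabs_Rabsolu. apply im_le_Cmod.
Qed.

Lemma is_Rseries_lin (a b : nat -> R) (la lb x y : R) :
  is_series a la -> is_series b lb ->
  is_series (fun n => x * a n + y * b n) (x * la + y * lb).
Proof.
  intros Ha Hb.
  apply (is_series_plus (V:=R_NormedModule) (fun n => x * a n) (fun n => y * b n)).
  - exact (is_series_scal (V:=R_NormedModule) x a la Ha).
  - exact (is_series_scal (V:=R_NormedModule) y b lb Hb).
Qed.

Lemma is_Cseries_plus (u v : nat -> C) (k l : C) :
  is_Cseries u k -> is_Cseries v l -> is_Cseries (fun n => u n + v n)%C (k + l)%C.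
Proof.
  intros [H1 H2] [H3 H4]. split.
  - exact (is_series_plus (V:=R_NormedModule) _ _ _ _ H1 H3).
  - exact (is_series_plus (V:=R_NormedModule) _ _ _ _ H2 H4).
Qed.

Lemma is_Cseries_scal (c : C) (u : nat -> C) (l : C) :
  is_Cseries u l -> is_Cseries (fun n => c * u n)%C (c * l)%C.
Proof.
  intros [H1 H2]. split.
  - replace (Re (c * l)%C) with (Re c * Re l + (- Im c) * Im l)
      by (unfold Re, Im; simpl; ring).
    apply is_series_ext with (2 := is_Rseries_lin _ _ _ _ (Re c) (- Im c) H1 H2).
    intros n. unfold Re, Im; simpl; ring.
  - replace (Im (c * l)%C) with (Im c * Re l + Re c * Im l)
      by (unfold Re, Im; simpl; ring).
    apply is_series_ext with (2 := is_Rseries_lin _ _ _ _ (Im c) (Re c) H1 H2).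
    intros n. unfold Re, Im; simpl; ring.
Qed.

Lemma is_Cseries_cons (u : nat -> C) (l : C) :
  is_Cseries (fun n => u (S n)) l -> is_Cseries u (u O + l)%C.
Proof.
  intros [H1 H2].
  split; apply (is_series_decr_1 (V:=R_NormedModule)).
  - refine (eq_ind _ (fun x => is_series (fun n => Re (u (S n))) x) H1 _ _).
    change (Re l = (Re (u O) + Re l) + - Re (u O)). ring.
  - refine (eq_ind _ (fun x => is_series (fun n => Im (u (S n))) x) H2 _ _).
    change (Im l = (Im (u O) + Im l) + - Im (u O)). ring.
Qed.

Lemma is_series_even_part (u : nat -> R) (l : R) :
  (forall n, u (S (2 * n)) = 0) -> is_series u l -> is_series (fun n => u (2 * n)%nat) l.
Proof.
  intros H0 H.
  assert (E : forall n, sum_n (fun k => u (2 * k)%nat) n = sum_n u (2 * n)).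
  { induction n as [|n IH].
    - simpl. now rewrite !sum_O.
    - rewrite sum_Sn, IH. replace (2 * S n)%nat with (S (S (2 * n))) by lia.
      rewrite !sum_Sn, H0. unfold plus; simpl. ring. }
  change (is_lim_seq (sum_n (fun k => u (2 * k)%nat)) l).
  apply is_lim_seq_ext with (fun n => sum_n u (2 * n)); [intros; now rewrite E|].
  apply (is_lim_seq_subseq (sum_n u) l (fun n => (2 * n)%nat)); [|exact H].
  apply eventually_subseq. intros; lia.
Qed.

Lemma is_series_le (a b : nat -> R) (la lb : R) :
  (forall n, a n <= b n) -> is_series a la -> is_series b lb -> la <= lb.
Proof.
  intros H Ha Hb.
  apply (is_lim_seq_le (sum_n a) (sum_n b) la lb); [|exact Ha|exact Hb].
  induction n as [|n IH]; [rewrite !sum_O; apply H|].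
  rewrite !sum_Sn. now apply Rplus_le_compat.
Qed.

(** Projecting the series on the direction of its sum [l] reduces this to a
    comparison of real series: [|l|^2 = sum Re (conj l u_n) <= |l| sum |u_n|]. *)
Lemma Cmod_Cseries_le (u : nat -> C) :
  ex_series (fun n => Cmod (u n)) -> Cmod (CSeries u) <= Series (fun n => Cmod (u n)).
Proof.
  intros H. pose proof (Cseries_absolute u H) as [H1 H2].
  set (l := CSeries u) in *.
  pose proof (is_Rseries_lin _ _ _ _ (Re l) (Im l) H1 H2) as H3.
  assert (H4 : is_series (fun n => Cmod l * Cmod (u n)) (Cmod l * Series (fun n => Cmod (u n)))).
  { apply (is_series_scal (V:=R_NormedModule)). now apply Series_correct. }
  assert (H5 : Cmod l ^ 2 <= Cmod l * Series (fun n => Cmod (u n))).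
  { rewrite Cmod2_alt.
    replace (Re l ^ 2 + Im l ^ 2) with (Re l * Re l + Im l * Im l) by ring.
    refine (is_series_le _ _ _ _ _ H3 H4). intros n.
    replace (Re l * Re (u n) + Im l * Im (u n)) with (Re (Cconj l * u n)%C)
      by (unfold Re, Im; simpl; ring).
    rewrite <- (Cmod_conj l), <- Cmod_mult.
    eapply Rle_trans; [apply Rle_abs|apply re_le_Cmod]. }
  destruct (Cmod_ge_0 l) as [Hl|Hl].
  - apply Rmult_le_reg_l with (Cmod l); [exact Hl|]. simpl in H5. lra.
  - rewrite <- Hl, <- (Rmult_0_l (Series (fun n => Cmod (u n)))), <- Series_scal_l.
    apply Series_le; [|exact H]. intros n. rewrite Rmult_0_l.
    split; [lra|apply Cmod_ge_0].
Qed.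

(** Real coefficients suffice for Bessel functions of real order, and let the real
    notion of radius of convergence serve in the complex plane. *)
Definition CPSeries (a : nat -> R) (z : C) : C := CSeries (fun n => RtoC (a n) * z ^ n)%C.

Lemma Cmod_term (a : nat -> R) (z : C) (n : nat) :
  Cmod (RtoC (a n) * z ^ n)%C = Rabs (a n * Cmod z ^ n).
Proof.
  rewrite Cmod_mult, Cmod_R, Cmod_pow, Rabs_mult.
  now rewrite (Rabs_pos_eq (Cmod z ^ n)) by (apply pow_le, Cmod_ge_0).
Qed.

Lemma in_disk (a : nat -> R) (z : C) :
  Rbar_lt (Cmod z) (CV_radius a) -> Rbar_lt (Rabs (Cmod z)) (CV_radius a).
Proof. now rewrite Rabs_pos_eq by apply Cmod_ge_0. Qed.

Lemma CPSeries_absolute (a : nat -> R) (z : C) :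
  Rbar_lt (Cmod z) (CV_radius a) -> ex_series (fun n => Cmod (RtoC (a n) * z ^ n)%C).
Proof.
  intros H. apply ex_series_ext with (fun n => Rabs (a n * Cmod z ^ n)).
  - intros n. symmetry. apply Cmod_term.
  - apply CV_disk_inside. now apply in_disk.
Qed.

Lemma CPSeries_correct (a : nat -> R) (z : C) :
  Rbar_lt (Cmod z) (CV_radius a) -> is_Cseries (fun n => RtoC (a n) * z ^ n)%C (CPSeries a z).
Proof. intros H. now apply Cseries_absolute, CPSeries_absolute. Qed.

Lemma CPSeries_real (a : nat -> R) (x : R) : CPSeries a (RtoC x) = RtoC (PSeries a x).
Proof.
  assert (H : forall n, (RtoC (a n) * RtoC x ^ n)%C = RtoC (a n * x ^ n)).
  { intros n. now rewrite <- RtoC_pow, RtoC_mult. }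
  apply injective_projections.
  - change (Series (fun n => Re (RtoC (a n) * RtoC x ^ n)%C)
      = Series (fun n => a n * x ^ n)).
    apply Series_ext. intros n. exact (f_equal Re (H n)).
  - change (Series (fun n => Im (RtoC (a n) * RtoC x ^ n)%C) = 0).
    rewrite <- (Rmult_0_l (Series (fun _ => 0))), <- Series_scal_l.
    apply Series_ext. intros n. rewrite Rmult_0_l. exact (f_equal Im (H n)).
Qed.

Lemma CPSeries_0 (a : nat -> R) : CPSeries a (RtoC 0) = RtoC (a O).
Proof. now rewrite CPSeries_real, PSeries_0. Qed.

Lemma CPSeries_ext (a b : nat -> R) (z : C) : (forall n, a n = b n) -> CPSeries a z = CPSeries b z.
Proof.
  intros H. unfold CPSeries, CSeries. f_equal; apply Series_ext; intros n; now rewrite H.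
Qed.

Lemma CPSeries_alternate (a : nat -> R) (z : C) : CPSeries (alternate a) z = CPSeries a (- z)%C.
Proof.
  assert (H : forall n, (RtoC (alternate a n) * z ^ n = RtoC (a n) * (- z) ^ n)%C).
  { intros n. replace (- z)%C with (RtoC (-1) * z)%C
      by (apply injective_projections; simpl; ring).
    rewrite Cpow_mult_l, <- RtoC_pow. unfold alternate. rewrite RtoC_mult. ring. }
  unfold CPSeries, CSeries. f_equal; apply Series_ext; intros n; now rewrite H.
Qed.

(** Mertens' theorem, applied to real and imaginary parts. *)
Lemma CPSeries_mult_is (a b : nat -> R) (z : C) :
  Rbar_lt (Cmod z) (CV_radius a) -> Rbar_lt (Cmod z) (CV_radius b) ->
  is_Cseries (fun n => RtoC (conv a b n) * z ^ n)%C (CPSeries a z * CPSeries b z)%C.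
Proof.
  intros Ha Hb.
  pose proof (CPSeries_correct a z Ha) as [Ha1 Ha2]. pose proof (CPSeries_correct b z Hb) as [Hb1 Hb2].
  assert (Hr : forall (c : nat -> R), Rbar_lt (Cmod z) (CV_radius c) ->
     ex_series (fun n => Rabs (Re (RtoC (c n) * z ^ n)%C)) /\
     ex_series (fun n => Rabs (Im (RtoC (c n) * z ^ n)%C))).
  { intros c Hc. split;
      apply (ex_series_le (V:=R_CompleteNormedModule) _ (fun n => Cmod (RtoC (c n) * z ^ n)%C)).
    2, 4: now apply CPSeries_absolute.
    - intros n. change (Rabs (Rabs (Re (RtoC (c n) * z ^ n)%C)) <= Cmod (RtoC (c n) * z ^ n)%C).
      rewrite Rabs_Rabsolu. apply re_le_Cmod.
    - intros n. change (Rabs (Rabs (Im (RtoC (c n) * z ^ n)%C)) <= Cmod (RtoC (c n) * z ^ n)%C).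
      rewrite Rabs_Rabsolu. apply im_le_Cmod. }
  destruct (Hr a Ha) as [Ea1 Ea2]. destruct (Hr b Hb) as [Eb1 Eb2].
  assert (Hsplit : forall n k, (k <= n)%nat -> (z ^ n = z ^ k * z ^ (n - k))%C).
  { intros n k Hk. rewrite <- Cpow_add_r. f_equal. lia. }
  split.
  - replace (Re (CPSeries a z * CPSeries b z)%C)
      with (1 * (Re (CPSeries a z) * Re (CPSeries b z)) + (-1) * (Im (CPSeries a z) * Im (CPSeries b z)))
      by (unfold Re, Im; simpl; ring).
    apply is_series_ext with (2 := is_Rseries_lin _ _ _ _ 1 (-1)
      (is_series_mult _ _ _ _ Ha1 Hb1 Ea1 Eb1) (is_series_mult _ _ _ _ Ha2 Hb2 Ea2 Eb2)).
    intros n. rewrite conv_PS_mult. unfold PS_mult.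
    rewrite !scal_sum, <- plus_sum.
    transitivity (sum_f_R0 (fun k => a k * b (n - k)%nat) n * Re (z ^ n)%C);
      [|unfold Re; simpl; ring].
    rewrite Rmult_comm, scal_sum. apply sum_eq. intros k Hk.
    rewrite (Hsplit n k Hk). unfold Re, Im; simpl. ring.
  - replace (Im (CPSeries a z * CPSeries b z)%C)
      with (1 * (Re (CPSeries a z) * Im (CPSeries b z)) + 1 * (Im (CPSeries a z) * Re (CPSeries b z)))
      by (unfold Re, Im; simpl; ring).
    apply is_series_ext with (2 := is_Rseries_lin _ _ _ _ 1 1
      (is_series_mult _ _ _ _ Ha1 Hb2 Ea1 Eb2) (is_series_mult _ _ _ _ Ha2 Hb1 Ea2 Eb1)).
    intros n. rewrite conv_PS_mult. unfold PS_mult.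
    rewrite !scal_sum, <- plus_sum.
    transitivity (sum_f_R0 (fun k => a k * b (n - k)%nat) n * Im (z ^ n)%C);
      [|unfold Im; simpl; ring].
    rewrite Rmult_comm, scal_sum. apply sum_eq. intros k Hk.
    rewrite (Hsplit n k Hk). unfold Re, Im; simpl. ring.
Qed.

Lemma CPSeries_theta (a : nat -> R) (z : C) :
  Rbar_lt (Cmod z) (CV_radius a) -> CPSeries (theta a) z = (z * CPSeries (PS_derive a) z)%C.
Proof.
  intros H. apply is_Cseries_unique.
  assert (H' : Rbar_lt (Cmod z) (CV_radius (PS_derive a))) by (rewrite CV_radius_derive; exact H).
  pose proof (is_Cseries_scal z _ _ (CPSeries_correct _ z H')) as K.
  replace (z * CPSeries (PS_derive a) z)%C
    with (RtoC (theta a 0) * z ^ 0 + z * CPSeries (PS_derive a) z)%C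
    by (unfold theta; simpl; rewrite Rmult_0_l; ring).
  apply (is_Cseries_cons (fun n => RtoC (theta a n) * z ^ n)%C).
  apply is_Cseries_ext with (2 := K). intros n.
  unfold theta, PS_derive. rewrite Cpow_S. ring.
Qed.

(** The factor of [|y - z|^2] depends on [rho] and [n] only, and is summable against
    the coefficients inside the disc: hence termwise differentiation. *)
Lemma pow_taylor_bound (rho : R) (y z : C) (n : nat) :
  Cmod y <= rho -> Cmod z <= rho ->
  Cmod (y ^ (S (S n)) - z ^ (S (S n)) - (y - z) * (RtoC (INR (S (S n))) * z ^ (S n)))%C
  <= INR (S (S n)) * INR (S n) * rho ^ n * Cmod (y - z)%C ^ 2.
Proof.
  intros Hy Hz.
  pose proof (Cmod_ge_0 y) as Y0. pose proof (Cmod_ge_0 z) as Z0.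
  induction n as [|n IH].
  - replace (y ^ 2 - z ^ 2 - (y - z) * (RtoC (INR 2) * z ^ 1))%C with ((y - z) ^ 2)%C.
    + rewrite Cmod_pow. simpl. nra.
    + simpl INR. rewrite RtoC_plus. simpl. ring.
  - set (m := S (S n)) in *.
    replace (y ^ S m - z ^ S m - (y - z) * (RtoC (INR (S m)) * z ^ m))%C
      with (y * (y ^ m - z ^ m - (y - z) * (RtoC (INR m) * z ^ S n))
            + RtoC (INR m) * (z ^ S n * (y - z) ^ 2))%C.
    + eapply Rle_trans; [apply Cmod_triangle|].
      rewrite !Cmod_mult, Cmod_R, !Cmod_pow, (Rabs_pos_eq (INR m)) by apply pos_INR.
      set (h := Cmod (y - z)%C) in *.
      assert (Hh : 0 <= h) by apply Cmod_ge_0.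
      assert (Hzp : Cmod z ^ S n <= rho ^ S n) by (apply pow_incr; lra).
      assert (Hrp : 0 <= rho ^ n) by (apply pow_le; lra).
      assert (Hm : 0 <= INR m) by apply pos_INR.
      assert (Hn : 0 <= INR (S n)) by apply pos_INR.
      assert (A : Cmod y * Cmod (y ^ m - z ^ m - (y - z) * (RtoC (INR m) * z ^ S n))%C
         <= rho * (INR m * INR (S n) * rho ^ n * h ^ 2)).
      { apply Rmult_le_compat; try assumption. apply Cmod_ge_0. }
      assert (B : INR m * (Cmod z ^ S n * h ^ 2) <= INR m * (rho ^ S n * h ^ 2)).
      { apply Rmult_le_compat_l; [assumption|]. apply Rmult_le_compat_r; [|assumption].
        apply pow2_ge_0. }
      apply Rle_trans with (1 := Rplus_le_compat _ _ _ _ A B).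
      replace (rho * (INR m * INR (S n) * rho ^ n * h ^ 2) + INR m * (rho ^ S n * h ^ 2))
        with (INR m * (INR (S n) + 1) * rho ^ S n * h ^ 2) by (simpl pow; ring).
      apply Rmult_le_compat_r; [apply pow2_ge_0|].
      apply Rmult_le_compat_r; [simpl; nra|].
      rewrite (S_INR m). unfold m. rewrite (S_INR (S n)). nra.
    + rewrite (S_INR m), RtoC_plus. unfold m. simpl. ring.
Qed.

Lemma Rbar_between (x : R) (r : Rbar) : Rbar_lt x r -> exists rho : R, x < rho /\ Rbar_lt rho r.
Proof.
  destruct r as [r| |]; simpl; intros H; [|now exists (x + 1); split; [lra|]|contradiction].
  exists ((x + r) / 2). lra.
Qed.

Lemma CV_radius_Rabs (a b : nat -> R) :
  (forall n, Rabs (a n) <= Rabs (b n)) -> Rbar_le (CV_radius b) (CV_radius a).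
Proof.
  intros H. apply (proj2 (CV_radius_bounded b)). intros r [M HM].
  apply (proj1 (CV_radius_bounded a)). exists M. intros n.
  eapply Rle_trans; [|apply (HM n)]. rewrite !Rabs_mult.
  apply Rmult_le_compat_r; [apply Rabs_pos|apply H].
Qed.

Lemma is_Cder_CPSeries (a : nat -> R) (z : C) :
  Rbar_lt (Cmod z) (CV_radius a) -> is_Cder (CPSeries a) z (CPSeries (PS_derive a) z).
Proof.
  intros Hz. destruct (Rbar_between _ _ Hz) as [rho [Hr1 Hr2]].
  pose proof (Cmod_ge_0 z) as Hz0.
  pose (b := fun n => Rabs (a n)).
  assert (Hb : Rbar_lt rho (CV_radius b)).
  { eapply Rbar_lt_le_trans; [exact Hr2|]. apply CV_radius_Rabs.
    intros n. unfold b. rewrite Rabs_Rabsolu. lra. }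
  pose (B := fun n => PS_derive (PS_derive b) n * rho ^ n).
  assert (HB : ex_series B).
  { apply ex_series_ext with (fun n => Rabs (B n)).
    - intros n. apply Rabs_pos_eq. unfold B, PS_derive, b.
      repeat apply Rmult_le_pos; try apply pos_INR; try apply Rabs_pos. apply pow_le; lra.
    - apply CV_disk_inside. rewrite !CV_radius_derive, Rabs_pos_eq by lra. exact Hb. }
  set (M := Series B).
  assert (HM : 0 <= M).
  { unfold M. rewrite <- (Rmult_0_l (Series B)), <- Series_scal_l.
    apply Series_le; [|exact HB]. intros n. rewrite Rmult_0_l. split; [lra|].
    unfold B, PS_derive, b.
    repeat apply Rmult_le_pos; try apply pos_INR; try apply Rabs_pos. apply pow_le; lra. }
  apply is_Cder_intro. intros eps Heps.
  exists (Rmin (rho - Cmod z) (eps / (M + 1))).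
  split. { apply Rmin_pos; [lra|]. apply Rdiv_lt_0_compat; lra. }
  intros y Hy. set (h := Cmod (y - z)%C) in *.
  pose proof (Rmin_l (rho - Cmod z) (eps / (M + 1))).
  pose proof (Rmin_r (rho - Cmod z) (eps / (M + 1))).
  assert (Hyr : Cmod y < rho).
  { replace y with (z + (y - z))%C by ring.
    eapply Rle_lt_trans; [apply Cmod_triangle|]. fold h. lra. }
  assert (Hyc : Rbar_lt (Cmod y) (CV_radius a)).
  { eapply Rbar_lt_trans; [|exact Hr2]. exact Hyr. }
  assert (Hzd : Rbar_lt (Cmod z) (CV_radius (PS_derive a))).
  { now rewrite CV_radius_derive. }
  pose (T := fun n => (RtoC (a n) * (y ^ n - z ^ n
      - (y - z) * (RtoC (INR n) * z ^ pred n)))%C).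
  assert (HT : is_Cseries T (CPSeries a y - CPSeries a z - (y - z) * CPSeries (PS_derive a) z)%C).
  { pose proof (CPSeries_correct a y Hyc) as K1.
    pose proof (is_Cseries_scal (RtoC (-1)) _ _ (CPSeries_correct a z Hz)) as K2.
    pose proof (is_Cseries_scal (- (y - z))%C _ _ (CPSeries_correct _ z Hzd)) as K3.
    apply (is_Cseries_ext _ (fun n => (- (y - z)) * (RtoC (INR (S n) * a (S n)) * z ^ n))%C) in K3;
      [|reflexivity].
    apply (is_Cseries_cons (fun n => (- (y - z)) * (RtoC (INR n * a n) * z ^ pred n))%C) in K3.
    pose proof (is_Cseries_plus _ _ _ _ (is_Cseries_plus _ _ _ _ K1 K2) K3) as K.
    replace (CPSeries a y - CPSeries a z - (y - z) * CPSeries (PS_derive a) z)%C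
      with (CPSeries a y + RtoC (-1) * CPSeries a z +
       (- (y - z) * (RtoC (INR 0 * a 0%nat) * z ^ pred 0) + - (y - z) * CPSeries (PS_derive a) z))%C.
    - apply is_Cseries_ext with (2 := K). intros n. unfold T.
      rewrite RtoC_mult. replace (RtoC (-1)) with (- RtoC 1)%C
        by (apply injective_projections; simpl; ring). ring.
    - simpl INR. rewrite Rmult_0_l. replace (RtoC (-1)) with (- RtoC 1)%C
        by (apply injective_projections; simpl; ring). ring. }
  assert (HTb : forall n, Cmod (T (S (S n))) <= B n * h ^ 2).
  { intros n. unfold T. rewrite Cmod_mult, Cmod_R. simpl pred.
    unfold B, PS_derive, b.
    replace (INR (S n) * (INR (S (S n)) * Rabs (a (S (S n)))) * rho ^ n * h ^ 2)
      with (Rabs (a (S (S n))) * (INR (S (S n)) * INR (S n) * rho ^ n * h ^ 2)) by ring.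
    apply Rmult_le_compat_l; [apply Rabs_pos|].
    apply pow_taylor_bound; lra. }
  assert (HBh : ex_series (fun n => B n * h ^ 2)) by (apply ex_series_scal_r, HB).
  assert (HTa : ex_series (fun n => Cmod (T (S (S n))))).
  { apply (ex_series_le (V:=R_CompleteNormedModule) _ (fun n => B n * h ^ 2)); [|exact HBh].
    intros n. change (Rabs (Cmod (T (S (S n)))) <= B n * h ^ 2).
    rewrite Rabs_pos_eq by apply Cmod_ge_0. apply HTb. }
  assert (HT2 : (CPSeries a y - CPSeries a z - (y - z) * CPSeries (PS_derive a) z)%C
      = CSeries (fun n => T (S (S n)))).
  { pose proof (Cseries_absolute _ HTa) as K.
    apply (is_Cseries_cons (fun n => T (S n))) in K. apply (is_Cseries_cons T) in K.
    rewrite <- (is_Cseries_unique _ _ HT), (is_Cseries_unique _ _ K).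
    unfold T at 1 2. simpl. ring. }
  rewrite HT2.
  eapply Rle_trans; [apply Cmod_Cseries_le, HTa|].
  apply Rle_trans with (M * h ^ 2).
  { unfold M. rewrite <- Series_scal_r. apply Series_le; [|exact HBh].
    intros n. split; [apply Cmod_ge_0|apply HTb]. }
  assert (Hh : 0 <= h) by apply Cmod_ge_0.
  assert (M * h <= eps).
  { assert (Hlt : h < eps / (M + 1)) by lra.
    apply (Rmult_lt_compat_l (M + 1)) in Hlt; [|lra].
    replace ((M + 1) * (eps / (M + 1))) with eps in Hlt by (field; lra). nra. }
  simpl. nra.
Qed.

(** * The entire factor of the product of Bessel functions *)

Lemma CV_radius_ratio (a : nat -> R) (c : R) :
  (forall n, a n <> 0) -> (forall n, Rabs (a (S n)) <= c / INR (S n) * Rabs (a n)) ->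
  CV_radius a = p_infty.
Proof.
  intros Ha H. apply CV_radius_infinite_DAlembert; [exact Ha|].
  apply is_lim_seq_le_le with (fun _ => 0) (fun n => c * / INR (S n)).
  - intros n. split; [apply Rabs_pos|].
    unfold Rdiv. rewrite Rabs_mult, Rabs_inv.
    pose proof (Rabs_pos_lt _ (Ha n)).
    apply (Rmult_le_reg_r (Rabs (a n))); [assumption|].
    rewrite Rmult_assoc, Rinv_l, Rmult_1_r by lra. apply H.
  - apply is_lim_seq_const.
  - replace (Finite 0) with (Rbar_mult c 0) by (simpl; f_equal; ring).
    apply (is_lim_seq_scal_l (fun n => / INR (S n)) c 0).
    apply (is_lim_seq_incr_1 (fun n => / INR n)).
    apply (is_lim_seq_inv INR p_infty); [apply is_lim_seq_INR|discriminate].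
Qed.

Lemma CV_radius_theta (a : nat -> R) : CV_radius (theta a) = CV_radius a.
Proof.
  rewrite <- (CV_radius_derive a), <- (CV_radius_incr_1 (PS_derive a)).
  apply CV_radius_ext.
  intros [|n]; unfold theta, PS_incr_1, PS_derive; simpl; [|reflexivity].
  now rewrite Rmult_0_l.
Qed.

Lemma CV_radius_alternate (a : nat -> R) : CV_radius (alternate a) = CV_radius a.
Proof.
  assert (H : forall n, Rabs (alternate a n) = Rabs (a n)).
  { intros n. unfold alternate. rewrite Rabs_mult, pow_1_abs. ring. }
  apply Rbar_le_antisym; apply CV_radius_Rabs; intros n; rewrite H; lra.
Qed.

Lemma PSeries_theta (a : nat -> R) (x : R) :
  PSeries (theta a) x = x * PSeries (PS_derive a) x.
Proof.
  rewrite <- PSeries_incr_1. apply PSeries_ext.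
  intros [|n]; unfold theta, PS_incr_1, PS_derive; simpl; [|reflexivity].
  now rewrite Rmult_0_l.
Qed.

Lemma ex_pseries_in (a : nat -> R) (x : R) :
  0 <= x -> Rbar_lt x (CV_radius a) -> ex_series (fun n => a n * x ^ n).
Proof.
  intros Hx H. apply ex_series_Rabs, CV_disk_inside.
  now rewrite Rabs_pos_eq.
Qed.

Lemma PSeries_le (a b : nat -> R) (x y : R) :
  0 <= x <= y -> (forall n, 0 <= a n <= b n) -> Rbar_lt y (CV_radius b) ->
  PSeries a x <= PSeries b y.
Proof.
  intros Hx Hab Hy. apply Series_le; [|apply ex_pseries_in; [lra|exact Hy]].
  intros n. split.
  - apply Rmult_le_pos; [apply Hab|apply pow_le; lra].
  - apply Rmult_le_compat; [apply Hab|apply pow_le; lra|apply Hab|apply pow_incr; lra].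
Qed.

Lemma PSeries_head (a : nat -> R) (x : R) : 0 <= x -> Rbar_lt x (CV_radius a) ->
  PSeries a x = a O + x * PSeries (fun n => a (S n)) x.
Proof.
  intros Hx H. apply PSeries_decr_1. apply CV_radius_inside.
  now rewrite Rabs_pos_eq.
Qed.

(** A quantitative form that yields both strict monotonicity and divergence at
    infinity. *)
Lemma PSeries_increment (a : nat -> R) (x y : R) :
  0 <= x <= y -> (forall n, 0 <= a (S n)) -> Rbar_lt y (CV_radius a) ->
  a 1%nat * (y - x) <= PSeries a y - PSeries a x.
Proof.
  intros Hx Ha Hy.
  assert (Hx' : Rbar_lt x (CV_radius a)).
  { eapply Rbar_le_lt_trans; [|exact Hy]. simpl; lra. }
  rewrite (PSeries_head a x), (PSeries_head a y) by (assumption || lra).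
  assert (Hc : CV_radius (fun n => a (S n)) = CV_radius a) by apply (CV_radius_decr_1 a).
  assert (H1 : PSeries (fun n => a (S n)) x <= PSeries (fun n => a (S n)) y).
  { apply PSeries_le; [exact Hx|intros n; split; [apply Ha|lra]|now rewrite Hc]. }
  assert (H0 : a 1%nat <= PSeries (fun n => a (S n)) y).
  { rewrite <- (PSeries_0 (fun n => a (S n))).
    apply PSeries_le; [lra|intros n; split; [apply Ha|lra]|now rewrite Hc]. }
  nra.
Qed.

Lemma Cmod_CPSeries_le_major (a b : nat -> R) (z : C) :
  (forall n, Rabs (a n) <= b n) -> Rbar_lt (Cmod z) (CV_radius b) ->
  Cmod (CPSeries a z) <= PSeries b (Cmod z).
Proof.
  intros Hab Hz.
  assert (Ha : Rbar_lt (Cmod z) (CV_radius a)).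
  { eapply Rbar_lt_le_trans; [exact Hz|]. apply CV_radius_Rabs.
    intros n. eapply Rle_trans; [apply Hab|apply Rle_abs]. }
  eapply Rle_trans; [apply Cmod_Cseries_le; now apply CPSeries_absolute|].
  apply Series_le; [|apply ex_pseries_in; [apply Cmod_ge_0|exact Hz]].
  intros n. split; [apply Cmod_ge_0|].
  rewrite Cmod_term, Rabs_mult.
  pose proof (pow_le _ n (Cmod_ge_0 z)) as Hp.
  rewrite (Rabs_pos_eq (Cmod z ^ n)) by exact Hp.
  apply Rmult_le_compat_r; [exact Hp|apply Hab].
Qed.

Lemma conv_geometric (n : nat) (x : R) : forall a b : nat -> R,
  conv a b n * x ^ n = conv (fun k => a k * x ^ k) (fun k => b k * x ^ k) n.
Proof.
  induction n as [|n IH]; intros a b; [simpl; ring|].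
  rewrite !conv_succ.
  rewrite (conv_ext n (fun k => a (S k) * x ^ S k) _
    (fun k => x * (a (S k) * x ^ k)) (fun k => b k * x ^ k));
    [|intros; simpl; ring|reflexivity].
  rewrite conv_scal_l, <- (IH (fun k => a (S k))). simpl. ring.
Qed.

(** The product of the truncations has all terms of the truncated product, and
    further nonnegative ones. *)
Lemma sum_conv_le (N : nat) : forall a b : nat -> R,
  (forall n, 0 <= a n) -> (forall n, 0 <= b n) ->
  sum_f_R0 (conv a b) N <= sum_f_R0 a N * sum_f_R0 b N.
Proof.
  induction N as [|N IH]; intros a b Ha Hb; [simpl; lra|].
  assert (HB : sum_f_R0 b N <= sum_f_R0 b (S N)) by (simpl; specialize (Hb (S N)); lra).
  assert (HA : 0 <= sum_f_R0 (fun k => a (S k)) N) by (apply cond_pos_sum; intros; apply Ha).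
  rewrite (decomp_sum (conv a b)), (decomp_sum a) by lia. simpl pred.
  rewrite (sum_eq _ (fun n => a O * b (S n) + conv (fun k => a (S k)) b n))
    by reflexivity.
  rewrite plus_sum.
  rewrite (sum_eq (fun n => a O * b (S n)) (fun n => b (S n) * a O)) by (intros; ring).
  rewrite <- scal_sum.
  specialize (IH (fun k => a (S k)) b (fun k => Ha (S k)) Hb).
  assert (HH : sum_f_R0 b (S N) = b O + sum_f_R0 (fun k => b (S k)) N)
    by (rewrite (decomp_sum b) by lia; reflexivity).
  change (conv a b 0) with (a O * b O).
  rewrite Rmult_plus_distr_r.
  replace (a O * sum_f_R0 b (S N))
    with (a O * b O + a O * sum_f_R0 (fun k => b (S k)) N) by (rewrite HH; ring).
  assert (sum_f_R0 (fun k => a (S k)) N * sum_f_R0 b N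
     <= sum_f_R0 (fun k => a (S k)) N * sum_f_R0 b (S N))
    by (apply Rmult_le_compat_l; assumption).
  lra.
Qed.

Lemma is_derive_plus_eq (f g : R -> R) (x lf lg l : R) :
  is_derive f x lf -> is_derive g x lg -> l = lf + lg ->
  is_derive (fun y => f y + g y) x l.
Proof.
  intros Hf Hg ->. exact (is_derive_plus (K:=R_AbsRing) (V:=R_NormedModule) f g x lf lg Hf Hg).
Qed.

Lemma is_derive_mult_eq (f g : R -> R) (x lf lg l : R) :
  is_derive f x lf -> is_derive g x lg -> l = lf * g x + f x * lg ->
  is_derive (fun y => f y * g y) x l.
Proof.
  intros Hf Hg ->. exact (is_derive_mult (K:=R_AbsRing) f g x lf lg Hf Hg Rmult_comm).
Qed.

Lemma is_derive_monomial (c x : R) (n : nat) :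
  is_derive (fun y => c * y ^ S n) x (c * (INR (S n) * x ^ n)).
Proof.
  auto_derive; [auto|]. rewrite S_INR. destruct n; simpl; ring.
Qed.

Lemma exp_le_1 (x : R) : x <= 0 -> exp x <= 1.
Proof.
  intros [H| ->]; rewrite <- exp_0; [left; now apply exp_increasing|lra].
Qed.

Section EntirePart.
Variable nu : R.
Hypothesis nu_gt : -1 < nu.

Local Notation e := (e_coef nu).
Local Notation t := (t_coef nu).
Local Notation q := (q_coef nu).

Lemma j_coef_radius : CV_radius (j_coef nu) = p_infty.
Proof.
  apply CV_radius_ratio with (/ (4 * (1 + nu))).
  - induction n as [|n IH]; [simpl; lra|].
    pose proof (index_plus_nu_pos nu nu_gt n). pose proof (lt_0_INR (S n) ltac:(lia)).
    change (- j_coef nu n / (4 * INR (S n) * (INR (S n) + nu)) <> 0).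
    unfold Rdiv. apply Rmult_integral_contrapositive_currified; [lra|].
    apply Rinv_neq_0_compat. nra.
  - intros n.
    pose proof (index_plus_nu_pos nu nu_gt n). pose proof (lt_0_INR (S n) ltac:(lia)).
    change (j_coef nu (S n)) with (- j_coef nu n / (4 * INR (S n) * (INR (S n) + nu))).
    unfold Rdiv. rewrite Rabs_mult, Rabs_Ropp, Rabs_inv, Rmult_comm.
    apply Rmult_le_compat_r; [apply Rabs_pos|].
    rewrite Rabs_pos_eq by nra. rewrite <- Rinv_mult.
    rewrite S_INR in *. pose proof (pos_INR n).
    apply Rinv_le_contravar; [nra|].
    assert ((INR n + 1) * (1 + nu) <= (INR n + 1) * (INR n + 1 + nu)) by nra. lra.
Qed.

Lemma e_coef_radius : CV_radius (e_coef nu) = p_infty.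
Proof.
  rewrite <- CV_radius_alternate.
  apply CV_radius_ratio with (/ (16 * (1 + nu) ^ 3)).
  - intros n. pose proof (alternate_e_coef_pos nu nu_gt n). lra.
  - intros n. unfold alternate. rewrite !Rabs_mult, !pow_1_abs, !Rmult_1_l.
    rewrite e_coef_succ by exact nu_gt.
    pose proof (pos_INR n). rewrite S_INR.
    unfold Rdiv. rewrite Rabs_mult, Rabs_Ropp, Rabs_inv, Rmult_comm.
    apply Rmult_le_compat_r; [apply Rabs_pos|].
    assert (A : 1 + nu <= INR n + 1 + nu) by lra.
    assert (B : 1 + nu <= 2 * (INR n + 1) + nu) by lra.
    assert (D : 1 + nu <= 2 * (INR n + 1) + nu - 1) by lra.
    assert (P : 0 < 1 + nu) by lra.
    set (u := INR n + 1 + nu) in *. set (v := 2 * (INR n + 1) + nu) in *.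
    set (w := v - 1) in *. set (c := 1 + nu) in *.
    assert (Q1 : c * c <= u * v) by (apply Rmult_le_compat; lra).
    assert (Q2 : c * c * c <= u * v * w).
    { apply Rmult_le_compat; try lra. nra. }
    assert (Q0 : 0 < c * c * c) by (repeat apply Rmult_lt_0_compat; lra).
    replace (16 * (INR n + 1) * u * v * w) with (16 * (u * v * w) * (INR n + 1)) by ring.
    rewrite Rabs_pos_eq by nra. rewrite <- Rinv_mult.
    apply Rinv_le_contravar; [simpl; nra|].
    apply Rmult_le_compat_r; [lra|]. simpl. lra.
Qed.

Lemma j_in (z : C) : Rbar_lt (Cmod z) (CV_radius (j_coef nu)).
Proof. now rewrite j_coef_radius. Qed.

Lemma e_in (z : C) : Rbar_lt (Cmod z) (CV_radius (e_coef nu)).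
Proof. now rewrite e_coef_radius. Qed.

(** The odd coefficients of the product vanish, so the even ones sum alone. *)
Lemma CPSeries_e_coef_square (x : C) :
  CPSeries (e_coef nu) (x ^ 2)%C = (CPSeries (j_coef nu) x * CPSeries (j_coef nu) (- x))%C.
Proof.
  rewrite <- CPSeries_alternate.
  assert (Ha : Rbar_lt (Cmod x) (CV_radius (alternate (j_coef nu))))
    by (rewrite CV_radius_alternate; apply j_in).
  destruct (CPSeries_mult_is _ _ x (j_in x) Ha) as [H1 H2].
  apply is_Cseries_unique.
  assert (H0 : forall n, jj_coef nu (S (2 * n)) = 0) by apply jj_coef_odd.
  split.
  - apply is_series_even_part in H1.
    + apply is_series_ext with (2 := H1). intros n. rewrite Cpow_mult_r. reflexivity.
    + intros n. fold (jj_coef nu). rewrite H0, Cmult_0_l. reflexivity.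
  - apply is_series_even_part in H2.
    + apply is_series_ext with (2 := H2). intros n. rewrite Cpow_mult_r. reflexivity.
    + intros n. fold (jj_coef nu). rewrite H0, Cmult_0_l. reflexivity.
Qed.

Lemma PSeries_e_coef_square (x : R) :
  PSeries (e_coef nu) (x ^ 2) = PSeries (j_coef nu) x * PSeries (j_coef nu) (- x).
Proof.
  apply RtoC_inj. rewrite RtoC_mult, <- !CPSeries_real, RtoC_pow, CPSeries_e_coef_square.
  now rewrite RtoC_opp.
Qed.

Lemma j_is_derive (x : R) :
  is_derive (PSeries (j_coef nu)) x (PSeries (PS_derive (j_coef nu)) x).
Proof. apply is_derive_PSeries. now rewrite j_coef_radius. Qed.

Lemma j_continuity : continuity (PSeries (j_coef nu)).
Proof. intros x. apply PSeries_continuity. now rewrite j_coef_radius. Qed.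

Lemma e_continuity : continuity (PSeries (e_coef nu)).
Proof. intros x. apply PSeries_continuity. now rewrite e_coef_radius. Qed.

Lemma j_ode (x : R) :
  PSeries (theta (theta (j_coef nu))) x
  = - nu * PSeries (theta (j_coef nu)) x - x / 4 * PSeries (j_coef nu) x.
Proof.
  assert (Hj : CV_radius (theta (j_coef nu)) = p_infty)
    by (rewrite CV_radius_theta; apply j_coef_radius).
  rewrite (PSeries_ext _ (PS_plus (PS_scal (- nu) (theta (j_coef nu)))
    (PS_scal (- / 4) (PS_incr_1 (j_coef nu))))).
  - rewrite PSeries_plus, !PSeries_scal, PSeries_incr_1; [field| |].
    + apply ex_pseries_scal; [apply Rmult_comm|].
      apply CV_radius_inside. now rewrite Hj.
    + apply ex_pseries_scal; [apply Rmult_comm|].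
      apply CV_radius_inside. now rewrite CV_radius_incr_1, j_coef_radius.
  - intros n. pose proof (j_coef_ode nu nu_gt n) as H.
    unfold PS_plus, PS_scal. change (theta (theta (j_coef nu)) n
      = - nu * theta (j_coef nu) n + - / 4 * PS_incr_1 (j_coef nu) n).
    replace (PS_incr_1 (j_coef nu) n) with (shift_up (j_coef nu) n) by (now destruct n).
    rewrite <- H. unfold theta. ring.
Qed.

Definition q_sum (N : nat) (x : R) : R := sum_f_R0 (fun n => q n * x ^ n) N.
Definition q_sum_theta (N : nat) (x : R) : R := sum_f_R0 (fun n => theta q n * x ^ n) N.
(** The antiderivative of [q_sum N x / x], for the integrating factor below. *)
Definition q_sum_log (N : nat) (x : R) : R := sum_f_R0 (fun n => q n / INR n * x ^ n) N.

Lemma q_sum_log_derive (N : nat) (x : R) : x <> 0 ->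
  is_derive (q_sum_log N) x (q_sum N x / x).
Proof.
  intros Hx. induction N as [|N IH].
  - unfold q_sum_log, q_sum; simpl.
    auto_derive; [auto|]. unfold q_coef. simpl. field. exact Hx.
  - apply (is_derive_plus_eq (q_sum_log N) (fun y => q (S N) / INR (S N) * y ^ S N) x
      _ _ _ IH (is_derive_monomial _ x N)).
    change (q_sum (S N) x) with (q_sum N x + q (S N) * (x * x ^ N)).
    field. split; [apply not_0_INR; lia|exact Hx].
Qed.

Lemma q_sum_derive (N : nat) (x : R) :
  exists l, is_derive (q_sum N) x l /\ x * l = q_sum_theta N x /\
    (x = 0 -> N <> O -> l = q 1%nat).
Proof.
  induction N as [|N IH].
  - exists 0. unfold q_sum, q_sum_theta, theta; simpl. split; [auto_derive; auto|].
    split; [ring|]. intros _ H. now destruct H.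
  - destruct IH as [l [H1 [H2 H3]]].
    exists (l + q (S N) * (INR (S N) * x ^ N)). split; [|split].
    + apply (is_derive_plus_eq (q_sum N) (fun y => q (S N) * y ^ S N) x
        l _ _ H1 (is_derive_monomial _ x N)). reflexivity.
    + unfold q_sum_theta in *. simpl sum_f_R0. rewrite <- H2.
      unfold theta. simpl pow. ring.
    + intros Hx _. destruct N as [|N].
      * assert (Hl : l = 0).
        { apply (is_derive_unique (q_sum 0)) in H1. rewrite <- H1.
          unfold q_sum. simpl. rewrite (Derive_ext _ (fun _ => q 0%nat * 1)) by reflexivity.
          apply Derive_const. }
        rewrite Hl. simpl. ring.
      * rewrite H3 by (auto; lia). rewrite Hx. simpl. ring.
Qed.

(** The truncations of [q] are subsolutions of Riccati's equation, since squaring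
    a truncation only adds nonnegative terms. *)
Lemma q_sum_riccati (N : nat) (x : R) : 0 <= x ->
  q_sum_theta N x + nu * q_sum N x <= x / 4 + q_sum N x ^ 2.
Proof.
  intros Hx. unfold q_sum_theta, q_sum.
  apply Rle_trans with (sum_f_R0 (fun n => / 4 * shift_up unit_seq n * x ^ n) N
     + sum_f_R0 (conv (fun n => q n * x ^ n) (fun n => q n * x ^ n)) N).
  - rewrite scal_sum, <- plus_sum, <- plus_sum. apply Req_le, sum_eq.
    intros n _. rewrite <- conv_geometric.
    transitivity ((theta q n + nu * q n) * x ^ n); [ring|].
    rewrite (q_coef_riccati nu nu_gt n). ring.
  - apply Rplus_le_compat.
    + destruct N as [|N]; [simpl; lra|]. apply Req_le.
      induction N as [|N IH]; [simpl; field|].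
      rewrite tech5, IH. simpl. ring.
    + replace (sum_f_R0 (fun n => q n * x ^ n) N ^ 2)
        with (sum_f_R0 (fun n => q n * x ^ n) N * sum_f_R0 (fun n => q n * x ^ n) N) by ring.
      apply sum_conv_le; intros n;
        (apply Rmult_le_pos; [now apply q_coef_nonneg|now apply pow_le]).
Qed.

(** Comparison with the true solution [- x j'(x) / j(x)], as long as [j] has no
    zero: the defect [h] satisfies [x h' <= (q_sum - nu) h] and vanishes to
    second order at [0], so the integrating factor keeps it nonpositive. *)
Lemma q_sum_comparison (N : nat) (X x : R) :
  (forall y, 0 <= y < X -> 0 < PSeries (j_coef nu) y) -> 0 < x < X ->
  q_sum (S N) x * PSeries (j_coef nu) x <= - PSeries (theta (j_coef nu)) x.
Proof.
  intros Hj Hx.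
  set (h := fun y => q_sum (S N) y * PSeries (j_coef nu) y + PSeries (theta (j_coef nu)) y).
  assert (Hder : forall y, exists l, is_derive h y l /\
     (0 < y < X -> y * l <= (q_sum (S N) y - nu) * h y) /\ (y = 0 -> l = 0)).
  { intros y. destruct (q_sum_derive (S N) y) as [s' [Hs1 [Hs2 Hs3]]].
    assert (Hth : is_derive (PSeries (theta (j_coef nu))) y
       (PSeries (PS_derive (theta (j_coef nu))) y)).
    { apply is_derive_PSeries. now rewrite CV_radius_theta, j_coef_radius. }
    exists ((s' * PSeries (j_coef nu) y + q_sum (S N) y * PSeries (PS_derive (j_coef nu)) y)
       + PSeries (PS_derive (theta (j_coef nu))) y).
    split; [|split].
    - refine (is_derive_plus_eq _ _ y _ _ _ _ Hth eq_refl).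
      exact (is_derive_mult_eq _ _ y _ _ _ Hs1 (j_is_derive y) eq_refl).
    - intros Hy. unfold h.
      replace (y * _) with (y * s' * PSeries (j_coef nu) y
         + q_sum (S N) y * (y * PSeries (PS_derive (j_coef nu)) y)
         + y * PSeries (PS_derive (theta (j_coef nu))) y) by ring.
      rewrite Hs2, <- !PSeries_theta, j_ode.
      pose proof (q_sum_riccati (S N) y ltac:(lra)) as HR.
      specialize (Hj y ltac:(lra)).
      apply (Rmult_le_compat_r (PSeries (j_coef nu) y)) in HR; [|lra].
      nra.
    - intros ->. rewrite Hs3 by (auto; lia). rewrite !PSeries_0.
      unfold PS_derive, theta, q_coef. simpl.
      rewrite rayleigh_eq by exact nu_gt.
      unfold q_sum. rewrite (sum_eq _ (fun n => shift_up (rayleigh nu) n * 0 ^ n)) by reflexivity.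
      assert (Hz : forall M, sum_f_R0 (fun n => shift_up (rayleigh nu) n * 0 ^ n) M = 0).
      { induction M as [|M IH]; simpl; [ring|]. rewrite IH. ring. }
      rewrite Hz. simpl. field. lra. }
  assert (h0 : h 0 = 0).
  { unfold h. rewrite !PSeries_0. unfold q_sum, theta. rewrite decomp_sum by lia.
    rewrite (sum_eq _ (fun _ => 0)).
    - rewrite sum_cte. unfold q_coef. simpl. ring.
    - intros i _. simpl. ring. }
  set (Phi := fun y => exp (nu * ln y - q_sum_log (S N) y) * h y).
  assert (Hmono : forall y, 0 < y < x -> Phi x <= Phi y).
  { intros y Hy.
    assert (HP : forall c, 0 < c < X -> exists l, is_derive Phi c l /\ l <= 0).
    { intros c Hc. destruct (Hder c) as [l [Hl1 [Hl2 _]]]. specialize (Hl2 Hc).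
      set (E := exp (nu * ln c - q_sum_log (S N) c)).
      exists ((nu / c - q_sum (S N) c / c) * E * h c + E * l). split.
      - refine (is_derive_mult_eq (fun y => exp (nu * ln y - q_sum_log (S N) y)) h c
          _ _ _ _ Hl1 eq_refl).
        apply (is_derive_comp (K:=R_AbsRing) (V:=R_NormedModule) exp
          (fun y => nu * ln y - q_sum_log (S N) y) c E); [apply is_derive_exp|].
        apply (is_derive_minus (K:=R_AbsRing) (V:=R_NormedModule)
          (fun y => nu * ln y) (q_sum_log (S N)) c).
        + auto_derive; [lra|]. field; lra.
        + apply q_sum_log_derive. lra.
      - assert (HE : 0 < E) by apply exp_pos.
        replace (_ + _) with (E / c * (c * l - (q_sum (S N) c - nu) * h c)) by (field; lra).
        assert (0 < E / c) by (apply Rdiv_lt_0_compat; lra). nra. }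
    assert (HP' : forall c, exists l, 0 < c < X -> is_derive Phi c l /\ l <= 0).
    { intros c. destruct (classic (0 < c < X)) as [Hc|Hc].
      - destruct (HP c Hc) as [l Hl]. now exists l.
      - now exists 0. }
    destruct (MVT_gen Phi y x (Derive Phi)) as [c [Hc1 Hc2]].
    - intros c Hc. rewrite Rmin_left, Rmax_right in Hc by lra.
      destruct (HP c ltac:(lra)) as [l [Hl _]]. apply Derive_correct. now exists l.
    - intros c Hc. rewrite Rmin_left, Rmax_right in Hc by lra.
      destruct (HP c ltac:(lra)) as [l [Hl _]].
      apply continuity_pt_filterlim, (ex_derive_continuous Phi). now exists l.
    - rewrite Rmin_left, Rmax_right in Hc1 by lra.
      destruct (HP c ltac:(lra)) as [l [Hl Hl0]].
      apply is_derive_unique in Hl. rewrite Hl in Hc2. nra. }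
  assert (Hphi : Phi x <= 0).
  { apply Rnot_lt_le. intros Hpos.
    destruct (Hder 0) as [l [Hl [_ Hl0]]]. rewrite Hl0 in Hl by reflexivity.
    destruct (is_derive_0_elim h 0 Hl (Phi x / 2)) as [d [Hd Hh]]; [lra|].
    set (y := Rmin (Rmin (d / 2) (x / 2)) 1).
    assert (Hy : 0 < y) by (unfold y; repeat apply Rmin_pos; lra).
    pose proof (Rmin_l (Rmin (d / 2) (x / 2)) 1). pose proof (Rmin_r (Rmin (d / 2) (x / 2)) 1).
    pose proof (Rmin_l (d / 2) (x / 2)). pose proof (Rmin_r (d / 2) (x / 2)).
    fold y in H, H0.
    specialize (Hh y). rewrite Rabs_pos_eq in Hh by lra.
    specialize (Hh ltac:(lra)). rewrite h0 in Hh.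
    specialize (Hmono y ltac:(lra)).
    assert (Hhy : h y <= Phi x / 2 * y).
    { pose proof (Rle_abs (h y - 0 - y * 0)). lra. }
    assert (HS : 0 <= q_sum_log (S N) y).
    { apply cond_pos_sum. intros n. apply Rmult_le_pos; [|apply pow_le; lra].
      destruct n as [|n]; [unfold q_coef; simpl; unfold Rdiv; rewrite Rmult_0_l; lra|].
      apply Rmult_le_pos; [now apply q_coef_nonneg|].
      left. apply Rinv_0_lt_compat, lt_0_INR. lia. }
    assert (Hexp : exp (nu * ln y - q_sum_log (S N) y) * y <= 1).
    { rewrite <- (exp_ln y) at 3 by exact Hy. rewrite <- exp_plus.
      apply exp_le_1. assert (ln y <= 0) by (rewrite <- ln_1; apply ln_le; lra). nra. }
    assert (Phi y <= Phi x / 2).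
    { unfold Phi at 1. set (E := exp _) in *.
      assert (0 < E) by apply exp_pos.
      apply Rle_trans with (E * (Phi x / 2 * y)); [apply Rmult_le_compat_l; lra|].
      replace (E * (Phi x / 2 * y)) with (Phi x / 2 * (E * y)) by ring.
      rewrite <- (Rmult_1_r (Phi x / 2)) at 2. apply Rmult_le_compat_l; lra. }
    lra. }
  unfold Phi, h in Hphi.
  set (E := exp _) in Hphi. assert (0 < E) by apply exp_pos.
  apply Rnot_lt_le. intros Hc.
  assert (0 < E * (q_sum (S N) x * PSeries (j_coef nu) x + PSeries (theta (j_coef nu)) x))
    by (apply Rmult_lt_0_compat; lra).
  lra.
Qed.

Lemma t_coef_nonneg (n : nat) : 0 <= t n.
Proof. now apply q_coef_nonneg. Qed.

Lemma t_coef_1_pos : 0 < t 1%nat.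
Proof. apply (rayleigh_pos nu nu_gt 1). Qed.

(** By comparison the terms [t_n (x^2)^n = q_(2n) x^(2n)] are bounded. *)
Lemma t_radius_ge (X x : R) :
  (forall y, 0 <= y < X -> 0 < PSeries (j_coef nu) y) -> 0 < x < X ->
  Rbar_le (x ^ 2) (CV_radius t).
Proof.
  intros Hj Hx.
  apply (proj1 (CV_radius_bounded t)).
  exists (- PSeries (theta (j_coef nu)) x / PSeries (j_coef nu) x).
  intros n.
  pose proof (Hj x ltac:(lra)) as Hp.
  rewrite <- pow_mult, Rabs_pos_eq
    by (apply Rmult_le_pos; [apply t_coef_nonneg|apply pow_le; lra]).
  apply (Rmult_le_reg_r _ _ _ Hp).
  unfold Rdiv. rewrite (Rmult_assoc (- _)), Rinv_l, Rmult_1_r by lra.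
  eapply Rle_trans; [|apply (q_sum_comparison (2 * n) X x Hj Hx)].
  apply Rmult_le_compat_r; [lra|].
  unfold q_sum. simpl sum_f_R0.
  assert (Hq : forall k, 0 <= q k * x ^ k).
  { intros k. apply Rmult_le_pos; [now apply q_coef_nonneg|apply pow_le; lra]. }
  assert (Hs : forall k, q k * x ^ k <= sum_f_R0 (fun m => q m * x ^ m) k).
  { intros [|k]; simpl; [lra|].
    pose proof (cond_pos_sum (fun m => q m * x ^ m) k Hq). simpl in H. lra. }
  specialize (Hs (2 * n)%nat). specialize (Hq (S (2 * n))).
  change (t n) with (q (2 * n)%nat). simpl in *. lra.
Qed.

(** A zero of [j] at [x] is a zero of [E] at [x^2], so [j] is positive as long as
    [E] is; continuity of [E] provides the room beyond [r]. *)
Lemma t_radius_gt (r : R) :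
  0 <= r -> (forall s, 0 <= s <= r -> 0 < PSeries e s) -> Rbar_lt r (CV_radius t).
Proof.
  intros Hr He.
  assert (Hc : continuous (PSeries e) r)
    by (apply continuity_pt_filterlim, e_continuity).
  pose proof (proj1 (filterlim_locally (F:=locally r) _ _) Hc
    (mkposreal _ (He r ltac:(lra)))) as [d Hd].
  pose proof (cond_pos d) as Hd0.
  assert (He' : forall s, 0 <= s < r + d -> 0 < PSeries e s).
  { intros s Hs. destruct (Rle_lt_dec s r) as [H|H]; [apply He; lra|].
    assert (Hb : Rabs (s - r) < d) by (rewrite Rabs_pos_eq; lra).
    specialize (Hd s Hb). change (Rabs (PSeries e s - PSeries e r) < PSeries e r) in Hd.
    apply Rabs_lt_between in Hd. lra. }
  set (X := sqrt (r + d)).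
  assert (HX : forall y, 0 <= y < X -> 0 < PSeries (j_coef nu) y).
  { intros y Hy.
    assert (Hnz : forall x, 0 <= x < X -> PSeries (j_coef nu) x <> 0).
    { intros x Hx H0. pose proof (PSeries_e_coef_square x) as H. rewrite H0, Rmult_0_l in H.
      apply (Rlt_irrefl 0). rewrite <- H at 2. apply He'. split; [apply pow2_ge_0|].
      rewrite <- (sqrt_sqrt (r + d)) by lra. fold X. simpl. nra. }
    apply Rnot_le_lt. intros Hle.
    destruct (IVT_gen (PSeries (j_coef nu)) 0 y 0 j_continuity) as [x [Hx1 Hx2]].
    - rewrite PSeries_0. simpl j_coef. rewrite Rmin_right, Rmax_left by lra. lra.
    - rewrite Rmin_left, Rmax_right in Hx1 by lra. apply (Hnz x); [lra|exact Hx2]. }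
  set (x := sqrt (r + d / 2)).
  assert (Hx : 0 < x < X).
  { split; [apply sqrt_lt_R0; lra|]. apply sqrt_lt_1_alt. lra. }
  pose proof (t_radius_ge X x HX Hx) as H.
  eapply Rbar_lt_le_trans; [|exact H].
  unfold x. simpl. rewrite Rmult_1_r, sqrt_sqrt by lra. lra.
Qed.

(** The coefficients of [Q] with [w Q' = T], that is [Q = - log E]. *)
Definition log_coef (n : nat) : R := t_coef nu n / INR n.

Lemma log_coef_derive (n : nat) : PS_derive log_coef n = t (S n).
Proof.
  unfold PS_derive, log_coef. field. apply not_0_INR. lia.
Qed.

Lemma log_coef_radius : CV_radius log_coef = CV_radius t.
Proof.
  rewrite <- CV_radius_derive, <- (CV_radius_decr_1 t).
  apply CV_radius_ext. apply log_coef_derive.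
Qed.

(** [E' = - Q' E] coefficientwise makes [E exp Q] constant. *)
Lemma CPSeries_e_coef_exp (w : C) : Rbar_lt (Cmod w) (CV_radius t) ->
  CPSeries e w = Cexp (- CPSeries log_coef w)%C.
Proof.
  intros Hw.
  set (f := fun y => (CPSeries e y * Cexp (CPSeries log_coef y))%C).
  assert (Hf : f w = f (0%R * w)%C).
  { apply Cder_zero_segment; [lra|]. intros s Hs.
    assert (Hy : Rbar_lt (Cmod (s * w)%C) (CV_radius t)).
    { eapply Rbar_le_lt_trans; [|exact Hw]. now apply Cmod_scal_le. }
    set (y := (s * w)%C) in *.
    pose proof (is_Cder_CPSeries e y (e_in y)) as D1.
    assert (D2 : is_Cder (CPSeries log_coef) y (CPSeries (PS_derive log_coef) y)).
    { apply is_Cder_CPSeries. now rewrite log_coef_radius. }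
    eapply is_Cder_eq; [exact (is_Cder_mult _ _ _ _ _ D1 (Cexp_comp_der _ _ _ D2))|].
    assert (HE : CPSeries (PS_derive e) y = (- (CPSeries (PS_derive log_coef) y * CPSeries e y))%C).
    { replace (- (CPSeries (PS_derive log_coef) y * CPSeries e y))%C
        with (RtoC (-1) * (CPSeries (PS_derive log_coef) y * CPSeries e y))%C
        by (replace (RtoC (-1)) with (- RtoC 1)%C
              by (apply injective_projections; simpl; ring); ring).
      apply is_Cseries_unique.
      apply is_Cseries_ext with
        (fun n => RtoC (-1) * (RtoC (conv (PS_derive log_coef) e n) * y ^ n))%C.
      - intros n.
        replace (PS_derive e n) with (-1 * conv (PS_derive log_coef) e n).
        + rewrite RtoC_mult. ring.
        + pose proof (theta_e_coef nu nu_gt (S n)) as H.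
          change (PS_derive e n) with (theta (e_coef nu) (S n)). rewrite H.
          rewrite (conv_ext (S n) (t_coef nu) (e_coef nu)
            (shift_up (PS_derive log_coef)) (e_coef nu)).
          * rewrite conv_shift_up_l. ring.
          * intros [|k] _; [reflexivity|]. symmetry. apply log_coef_derive.
          * reflexivity.
      - apply is_Cseries_scal, CPSeries_mult_is; [|apply e_in].
        rewrite CV_radius_derive. now rewrite log_coef_radius. }
    rewrite HE. ring. }
  replace (0%R * w)%C with (RtoC 0) in Hf by ring.
  unfold f in Hf. rewrite !CPSeries_0 in Hf.
  unfold log_coef at 2 in Hf. rewrite e_coef_0 in Hf.
  replace (t_coef nu 0 / INR 0) with 0 in Hf by (change (t_coef nu 0) with 0; unfold Rdiv; ring).
  rewrite Cexp_0 in Hf.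
  pose proof (Cexp_add (CPSeries log_coef w) (- CPSeries log_coef w)%C) as HA.
  replace (CPSeries log_coef w + - CPSeries log_coef w)%C with (RtoC 0) in HA by ring.
  rewrite Cexp_0 in HA.
  replace (CPSeries e w) with (CPSeries e w * (Cexp (CPSeries log_coef w) * Cexp (- CPSeries log_coef w)))%C
    by (rewrite <- HA; ring).
  rewrite Cmult_assoc, Hf. ring.
Qed.
End EntirePart.

(** * The values of the logarithmic derivative *)

Lemma Rbar_le_p_infty (x : Rbar) : Rbar_le x p_infty.
Proof. destruct x; simpl; auto. Qed.

Definition theta_minus (k : R) (a : nat -> R) (n : nat) : R := (INR n - k) * a n.

Definition tail_coef (a : nat -> R) (n : nat) : R :=
  match n with O => 0 | S _ => a n end.

Lemma CV_radius_tail_coef (a : nat -> R) : Rbar_le (CV_radius a) (CV_radius (tail_coef a)).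
Proof.
  apply CV_radius_Rabs. intros [|n]; simpl; [rewrite Rabs_R0; apply Rabs_pos|lra].
Qed.

Lemma CV_radius_theta_minus (k : R) (a : nat -> R) :
  k <> 0 -> CV_radius a = p_infty -> CV_radius (theta_minus k a) = p_infty.
Proof.
  intros Hk Ha.
  rewrite (CV_radius_ext _ (PS_plus (theta a) (PS_scal (- k) a))).
  - apply Rbar_le_antisym; [apply Rbar_le_p_infty|].
    eapply Rbar_le_trans; [|apply CV_radius_plus].
    rewrite CV_radius_theta, CV_radius_scal, Ha by now apply Ropp_neq_0_compat.
    simpl. exact I.
  - intros n. unfold theta_minus, theta, PS_plus, PS_scal.
    change ((INR n - k) * a n = INR n * a n + - k * a n). ring.
Qed.

Lemma CPSeries_theta_minus (k : R) (a : nat -> R) (z : C) :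
  Rbar_lt (Cmod z) (CV_radius a) ->
  CPSeries (theta_minus k a) z = (CPSeries (theta a) z - RtoC k * CPSeries a z)%C.
Proof.
  intros Hz. apply is_Cseries_unique.
  assert (Hz' : Rbar_lt (Cmod z) (CV_radius (theta a))) by now rewrite CV_radius_theta.
  pose proof (is_Cseries_plus _ _ _ _ (CPSeries_correct _ z Hz')
    (is_Cseries_scal (- RtoC k)%C _ _ (CPSeries_correct _ z Hz))) as K.
  replace (CPSeries (theta a) z - RtoC k * CPSeries a z)%C
    with (CPSeries (theta a) z + - RtoC k * CPSeries a z)%C by ring.
  apply is_Cseries_ext with (2 := K). intros n.
  unfold theta_minus, theta. rewrite !RtoC_mult, RtoC_minus. ring.
Qed.

Lemma CPSeries_tail_coef (a : nat -> R) (z : C) :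
  Rbar_lt (Cmod z) (CV_radius a) -> CPSeries (tail_coef a) z = (CPSeries a z - RtoC (a O))%C.
Proof.
  intros Hz. apply is_Cseries_unique.
  pose proof (CPSeries_correct _ z Hz) as K.
  assert (K0 : is_Cseries (fun n => match n with O => - RtoC (a O) | _ => RtoC 0 end)%C
     (- RtoC (a O))%C).
  { assert (Z : is_Cseries (fun _ => RtoC 0) (RtoC 0)).
    { pose proof (is_Cseries_scal (RtoC 0) _ _ K) as Z. rewrite Cmult_0_l in Z.
      apply is_Cseries_ext with (2 := Z). intros n. ring. }
    pose proof (is_Cseries_cons
      (fun n => match n with O => - RtoC (a O) | _ => RtoC 0 end)%C _ Z) as Z1.
    cbv beta iota in Z1. now rewrite Cplus_0_r in Z1. }
  apply is_Cseries_ext with (2 := is_Cseries_plus _ _ _ _ K K0).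
  intros [|n]; simpl; ring.
Qed.

Lemma PSeries_theta_minus (k : R) (a : nat -> R) (x : R) :
  CV_radius a = p_infty ->
  PSeries (theta_minus k a) x = PSeries (theta a) x - k * PSeries a x.
Proof.
  intros Ha. apply RtoC_inj. rewrite RtoC_minus, RtoC_mult, <- !CPSeries_real.
  apply CPSeries_theta_minus. now rewrite Ha.
Qed.

Lemma PSeries_tail_coef (a : nat -> R) (x : R) :
  CV_radius a = p_infty -> PSeries (tail_coef a) x = PSeries a x - a O.
Proof.
  intros Ha. apply RtoC_inj. rewrite RtoC_minus, <- !CPSeries_real.
  apply CPSeries_tail_coef. now rewrite Ha.
Qed.

Section RadiusEquations.
Variable nu : R.
Hypothesis nu_gt : -1 < nu.
Local Notation e := (e_coef nu).
Local Notation t := (t_coef nu).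

Lemma t_radius_pos : Rbar_lt 0 (CV_radius t).
Proof.
  apply t_radius_gt; [exact nu_gt|lra|]. intros s Hs.
  replace s with 0 by lra. rewrite PSeries_0, e_coef_0. lra.
Qed.

Lemma PSeries_e_coef_exp (r : R) : 0 <= r -> Rbar_lt r (CV_radius t) ->
  PSeries e r = exp (- PSeries (log_coef nu) r).
Proof.
  intros H0 Hr. apply RtoC_inj.
  rewrite <- CPSeries_real, (CPSeries_e_coef_exp nu nu_gt), CPSeries_real, <- RtoC_opp.
  - apply Cexp_RtoC.
  - now rewrite Cmod_R, Rabs_pos_eq.
Qed.

Lemma t_increasing (r s : R) : 0 <= r < s -> Rbar_lt s (CV_radius t) ->
  PSeries t r < PSeries t s.
Proof.
  intros Hr Hs. pose proof (t_coef_1_pos nu nu_gt) as H1.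
  pose proof (PSeries_increment t r s) as H.
  assert (t 1%nat * (s - r) <= PSeries t s - PSeries t r).
  { apply H; [lra|intros; now apply t_coef_nonneg|exact Hs]. }
  nra.
Qed.

(** A bound [M] for [T] would bound the logarithm [Q <= T] of [1 / E], so that
    [E] would stay positive up to the radius of convergence of [T], and beyond
    it by continuity. *)
Lemma t_unbounded (M : R) :
  exists r, 0 <= r /\ Rbar_lt r (CV_radius t) /\ M < PSeries t r.
Proof.
  apply NNPP. intros Hno.
  assert (HM : forall r, 0 <= r -> Rbar_lt r (CV_radius t) -> PSeries t r <= M).
  { intros r H0 Hr. apply Rnot_lt_le. intros H. apply Hno. now exists r. }
  assert (Ht0 : PSeries t 0 = 0) by apply PSeries_0.
  pose proof (t_coef_1_pos nu nu_gt) as Ht1.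
  assert (HM0 : 0 <= M).
  { rewrite <- Ht0. apply HM; [lra|apply t_radius_pos]. }
  destruct (CV_radius t) as [rho| |] eqn:Hrho.
  - assert (Hpos : 0 < rho).
    { pose proof t_radius_pos as H. rewrite Hrho in H. exact H. }
    assert (Hlow : forall r, 0 <= r < rho -> exp (- M) <= PSeries e r).
    { intros r Hr.
      assert (Hrr : Rbar_lt r (CV_radius t)) by (rewrite Hrho; simpl; lra).
      rewrite PSeries_e_coef_exp by (lra || exact Hrr).
      assert (HQ : PSeries (log_coef nu) r <= PSeries t r).
      { apply PSeries_le; [lra| |exact Hrr].
        intros [|n]; unfold log_coef.
        - change (t_coef nu 0) with 0. unfold Rdiv. rewrite Rmult_0_l. lra.
        - pose proof (t_coef_nonneg nu nu_gt (S n)) as Hn.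
          assert (1 <= INR (S n)) by (rewrite S_INR; pose proof (pos_INR n); lra).
          split; [apply Rmult_le_pos; [exact Hn|left; apply Rinv_0_lt_compat; lra]|].
          apply (Rmult_le_reg_r (INR (S n))); [lra|].
          unfold Rdiv. rewrite Rmult_assoc, Rinv_l by lra. nra. }
      specialize (HM r ltac:(lra) ltac:(simpl; lra)).
      destruct (Rle_lt_or_eq_dec (- M) (- PSeries (log_coef nu) r)) as [H|H]; [lra| |].
      - left. now apply exp_increasing.
      - rewrite H. lra. }
    assert (Hend : 0 < PSeries e rho).
    { apply Rnot_le_lt. intros Hle.
      assert (Hc : continuous (PSeries e) rho)
        by (apply continuity_pt_filterlim, e_continuity; exact nu_gt).
      pose proof (exp_pos (- M)) as HeM.
      pose proof (proj1 (filterlim_locally (F:=locally rho) _ _) Hc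
        (mkposreal _ HeM)) as [d Hd].
      pose proof (cond_pos d) as Hd0.
      set (s := Rmax (rho / 2) (rho - d / 2)).
      assert (Hs : 0 <= s < rho /\ rho - s < d).
      { unfold s. pose proof (Rmax_l (rho / 2) (rho - d / 2)).
        pose proof (Rmax_r (rho / 2) (rho - d / 2)).
        split; [split; [lra|apply Rmax_lub_lt; lra]|lra]. }
      assert (Hb : Rabs (s - rho) < d) by (rewrite Rabs_left; lra).
      specialize (Hd s Hb). change (Rabs (PSeries e s - PSeries e rho) < exp (- M)) in Hd.
      apply Rabs_lt_between in Hd. specialize (Hlow s (proj1 Hs)). lra. }
    assert (Hlt : Rbar_lt rho (CV_radius t)).
    { apply t_radius_gt; [exact nu_gt|lra|]. intros s Hs.
      destruct (Rle_lt_or_eq_dec s rho) as [H|H]; [lra| |now rewrite H].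
      eapply Rlt_le_trans; [apply exp_pos|apply Hlow; lra]. }
    rewrite Hrho in Hlt. simpl in Hlt. lra.
  - set (r := (M + 1) / t 1%nat).
    assert (Hr : 0 < r) by (apply Rdiv_lt_0_compat; lra).
    assert (H : t 1%nat * (r - 0) <= PSeries t r - PSeries t 0).
    { apply PSeries_increment; [lra|intros; now apply t_coef_nonneg|now rewrite Hrho]. }
    replace (t 1%nat * (r - 0)) with (M + 1) in H by (unfold r; field; lra).
    specialize (HM r ltac:(lra) I). lra.
  - pose proof t_radius_pos as H. now rewrite Hrho in H.
Qed.

Lemma t_level (lambda : R) : 0 < lambda ->
  exists r, 0 < r /\ Rbar_lt r (CV_radius t) /\ PSeries t r = lambda.
Proof.
  intros Hl. destruct (t_unbounded lambda) as [s [Hs0 [Hs1 Hs2]]].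
  assert (Ht0 : PSeries t 0 = 0) by apply PSeries_0.
  assert (Hs : 0 < s).
  { destruct Hs0 as [H|H]; [exact H|]. rewrite <- H in Hs2. lra. }
  destruct (Ranalysis5.IVT_interv (fun r => PSeries t r - lambda) 0 s) as [r [Hr1 Hr2]].
  - intros r Hr. apply continuity_pt_minus; [|apply continuity_pt_const; intros ? ?; reflexivity].
    apply PSeries_continuity. rewrite Rabs_pos_eq by lra.
    eapply Rbar_le_lt_trans; [|exact Hs1]. simpl; lra.
  - exact Hs.
  - rewrite Ht0. lra.
  - lra.
  - exists r. split; [|split; [|lra]].
    + destruct (proj1 Hr1) as [H|H]; [exact H|]. rewrite <- H, Ht0 in Hr2. lra.
    + eapply Rbar_le_lt_trans; [|exact Hs1]. simpl; lra.
Qed.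

(** The coefficients of [T] are nonnegative. *)
Lemma Re_t_le (w : C) : Rbar_lt (Cmod w) (CV_radius t) -> Re (CPSeries t w) <= PSeries t (Cmod w).
Proof.
  intros Hw. eapply Rle_trans; [apply Rle_abs|].
  eapply Rle_trans; [apply re_le_Cmod|].
  apply Cmod_CPSeries_le_major; [|exact Hw].
  intros n. rewrite Rabs_pos_eq; [lra|now apply t_coef_nonneg].
Qed.

Lemma CPSeries_theta_e_coef (w : C) : Rbar_lt (Cmod w) (CV_radius t) ->
  CPSeries (theta e) w = (- (CPSeries t w * CPSeries e w))%C.
Proof.
  intros Hw.
  replace (- (CPSeries t w * CPSeries e w))%C with (RtoC (-1) * (CPSeries t w * CPSeries e w))%C
    by (replace (RtoC (-1)) with (- RtoC 1)%C
          by (apply injective_projections; simpl; ring); ring).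
  apply is_Cseries_unique.
  apply is_Cseries_ext with (fun n => RtoC (-1) * (RtoC (conv t e n) * w ^ n))%C.
  - intros n. rewrite theta_e_coef by exact nu_gt.
    replace (- conv t e n) with (-1 * conv t e n) by ring.
    rewrite RtoC_mult. ring.
  - apply is_Cseries_scal, CPSeries_mult_is; [exact Hw|now apply e_in].
Qed.

Lemma CPSeries_e_coef_neq_0 (w : C) : Rbar_lt (Cmod w) (CV_radius t) -> CPSeries e w <> RtoC 0.
Proof. intros Hw. rewrite CPSeries_e_coef_exp by assumption. apply Cexp_neq_0. Qed.

Section ExcessOnNegativeAxis.
Variable kappa : R.
Hypothesis kappa_bounds : 0 < kappa < 1 / 2.

(** The power series in [r] of [theta E - kappa E] at [- r]; only the constant
    coefficient is negative. *)
Definition excess : nat -> R := theta_minus kappa (alternate e).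

Lemma alternate_e_radius : CV_radius (alternate e) = p_infty.
Proof. now rewrite CV_radius_alternate, e_coef_radius. Qed.

Lemma excess_radius : CV_radius excess = p_infty.
Proof. apply CV_radius_theta_minus; [lra|apply alternate_e_radius]. Qed.

Lemma excess_succ_pos (n : nat) : 0 < excess (S n).
Proof.
  pose proof (alternate_e_coef_pos nu nu_gt (S n)).
  pose proof (pos_INR n). apply Rmult_lt_0_compat; [rewrite S_INR; lra|assumption].
Qed.

Lemma excess_increasing (r s : R) : 0 <= r < s -> PSeries excess r < PSeries excess s.
Proof.
  intros Hr. pose proof (excess_succ_pos 0).
  assert (excess 1%nat * (s - r) <= PSeries excess s - PSeries excess r).
  { apply PSeries_increment; [lra|intros; left; apply excess_succ_pos|].
    now rewrite excess_radius. }
  nra.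
Qed.

Lemma excess_0 : PSeries excess 0 = - kappa.
Proof.
  rewrite PSeries_0. unfold excess, theta_minus, alternate. rewrite e_coef_0. simpl. ring.
Qed.

Lemma excess_root : exists d, 0 < d /\ PSeries excess d = 0.
Proof.
  pose proof (excess_succ_pos 0) as H1.
  set (s := 1 / excess 1%nat).
  assert (Hs : 0 < s) by (apply Rdiv_lt_0_compat; lra).
  assert (Hinc : excess 1%nat * (s - 0) <= PSeries excess s - PSeries excess 0).
  { apply PSeries_increment; [lra|intros; left; apply excess_succ_pos|].
    now rewrite excess_radius. }
  replace (excess 1%nat * (s - 0)) with 1 in Hinc by (unfold s; field; lra).
  rewrite excess_0 in Hinc.
  destruct (Ranalysis5.IVT_interv (PSeries excess) 0 s) as [r [Hr1 Hr2]].
  - intros r Hr. apply PSeries_continuity. now rewrite excess_radius.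
  - exact Hs.
  - rewrite excess_0. lra.
  - lra.
  - exists r. split; [|exact Hr2].
    destruct (proj1 Hr1) as [H|H]; [exact H|]. rewrite <- H, excess_0 in Hr2. lra.
Qed.

(** Since [n - kappa >= 1 - kappa] for [n >= 1], a nonpositive excess forces
    [sum_(n >= 1) |e_n| r^n <= kappa / (1 - kappa) < 1 = e_0]. *)
Lemma excess_nonpos_e_coef_pos (r : R) :
  0 <= r -> PSeries excess r <= 0 -> 0 < PSeries e r.
Proof.
  intros Hr Hx.
  assert (Hcv : forall c : nat -> R, CV_radius c = p_infty -> forall x : R,
    Rbar_lt x (CV_radius c)) by (intros c -> x; exact I).
  set (b := alternate e) in *.
  set (b1 := fun n => b (S n)). set (x1 := fun n => excess (S n)).
  assert (Hb0 : PSeries b r = 1 + r * PSeries b1 r).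
  { rewrite (PSeries_head b r Hr) by (apply Hcv, alternate_e_radius).
    unfold b at 1, alternate. rewrite e_coef_0. simpl. f_equal. ring. }
  assert (Hx0 : PSeries excess r = - kappa + r * PSeries x1 r).
  { rewrite (PSeries_head excess r Hr) by (apply Hcv, excess_radius).
    rewrite <- excess_0, PSeries_0. reflexivity. }
  assert (Hle : (1 - kappa) * PSeries b1 r <= PSeries x1 r).
  { rewrite <- PSeries_scal. apply PSeries_le; [lra| |].
    - intros n. unfold PS_scal, x1, b1, excess, theta_minus.
      change (scal (1 - kappa) (b (S n))) with ((1 - kappa) * b (S n)).
      pose proof (alternate_e_coef_pos nu nu_gt (S n)) as Hp. fold b in Hp |- *.
      rewrite S_INR. pose proof (pos_INR n). split; nra.
    - apply Hcv. change (CV_radius (PS_decr_1 excess) = p_infty).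
      now rewrite CV_radius_decr_1, excess_radius. }
  assert (Hb2 : r * PSeries b1 r < 1).
  { assert ((1 - kappa) * (r * PSeries b1 r) <= kappa).
    { apply Rle_trans with (r * PSeries x1 r); [|lra].
      replace ((1 - kappa) * (r * PSeries b1 r)) with (r * ((1 - kappa) * PSeries b1 r)) by ring.
      now apply Rmult_le_compat_l. }
    nra. }
  rewrite (PSeries_head e r Hr) by (apply Hcv, e_coef_radius; exact nu_gt).
  rewrite e_coef_0.
  assert (Hab : - PSeries b1 r <= PSeries (fun n => e (S n)) r).
  { assert (H : Cmod (CPSeries (fun n => e (S n)) (RtoC r)) <= PSeries b1 (Cmod (RtoC r))).
    { apply Cmod_CPSeries_le_major.
      - intros n. unfold b1.
        pose proof (alternate_e_coef_pos nu nu_gt (S n)) as Hp. fold b in Hp.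
        rewrite <- (Rabs_pos_eq (b (S n))) by lra.
        unfold b, alternate. rewrite Rabs_mult, pow_1_abs. lra.
      - apply Hcv. change (CV_radius (PS_decr_1 b) = p_infty).
        rewrite CV_radius_decr_1. apply alternate_e_radius. }
    rewrite CPSeries_real, !Cmod_R, (Rabs_pos_eq r) in H by lra.
    apply Rabs_le_between in H. lra. }
  assert (r * - PSeries b1 r <= r * PSeries (fun n => e (S n)) r)
    by (now apply Rmult_le_compat_l).
  lra.
Qed.

(** [Re (theta E / E) < kappa] amounts to [|theta E| < |theta E - 2 kappa E|],
    and since [2 kappa < 1] all coefficients [n - 2 kappa] with [n >= 1] are
    positive: the triangle inequality reduces the claim to the negative axis. *)
Lemma Re_t_gt (w : C) : Rbar_lt (Cmod w) (CV_radius t) ->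
  PSeries excess (Cmod w) < 0 -> - kappa < Re (CPSeries t w).
Proof.
  intros Hw Hx. set (rho := Cmod w) in *.
  assert (Hrho : 0 <= rho) by apply Cmod_ge_0.
  set (b := alternate e) in *.
  assert (Hbp : forall n, 0 < b n) by (intros; now apply alternate_e_coef_pos).
  assert (Hbe : forall n, Rabs (e n) = b n).
  { intros n. rewrite <- (Rabs_pos_eq (b n)) by (left; apply Hbp).
    unfold b, alternate. rewrite Rabs_mult, pow_1_abs. ring. }
  pose (c := tail_coef (theta_minus (2 * kappa) e)).
  pose (cb := tail_coef (theta_minus (2 * kappa) b)).
  assert (Hbr : CV_radius b = p_infty) by apply alternate_e_radius.
  assert (Hmr : CV_radius (theta_minus (2 * kappa) b) = p_infty)
    by (apply CV_radius_theta_minus; [lra|exact Hbr]).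
  assert (Hcb : forall n, Rabs (c n) <= cb n).
  { intros [|n]; unfold c, cb, tail_coef, theta_minus; [rewrite Rabs_R0; lra|].
    rewrite Rabs_mult, Hbe, Rabs_pos_eq; [lra|].
    rewrite S_INR. pose proof (pos_INR n). lra. }
  set (A := CPSeries (theta e) w). set (E := CPSeries e w).
  assert (HA : Cmod A <= PSeries (theta b) rho).
  { apply Cmod_CPSeries_le_major.
    - intros n. unfold theta. rewrite Rabs_mult, Hbe, (Rabs_pos_eq (INR n)) by apply pos_INR. lra.
    - now rewrite CV_radius_theta, Hbr. }
  assert (HC : Cmod (CPSeries c w) <= PSeries cb rho).
  { apply Cmod_CPSeries_le_major; [exact Hcb|].
    eapply Rbar_lt_le_trans; [|apply CV_radius_tail_coef]. now rewrite Hmr. }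
  assert (HCe : CPSeries c w = (A - RtoC (2 * kappa) * E + RtoC (2 * kappa))%C).
  { unfold c. rewrite CPSeries_tail_coef, CPSeries_theta_minus.
    - fold A E. unfold theta_minus. rewrite e_coef_0. simpl INR.
      replace (RtoC ((0 - 2 * kappa) * 1)) with (- RtoC (2 * kappa))%C
        by (rewrite <- RtoC_opp; f_equal; ring).
      ring.
    - now apply e_in.
    - rewrite CV_radius_theta_minus; [exact I|lra|now apply e_coef_radius]. }
  assert (Hsum : PSeries (theta b) rho + PSeries cb rho = 2 * PSeries excess rho + 2 * kappa).
  { unfold cb, excess. fold b.
    rewrite PSeries_tail_coef, !PSeries_theta_minus by assumption.
    unfold theta_minus, b at 4, alternate. rewrite e_coef_0. simpl. ring. }
  assert (Hcmp : Cmod A < Cmod (A - RtoC (2 * kappa) * E)%C).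
  { assert (H : 2 * kappa <= Cmod (CPSeries c w) + Cmod (A - RtoC (2 * kappa) * E)%C).
    { rewrite <- (Rabs_pos_eq (2 * kappa)) at 1 by lra. rewrite <- Cmod_R.
      replace (RtoC (2 * kappa)) with (CPSeries c w + - (A - RtoC (2 * kappa) * E))%C at 1
        by (rewrite HCe; ring).
      eapply Rle_trans; [apply Cmod_triangle|]. rewrite Cmod_opp. lra. }
    lra. }
  assert (HAE : A = (- (CPSeries t w * E))%C) by now apply CPSeries_theta_e_coef.
  rewrite HAE in Hcmp.
  replace (- (CPSeries t w * E) - RtoC (2 * kappa) * E)%C
    with (- ((CPSeries t w + RtoC (2 * kappa)) * E))%C in Hcmp by ring.
  rewrite !Cmod_opp, !Cmod_mult in Hcmp.
  assert (HE : 0 < Cmod E) by (apply Cmod_gt_0; now apply CPSeries_e_coef_neq_0).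
  apply Rmult_lt_reg_r in Hcmp; [|exact HE].
  assert (Hsq : Cmod (CPSeries t w) ^ 2 < Cmod (CPSeries t w + RtoC (2 * kappa))%C ^ 2).
  { pose proof (Cmod_ge_0 (CPSeries t w)). simpl. nra. }
  rewrite !Cmod2_alt in Hsq.
  destruct (CPSeries t w) as [x y]. simpl in *. nra.
Qed.

End ExcessOnNegativeAxis.
End RadiusEquations.

(** * The Gamma function *)

Definition gamma_integrand (x t : R) : R := Rpower t (x - 1) * exp (- t).

Lemma Rpower_pos (t y : R) : 0 < Rpower t y.
Proof. apply exp_pos. Qed.

Lemma gamma_integrand_pos (x t : R) : 0 < gamma_integrand x t.
Proof. apply Rmult_lt_0_compat; apply exp_pos. Qed.

Lemma Rpower_is_derive (y t : R) : 0 < t ->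
  is_derive (fun s => Rpower s y) t (y * Rpower t (y - 1)).
Proof.
  intros Ht.
  replace (y * Rpower t (y - 1)) with (y * / t * Rpower t y).
  - unfold Rpower. auto_derive; [exact Ht|]. field. lra.
  - unfold Rminus. rewrite Rpower_plus, Rpower_Ropp, Rpower_1 by exact Ht. ring.
Qed.

Lemma gamma_integrand_continuous (x t : R) : 0 < t -> continuous (gamma_integrand x) t.
Proof.
  intros Ht. apply (continuous_mult (K:=R_AbsRing) (fun s => Rpower s (x - 1)) (fun s => exp (- s))).
  - apply (ex_derive_continuous (fun s => Rpower s (x - 1))). eexists. now apply Rpower_is_derive.
  - apply (ex_derive_continuous (fun s => exp (- s))). auto_derive. exact I.
Qed.

Lemma gamma_integrand_ex_RInt (x a b : R) : 0 < a -> a <= b -> ex_RInt (gamma_integrand x) a b.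
Proof.
  intros Ha Hab. apply (ex_RInt_continuous (V:=R_CompleteNormedModule)).
  intros t Ht. rewrite Rmin_left in Ht by exact Hab. apply gamma_integrand_continuous. lra.
Qed.

(** The integral over [[a, b]] grows with the interval, so its supremum is its
    limit at both ends simultaneously; the interval [[1, 2]] witnesses positivity. *)
Lemma is_RInt_gen_bounded (f : R -> R) (M : R) :
  (forall a b, 0 < a -> a <= b -> ex_RInt f a b) -> (forall t, 0 < t -> 0 < f t) ->
  (forall a b, 0 < a -> a <= b -> RInt f a b <= M) ->
  exists l, is_RInt_gen f (at_right 0) (Rbar_locally p_infty) l /\ RInt f 1 2 <= l.
Proof.
  intros Hex Hpos HM.
  assert (Hmono : forall a b c d, 0 < a -> a <= b -> b <= c -> c <= d ->
     RInt f b c <= RInt f a d).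
  { intros a b c d Ha Hab Hbc Hcd.
    rewrite <- (RInt_Chasles f a b d) by (apply Hex; lra).
    rewrite <- (RInt_Chasles f b c d) by (apply Hex; lra).
    change (RInt f b c <= RInt f a b + (RInt f b c + RInt f c d)).
    assert (0 <= RInt f a b).
    { apply RInt_ge_0; [lra|apply Hex; lra|]. intros t Ht. left. apply Hpos. lra. }
    assert (0 <= RInt f c d).
    { apply RInt_ge_0; [lra|apply Hex; lra|]. intros t Ht. left. apply Hpos. lra. }
    lra. }
  destruct (completeness (fun y => exists a b, 0 < a /\ a <= b /\ y = RInt f a b)) as [l [Hl1 Hl2]].
  { exists M. intros y [a [b [Ha [Hab ->]]]]. now apply HM. }
  { exists (RInt f 1 2), 1, 2. lra. }
  assert (Hle : forall a b, 0 < a -> a <= b -> RInt f a b <= l).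
  { intros a b Ha Hab. apply Hl1. now exists a, b. }
  exists l. split; [|apply Hle; lra].
  intros P [eps HP].
  assert (Hnear : exists a b, 0 < a /\ a <= b /\ l - eps < RInt f a b).
  { apply NNPP. intros Hno. pose proof (cond_pos eps).
    assert (l <= l - eps); [|lra].
    apply Hl2. intros y [a [b [Ha [Hab ->]]]]. apply Rnot_lt_le. intros Hlt.
    apply Hno. now exists a, b. }
  destruct Hnear as [a0 [b0 [Ha0 [Hab0 Hl]]]].
  apply Filter_prod with (fun a => 0 < a < a0) (fun b => b0 < b).
  - exists (mkposreal a0 Ha0). intros a Hb Ha.
    change (Rabs (a - 0) < a0) in Hb. rewrite Rminus_0_r, Rabs_pos_eq in Hb by lra. lra.
  - exists b0. auto.
  - intros a b Ha Hb. exists (RInt f a b). split.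
    + apply (RInt_correct f). apply Hex; simpl; lra.
    + apply HP. change (Rabs (RInt f a b - l) < eps).
      pose proof (Hmono a a0 b0 b ltac:(lra) ltac:(lra) Hab0 ltac:(lra)).
      pose proof (Hle a b ltac:(lra) ltac:(lra)).
      rewrite Rabs_left1 by lra. lra.
Qed.

(** The tangent bound [ln t <= ln s + t / s - 1] absorbs a power of [t] in
    [exp (t / 2)]. *)
Lemma Rpower_le_exp (y : R) : exists c, 0 < c /\
  forall t, 1 <= t -> Rpower t y <= c * exp (t / 2).
Proof.
  set (s := 2 * Rabs y + 2). pose proof (Rabs_pos y) as Hy.
  assert (Hs : 0 < s) by (unfold s; lra).
  exists (exp (Rabs y * ln s)). split; [apply exp_pos|]. intros t Ht.
  rewrite <- exp_plus. unfold Rpower.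
  assert (Hln : ln t <= ln s + (t / s - 1)).
  { replace t with (s * (t / s)) at 1 by (field; lra).
    assert (Hts : 0 < t / s) by (apply Rdiv_lt_0_compat; lra).
    rewrite ln_mult by assumption. apply Rplus_le_compat_l.
    pose proof (exp_ineq1_le (ln (t / s))) as H. rewrite exp_ln in H by exact Hts. lra. }
  assert (Hln0 : 0 <= ln t) by (rewrite <- ln_1; apply ln_le; lra).
  assert (H1 : y * ln t <= Rabs y * ln t).
  { apply Rmult_le_compat_r; [exact Hln0|apply Rle_abs]. }
  assert (H2 : Rabs y * ln t <= Rabs y * (ln s + (t / s - 1)))
    by (now apply Rmult_le_compat_l).
  assert (H3 : Rabs y * (t / s) <= t / 2).
  { apply (Rmult_le_reg_r (2 * s)); [lra|].
    replace (Rabs y * (t / s) * (2 * s)) with (t * (2 * Rabs y)) by (field; lra).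
    replace (t / 2 * (2 * s)) with (t * s) by field. unfold s. nra. }
  destruct (Rle_lt_or_eq_dec (y * ln t) (Rabs y * ln s + t / 2)) as [H|H]; [nra| |].
  - left. now apply exp_increasing.
  - rewrite H. lra.
Qed.

(** Near [0] the power alone is integrable; beyond [1] half of the exponential
    absorbs it. *)
Lemma gamma_bounded (x : R) : 0 < x -> exists M,
  forall a b, 0 < a -> a <= b -> RInt (gamma_integrand x) a b <= M.
Proof.
  intros Hx. destruct (Rpower_le_exp (x - 1)) as [c [Hc Hpow]].
  assert (H01 : forall a, 0 < a <= 1 -> RInt (gamma_integrand x) a 1 <= / x).
  { intros a Ha.
    assert (HI : is_RInt (fun t => Rpower t (x - 1)) a 1 (Rpower 1 x / x - Rpower a x / x)).
    { apply (is_RInt_derive (fun t => Rpower t x / x)).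
      - intros t Ht. rewrite Rmin_left in Ht by lra.
        replace (Rpower t (x - 1)) with (x * Rpower t (x - 1) * / x) by (field; lra).
        apply (is_derive_ext (fun s => scal (/ x) (Rpower s x))).
        + intros s. apply Rmult_comm.
        + rewrite Rmult_comm. apply (is_derive_scal (fun s => Rpower s x)).
          apply Rpower_is_derive. lra.
      - intros t Ht. rewrite Rmin_left in Ht by lra.
        apply (ex_derive_continuous (fun s => Rpower s (x - 1))).
        eexists. apply Rpower_is_derive. lra. }
    apply Rle_trans with (RInt (fun t => Rpower t (x - 1)) a 1).
    - apply RInt_le; [lra|apply gamma_integrand_ex_RInt; lra|now eexists; apply HI|].
      intros t Ht. unfold gamma_integrand. rewrite <- (Rmult_1_r (Rpower t (x - 1))) at 2.
      apply Rmult_le_compat_l; [left; apply Rpower_pos|].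
      rewrite <- exp_0. left. apply exp_increasing. lra.
    - rewrite (is_RInt_unique _ _ _ _ HI).
      replace (Rpower 1 x) with 1 by (unfold Rpower; now rewrite ln_1, Rmult_0_r, exp_0).
      assert (0 < Rpower a x / x) by (apply Rdiv_lt_0_compat; [apply Rpower_pos|lra]).
      unfold Rdiv at 1. rewrite Rmult_1_l. lra. }
  assert (H1 : forall b, 1 <= b -> RInt (gamma_integrand x) 1 b <= 2 * c).
  { intros b Hb.
    assert (HI : is_RInt (fun t => c * exp (- t / 2)) 1 b
       (- (2 * c) * exp (- b / 2) - - (2 * c) * exp (- 1 / 2))).
    { apply (is_RInt_derive (fun t => - (2 * c) * exp (- t / 2))).
      - intros t _. auto_derive; [exact I|]. unfold Rdiv. field.
      - intros t _. apply (ex_derive_continuous (fun s => c * exp (- s / 2))).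
        auto_derive. exact I. }
    apply Rle_trans with (RInt (fun t => c * exp (- t / 2)) 1 b).
    - apply RInt_le; [lra|apply gamma_integrand_ex_RInt; lra|now eexists; apply HI|].
      intros t Ht. unfold gamma_integrand.
      apply Rle_trans with (c * exp (t / 2) * exp (- t)).
      + apply Rmult_le_compat_r; [left; apply exp_pos|]. apply Hpow. lra.
      + rewrite Rmult_assoc, <- exp_plus.
        replace (t / 2 + - t) with (- t / 2) by field. lra.
    - rewrite (is_RInt_unique _ _ _ _ HI).
      assert (exp (- 1 / 2) < 1) by (rewrite <- exp_0; apply exp_increasing; lra).
      pose proof (exp_pos (- b / 2)). nra. }
  exists (/ x + 2 * c). intros a b Ha Hab.
  pose proof (Rinv_0_lt_compat x Hx) as Hix.
  assert (Hex := gamma_integrand_ex_RInt x).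
  assert (Hnn : forall p q, 0 < p -> p <= q -> 0 <= RInt (gamma_integrand x) p q).
  { intros p q Hp Hq. apply RInt_ge_0; [exact Hq|now apply Hex|].
    intros t _. left. apply gamma_integrand_pos. }
  destruct (Rle_lt_dec b 1) as [Hb|Hb]; [|destruct (Rle_lt_dec 1 a) as [Ha1|Ha1]].
  - specialize (H01 a ltac:(lra)). specialize (Hnn b 1 ltac:(lra) Hb).
    rewrite <- (RInt_Chasles (gamma_integrand x) a b 1) in H01 by (apply Hex; lra).
    change (RInt (gamma_integrand x) a b + RInt (gamma_integrand x) b 1 <= / x) in H01. lra.
  - specialize (H1 b ltac:(lra)). specialize (Hnn 1 a ltac:(lra) Ha1).
    rewrite <- (RInt_Chasles (gamma_integrand x) 1 a b) in H1 by (apply Hex; lra).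
    change (RInt (gamma_integrand x) 1 a + RInt (gamma_integrand x) a b <= 2 * c) in H1. lra.
  - rewrite <- (RInt_Chasles (gamma_integrand x) a 1 b) by (apply Hex; lra).
    apply Rplus_le_compat; [apply H01|apply H1]; lra.
Qed.

Lemma Gamma_correct (x : R) : 0 < x ->
  is_RInt_gen (gamma_integrand x) (at_right 0) (Rbar_locally p_infty) (Gamma x)
  /\ 0 < Gamma x.
Proof.
  intros Hx. destruct (gamma_bounded x Hx) as [M HM].
  destruct (is_RInt_gen_bounded (gamma_integrand x) M) as [l [Hl1 Hl2]].
  - apply gamma_integrand_ex_RInt.
  - intros; apply gamma_integrand_pos.
  - exact HM.
  - assert (E : Gamma x = l) by exact (is_RInt_gen_unique _ _ Hl1).
    rewrite E. split; [exact Hl1|].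
    eapply Rlt_le_trans; [|exact Hl2].
    apply RInt_gt_0; [lra|intros; apply gamma_integrand_pos|].
    intros t Ht. apply gamma_integrand_continuous. lra.
Qed.

Lemma Gamma_pos (x : R) : 0 < x -> 0 < Gamma x.
Proof. intros Hx. now apply Gamma_correct. Qed.

(** Integration by parts: [t^x exp (- t)] vanishes at both ends. *)
Lemma Gamma_succ (x : R) : 0 < x -> Gamma (x + 1) = x * Gamma x.
Proof.
  intros Hx.
  destruct (Gamma_correct (x + 1) ltac:(lra)) as [H1 _].
  destruct (Gamma_correct x Hx) as [H2 _].
  pose proof (is_RInt_gen_minus (V:=R_NormedModule) _ _ _ _ H1
    (is_RInt_gen_scal (V:=R_NormedModule) _ x _ H2)) as H3.
  assert (H4 : is_RInt_gen (fun t => minus (gamma_integrand (x + 1) t)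
      (scal x (gamma_integrand x t))) (at_right 0) (Rbar_locally p_infty) 0).
  { intros P [eps HP].
    destruct (Rpower_le_exp x) as [c [Hc Hpow]].
    pose proof (cond_pos eps) as Heps.
    set (F := fun t => - (Rpower t x * exp (- t))).
    apply Filter_prod with (fun a => 0 < a < Rmin 1 (exp (ln (eps / 2) / x)))
      (fun b => Rmax 1 (2 * ln (c / (eps / 2))) < b).
    - assert (Hd : 0 < Rmin 1 (exp (ln (eps / 2) / x)))
        by (apply Rmin_pos; [lra|apply exp_pos]).
      exists (mkposreal _ Hd). intros a Hb Ha.
      change (Rabs (a - 0) < Rmin 1 (exp (ln (eps / 2) / x))) in Hb.
      rewrite Rminus_0_r, Rabs_pos_eq in Hb by lra. lra.
    - now exists (Rmax 1 (2 * ln (c / (eps / 2)))).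
    - intros a b Ha Hb. exists (F b - F a).
      pose proof (Rmin_l 1 (exp (ln (eps / 2) / x))).
      pose proof (Rmin_r 1 (exp (ln (eps / 2) / x))).
      pose proof (Rmax_l 1 (2 * ln (c / (eps / 2)))).
      pose proof (Rmax_r 1 (2 * ln (c / (eps / 2)))).
      split.
      + apply (is_RInt_derive F).
        * intros t Ht. simpl in Ht. rewrite Rmin_left in Ht by lra.
          unfold F. unfold gamma_integrand.
          replace (x + 1 - 1) with x by ring.
          apply (is_derive_ext (fun s => Rpower s x * - exp (- s)));
            [intros s; symmetry; apply Ropp_mult_distr_r|].
          replace (minus _ _) with (x * Rpower t (x - 1) * - exp (- t) + Rpower t x * exp (- t)).
          -- apply (is_derive_mult (K:=R_AbsRing) (fun s => Rpower s x) (fun s => - exp (- s)));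
               [apply Rpower_is_derive; lra| |apply Rmult_comm].
             auto_derive; [exact I|ring].
          -- unfold minus, plus, opp, scal; simpl. unfold mult; simpl. ring.
        * intros t Ht. simpl in Ht. rewrite Rmin_left in Ht by lra.
          apply (continuous_minus (V:=R_NormedModule)); [apply gamma_integrand_continuous; lra|].
          apply (continuous_scal_r (V:=R_NormedModule)). apply gamma_integrand_continuous; lra.
      + apply HP. change (Rabs (F b - F a - 0) < eps). unfold F.
        assert (A0 : 0 < Rpower a x * exp (- a)) by (apply Rmult_lt_0_compat; apply exp_pos).
        assert (B0 : 0 < Rpower b x * exp (- b)) by (apply Rmult_lt_0_compat; apply exp_pos).
        assert (A1 : Rpower a x * exp (- a) < eps / 2).
        { apply Rle_lt_trans with (Rpower a x * 1).
          - apply Rmult_le_compat_l; [left; apply Rpower_pos|].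
            rewrite <- exp_0. left. apply exp_increasing. lra.
          - rewrite Rmult_1_r. unfold Rpower.
            rewrite <- (exp_ln (eps / 2)) by lra. apply exp_increasing.
            assert (Hla : ln a < ln (eps / 2) / x).
            { rewrite <- (ln_exp (ln (eps / 2) / x)). apply ln_increasing; lra. }
            apply (Rmult_lt_compat_l x) in Hla; [|exact Hx].
            replace (x * (ln (eps / 2) / x)) with (ln (eps / 2)) in Hla by (field; lra).
            exact Hla. }
        assert (B1 : Rpower b x * exp (- b) < eps / 2).
        { apply Rle_lt_trans with (c * exp (b / 2) * exp (- b)).
          - apply Rmult_le_compat_r; [left; apply exp_pos|]. apply Hpow. lra.
          - rewrite Rmult_assoc, <- exp_plus.
            replace (b / 2 + - b) with (- (b / 2)) by field.
            rewrite exp_Ropp.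
            assert (He : c / (eps / 2) < exp (b / 2)).
            { assert (Hce : 0 < c / (eps / 2)) by (apply Rdiv_lt_0_compat; lra).
              rewrite <- (exp_ln (c / (eps / 2))) by exact Hce. apply exp_increasing. lra. }
            pose proof (exp_pos (b / 2)) as HE.
            apply (Rmult_lt_reg_r (exp (b / 2))); [exact HE|].
            rewrite Rmult_assoc, Rinv_l, Rmult_1_r by lra.
            apply (Rmult_lt_compat_r (eps / 2)) in He; [|lra].
            replace (c / (eps / 2) * (eps / 2)) with c in He by (field; lra). lra. }
        apply Rabs_lt_between. lra. }
  pose proof (is_RInt_gen_unique _ _ H3) as E3.
  pose proof (is_RInt_gen_unique _ _ H4) as E4.
  pose proof (eq_trans (eq_sym E3) E4) as E5.
  change (Gamma (x + 1) - x * Gamma x = 0) in E5. lra.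
Qed.

(** * Series for the Bessel functions *)

Lemma Cexp_pow (n : nat) (l : C) : Cexp (RtoC (INR n) * l)%C = (Cexp l ^ n)%C.
Proof.
  induction n as [|n IH].
  - simpl INR. rewrite Cmult_0_l. apply Cexp_0.
  - rewrite S_INR, RtoC_plus, Cpow_S, <- IH, <- Cexp_add. f_equal. ring.
Qed.

Lemma Cpower_nonzero (z : C) (p : R) : z <> RtoC 0 -> Cpower z p = Cexp (RtoC p * Clog z)%C.
Proof. intros Hz. unfold Cpower. now destruct (Ceq_dec z 0). Qed.

(** Positive factors do not move the argument across the cut. *)
Lemma Clog_scal (c : R) (z : C) : 0 < c -> z <> RtoC 0 ->
  Clog (RtoC c * z)%C = (Clog z + RtoC (ln c))%C.
Proof.
  intros Hc Hz. pose proof (proj1 (Cmod_gt_0 z) Hz) as Hm.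
  assert (HM : Cmod (RtoC c * z)%C = c * Cmod z)
    by (rewrite Cmod_mult, Cmod_R, Rabs_pos_eq; lra).
  assert (HR : Re (RtoC c * z)%C = c * Re z) by (destruct z; simpl; ring).
  assert (HI : Im (RtoC c * z)%C = c * Im z) by (destruct z; simpl; ring).
  apply injective_projections; simpl.
  - rewrite HM, ln_mult by assumption. ring.
  - unfold Carg. rewrite HM, HR, HI.
    replace (c * Re z / (c * Cmod z)) with (Re z / Cmod z) by (field; lra).
    destruct (Rle_dec 0 (c * Im z)); destruct (Rle_dec 0 (Im z)); try ring; exfalso; nra.
Qed.

Lemma Im_Clog_bound (z : C) : - PI <= Im (Clog z) <= PI.
Proof.
  simpl. unfold Carg. pose proof (acos_bound (Re z / Cmod z)).
  destruct (Rle_dec 0 (Im z)); lra.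
Qed.

Definition has_log_der (f : C -> C) (z L : C) : Prop :=
  exists d : C, is_Cder f z d /\ f z <> RtoC 0 /\ (z * d / f z)%C = L.

Lemma starlike_radius_intro (alpha : R) (f L : C -> C) (delta : R) :
  0 < delta ->
  (forall z, 0 < Cmod z <= delta -> has_log_der f z (L z)) ->
  (forall z, 0 < Cmod z < delta -> alpha < Re (L z)) ->
  (exists z0, Cmod z0 = delta /\ Re (L z0) <= alpha) ->
  starlike_radius alpha f = Finite delta.
Proof.
  intros Hd HL Hin [z0 [Hz0 Hout]].
  apply is_lub_Rbar_unique. split.
  - intros r [Hr Hs]. apply Rnot_lt_le. intros Hlt.
    destruct (Hs z0) as [_ [_ H]]; [lra|].
    destruct (HL z0) as [d [Hd1 [_ Hd2]]]; [lra|].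
    assert (E : C_derive f z0 = d) by now apply is_C_derive_unique.
    rewrite E, Hd2 in H. lra.
  - intros b Hb. apply Hb. split; [exact Hd|].
    intros z Hz. destruct (HL z) as [d [Hd1 [Hd2 Hd3]]]; [lra|].
    split; [now exists d|]. split; [exact Hd2|].
    assert (E : C_derive f z = d) by now apply is_C_derive_unique.
    rewrite E, Hd3. now apply Hin.
Qed.

Section Bessel.
Variable nu : R.
Hypothesis nu_gt : -1 < nu.
Local Notation e := (e_coef nu).
Local Notation t := (t_coef nu).

(** The factor [4^n] compensates the halved argument in the Bessel series. *)
Lemma gamma_j_coef (n : nat) :
  (-1) ^ n / (INR (fact n) * Gamma (nu + INR n + 1))
  = 4 ^ n * j_coef nu n / Gamma (nu + 1).
Proof.
  pose proof (Gamma_pos (nu + 1) ltac:(lra)) as G0.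
  assert (Gn : forall m, 0 < Gamma (nu + INR m + 1)).
  { intros m. apply Gamma_pos. pose proof (pos_INR m). lra. }
  induction n as [|n IH].
  - simpl. replace (nu + 0 + 1) with (nu + 1) by ring. field. lra.
  - pose proof (index_plus_nu_pos nu nu_gt n) as Hn. pose proof (pos_INR n) as Hp.
    pose proof (Gn n) as G1. pose proof (INR_fact_lt_0 n) as F1.
    change (j_coef nu (S n)) with (- j_coef nu n / (4 * INR (S n) * (INR (S n) + nu))).
    rewrite fact_simpl, mult_INR.
    replace (nu + INR (S n) + 1) with ((nu + INR n + 1) + 1) by (rewrite S_INR; ring).
    rewrite Gamma_succ by lra.
    rewrite S_INR in *.
    transitivity (- ((-1) ^ n / (INR (fact n) * Gamma (nu + INR n + 1)))
      / ((INR n + 1) * (nu + INR n + 1))).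
    + simpl pow. field. repeat split; lra.
    + rewrite IH. simpl pow. field. repeat split; lra.
Qed.

(** The power [(z/2)^nu] factors out of the series for every nonzero [z], with
    no cut: all terms use the same logarithm of [z/2]. *)
Lemma bessel_term (a : nat -> R) (k : R) (b : nat -> R) (z : C) :
  z <> RtoC 0 -> CV_radius b = p_infty -> (forall n, a n = 4 ^ n * b n * k) ->
  CSeries (fun n => RtoC (a n) * Cpower (z / 2) (2 * INR n + nu))%C
  = (Cpower (z / 2) nu * RtoC k * CPSeries b (z ^ 2))%C.
Proof.
  intros Hz Hb Ha.
  assert (H2 : RtoC 2 <> RtoC 0) by (intros H; apply RtoC_inj in H; lra).
  assert (Hz2 : (z / 2)%C <> RtoC 0).
  { intros H. apply Hz. replace z with (z / 2 * 2)%C by (field; exact H2).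
    rewrite H. ring. }
  apply is_Cseries_unique.
  assert (Hin : Rbar_lt (Cmod (z ^ 2)%C) (CV_radius b)) by now rewrite Hb.
  apply is_Cseries_ext with (2 := is_Cseries_scal (Cpower (z / 2) nu * RtoC k)%C _ _
    (CPSeries_correct b _ Hin)).
  intros n. rewrite Ha, !Cpower_nonzero by exact Hz2.
  replace (2 * INR n + nu) with (INR (2 * n) + nu) by (rewrite mult_INR; reflexivity).
  rewrite RtoC_plus, Cmult_plus_distr_r.
  rewrite Cexp_add, Cexp_pow, Cexp_Clog by exact Hz2.
  rewrite Cpow_mult_r.
  replace ((z / 2) ^ 2)%C with (z ^ 2 * RtoC (/ 4))%C.
  - rewrite Cpow_mult_l, <- (RtoC_pow (/ 4)), !RtoC_mult, pow_inv.
    replace (RtoC (4 ^ n) * RtoC (b n) * RtoC k * ((z ^ 2) ^ n * RtoC (/ 4 ^ n) *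
      Cexp (RtoC nu * Clog (z / 2))))%C
      with (RtoC (4 ^ n) * RtoC (/ 4 ^ n) * (Cexp (RtoC nu * Clog (z / 2)) * RtoC k *
        (RtoC (b n) * (z ^ 2) ^ n)))%C by ring.
    rewrite <- RtoC_mult, Rinv_r by (apply pow_nonzero; lra). ring.
  - assert (H4 : RtoC (/ 4) = (/ RtoC 2 * / RtoC 2)%C).
    { rewrite <- !RtoC_inv, <- RtoC_mult by lra. f_equal. lra. }
    rewrite H4. unfold Cdiv. rewrite Cpow_mult_l. simpl. ring.
Qed.

Definition pi_factor : R := / (Rpower 2 (2 * nu) * Gamma (nu + 1) ^ 2).

Lemma pi_factor_inv :
  (RtoC (Rpower 2 (2 * nu)) * RtoC (Gamma (nu + 1) ^ 2) * RtoC pi_factor)%C = RtoC 1.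
Proof.
  rewrite <- !RtoC_mult. f_equal. unfold pi_factor.
  pose proof (Gamma_pos (nu + 1) ltac:(lra)). pose proof (exp_pos (2 * nu * ln 2)).
  apply Rinv_r. unfold Rpower. apply Rmult_integral_contrapositive_currified; [lra|].
  apply pow_nonzero. lra.
Qed.

Lemma bessel_Pi_eq (z : C) : z <> RtoC 0 ->
  bessel_Pi nu z
  = (RtoC pi_factor * (Cexp (RtoC (2 * nu) * Clog z) * CPSeries e (z ^ 4)))%C.
Proof.
  intros Hz. pose proof (Gamma_pos (nu + 1) ltac:(lra)) as G0.
  unfold bessel_Pi, bessel_J, bessel_I.
  rewrite (bessel_term _ (/ Gamma (nu + 1)) (j_coef nu) z Hz).
  2: now apply j_coef_radius. 2: exact gamma_j_coef.
  rewrite (bessel_term _ (/ Gamma (nu + 1)) (alternate (j_coef nu)) z Hz).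
  2: { rewrite CV_radius_alternate. now apply j_coef_radius. }
  2: { intros n. unfold alternate.
       replace (4 ^ n * ((-1) ^ n * j_coef nu n) * / Gamma (nu + 1))
         with ((-1) ^ n * (4 ^ n * j_coef nu n / Gamma (nu + 1))) by (unfold Rdiv; ring).
       rewrite <- gamma_j_coef.
       replace ((-1) ^ n * ((-1) ^ n / (INR (fact n) * Gamma (nu + INR n + 1))))
         with (((-1) ^ n * (-1) ^ n) / (INR (fact n) * Gamma (nu + INR n + 1)))
         by (unfold Rdiv; ring).
       rewrite <- Rpow_mult_distr. replace (-1 * -1) with 1 by ring. now rewrite pow1. }
  rewrite CPSeries_alternate.
  replace (z ^ 4)%C with ((z ^ 2) ^ 2)%C by (simpl; ring).
  rewrite CPSeries_e_coef_square by exact nu_gt.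
  assert (Hz2 : (z / 2)%C = (RtoC (/ 2) * z)%C).
  { rewrite RtoC_inv by lra. unfold Cdiv. ring. }
  assert (Hzn : (RtoC (/ 2) * z)%C <> RtoC 0).
  { apply Cmult_neq_0; [|exact Hz]. intros H. apply RtoC_inj in H. lra. }
  rewrite Hz2, !Cpower_nonzero, Clog_scal by (assumption || lra).
  replace (Cexp (RtoC (2 * nu) * Clog z))%C
    with (RtoC (Rpower 2 (2 * nu)) * (Cexp (RtoC nu * (Clog z + RtoC (ln (/ 2))))
           * Cexp (RtoC nu * (Clog z + RtoC (ln (/ 2))))))%C.
  - set (p := Cexp (RtoC nu * (Clog z + RtoC (ln (/ 2))))).
    pose proof pi_factor_inv as HP.
    set (k := Rpower 2 (2 * nu)) in *. set (G := Gamma (nu + 1)) in *.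
    rewrite RtoC_inv by lra.
    assert (HG : RtoC G <> RtoC 0) by (intros H; apply RtoC_inj in H; lra).
    rewrite RtoC_pow in HP.
    assert (HGk : (RtoC pi_factor * RtoC k)%C = (/ RtoC G * / RtoC G)%C).
    { transitivity ((/ RtoC G * / RtoC G) * (RtoC k * RtoC G ^ 2 * RtoC pi_factor))%C;
        [simpl; field; exact HG|]. rewrite HP. ring. }
    transitivity ((RtoC pi_factor * RtoC k) * (p * p * (CPSeries (j_coef nu) (z ^ 2)
      * CPSeries (j_coef nu) (- z ^ 2))))%C; [|ring].
    rewrite HGk. ring.
  - unfold Rpower. rewrite <- Cexp_RtoC, <- !Cexp_add. f_equal.
    rewrite ln_Rinv by lra. rewrite RtoC_opp, !RtoC_mult. ring.
Qed.
End Bessel.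

(** * The normalized functions *)

Lemma Cmod_pos_of_near (z y : C) : Cmod (y - z)%C < Cmod z -> y <> RtoC 0.
Proof.
  intros H ->. replace (0 - z)%C with (- z)%C in H by ring. rewrite Cmod_opp in H. lra.
Qed.

(** Were [h'(z)] nonzero, a step in the direction [h(z) conj (h'(z))] would
    increase the modulus to first order. *)
Lemma unit_modulus_der (h : C -> C) (z d : C) (r : R) :
  0 < r -> (forall y, Cmod (y - z)%C < r -> Cmod (h y) = 1) ->
  is_Cder h z d -> d = RtoC 0.
Proof.
  intros Hr Hmod Hd. apply Cmod_eq_0.
  destruct (Cmod_ge_0 d) as [Hpos|H0]; [exfalso|now symmetry].
  set (m := Cmod d) in *.
  destruct (is_Cder_elim h z d Hd (m / 2) ltac:(lra)) as [r' [Hr' Hy]].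
  (* A real step that keeps [z + v] at distance [Rmin r r' / 2] from [z]. *)
  set (s := Rmin r r' / 2 / m).
  assert (Hrr : 0 < Rmin r r') by (now apply Rmin_pos).
  pose proof (Rmin_l r r'). pose proof (Rmin_r r r').
  assert (Hs : 0 < s) by (repeat apply Rdiv_lt_0_compat; lra).
  assert (Hsm : s * m = Rmin r r' / 2) by (unfold s; field; lra).
  set (A := h z).
  assert (HA : Cmod A = 1).
  { apply Hmod. replace (z - z)%C with (RtoC 0) by ring. rewrite Cmod_0. exact Hr. }
  set (v := (RtoC s * (A * Cconj d))%C).
  assert (Hv : Cmod v = s * m).
  { unfold v. rewrite !Cmod_mult, Cmod_R, Cmod_conj, HA, Rabs_pos_eq by lra. fold m. ring. }
  specialize (Hy (z + v)%C). specialize (Hmod (z + v)%C).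
  replace (z + v - z)%C with v in Hy, Hmod by ring. rewrite Hv in Hy, Hmod.
  specialize (Hy ltac:(lra)). specialize (Hmod ltac:(lra)). fold A in Hy.
  assert (Hdd : (d * Cconj d)%C = RtoC (m ^ 2)) by (unfold m; now rewrite Cmod2_conj).
  assert (Hlow : Cmod (A + v * d)%C = 1 + s * m ^ 2).
  { replace (A + v * d)%C with (A * RtoC (1 + s * m ^ 2))%C.
    - rewrite Cmod_mult, HA, Cmod_R, Rabs_pos_eq; [ring|].
      pose proof (pow2_ge_0 m). nra.
    - rewrite RtoC_plus, RtoC_mult, <- Hdd. unfold v. ring. }
  assert (Htri : Cmod (A + v * d)%C <= Cmod (h (z + v)%C) + Cmod (h (z + v) - A - v * d)%C).
  { replace (A + v * d)%C with (h (z + v)%C + - (h (z + v) - A - v * d))%C by ring.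
    eapply Rle_trans; [apply Cmod_triangle|]. rewrite Cmod_opp. lra. }
  rewrite Hmod, Hlow in Htri.
  assert (s * m ^ 2 <= m / 2 * (s * m)) by lra.
  assert (0 < s * m ^ 2) by (apply Rmult_lt_0_compat; [lra|now apply pow_lt]).
  assert (m / 2 * (s * m) = s * m ^ 2 / 2) by (simpl; field). lra.
Qed.

(** That [f(y) / y] tends to [1], written without division. *)
Lemma normalized_near_0 (f : C -> C) : f (RtoC 0) = RtoC 0 -> is_Cder f (RtoC 0) (RtoC 1) ->
  forall eta, 0 < eta -> exists d, 0 < d /\
    forall y, Cmod y < d -> Cmod (f y - y)%C <= eta * Cmod y.
Proof.
  intros H0 Hd eta Heta.
  destruct (is_Cder_elim _ _ _ Hd eta Heta) as [d [Hd0 Hy]].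
  exists d. split; [exact Hd0|]. intros y Hlt. specialize (Hy y).
  replace (y - 0)%C with y in Hy by ring. specialize (Hy Hlt).
  rewrite H0 in Hy. now replace (f y - 0 - y * 1)%C with (f y - y)%C in Hy by ring.
Qed.

Lemma is_Cder_Cinv (z : C) : z <> RtoC 0 -> is_Cder Cinv z (- / (z * z))%C.
Proof.
  intros Hz. set (m := Cmod z). assert (Hm : 0 < m) by now apply Cmod_gt_0.
  assert (Hm3 : 0 < m ^ 3) by now apply pow_lt.
  apply is_Cder_intro. intros eps Heps.
  assert (He : 0 < eps * m ^ 3 / 2) by (apply Rdiv_lt_0_compat; nra).
  exists (Rmin (m / 2) (eps * m ^ 3 / 2)). split; [apply Rmin_pos; lra|].
  intros y Hy. pose proof (Rmin_l (m / 2) (eps * m ^ 3 / 2)).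
  pose proof (Rmin_r (m / 2) (eps * m ^ 3 / 2)).
  set (h := Cmod (y - z)%C) in *.
  assert (Hh : 0 <= h) by apply Cmod_ge_0.
  assert (Hym : m / 2 <= Cmod y).
  { pose proof (Cmod_triangle y (- (y - z))%C) as T.
    replace (y + - (y - z))%C with z in T by ring. rewrite Cmod_opp in T. fold m h in T. lra. }
  assert (Hy0 : y <> RtoC 0) by (apply Cmod_gt_0; lra).
  replace (/ y - / z - (y - z) * - / (z * z))%C
    with ((y - z) * (y - z) / (y * (z * z)))%C by (field; now split).
  rewrite Cmod_div, !Cmod_mult by (repeat apply Cmult_neq_0; assumption). fold m h.
  assert (Hd : m ^ 3 / 2 <= Cmod y * (m * m)) by (simpl; nra).
  apply Rle_div_l; [lra|].
  apply Rle_trans with (eps * h * (m ^ 3 / 2)); [nra|].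
  apply Rmult_le_compat_l; [nra|exact Hd].
Qed.

Lemma is_Cder_inv (f : C -> C) (z l : C) : f z <> RtoC 0 -> is_Cder f z l ->
  is_Cder (fun y => / f y)%C z (l * - / (f z * f z))%C.
Proof. intros Hz Hf. apply is_Cder_comp; [now apply is_Cder_Cinv|exact Hf]. Qed.

Section BesselFunctions.
Variable nu : R.
Hypothesis nu_gt : -1 < nu.
Local Notation e := (e_coef nu).
Local Notation t := (t_coef nu).

Lemma is_Cder_e_power (m : nat) (z : C) :
  exists l, is_Cder (fun y => CPSeries e (y ^ S m)%C) z l /\
    (z * l)%C = (RtoC (INR (S m)) * CPSeries (theta e) (z ^ S m))%C.
Proof.
  exists (RtoC (INR (S m)) * z ^ m * CPSeries (PS_derive e) (z ^ S m))%C. split.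
  - apply (is_Cder_comp (CPSeries e) (fun y => y ^ S m)%C); [|apply is_Cder_pow].
    apply is_Cder_CPSeries. now apply e_in.
  - rewrite CPSeries_theta by now apply e_in. simpl. ring.
Qed.

(** The factor [z^(2 nu)] contributes [2 nu] to [z Pi' / Pi].  Positive real part
    keeps [z] off the cut of the principal power. *)
Lemma bessel_Pi_euler (z : C) (c : R) : 0 < Re z ->
  (z * C_derive (bessel_Pi nu) z - RtoC c * bessel_Pi nu z)%C
  = (RtoC (pi_factor nu) * Cexp (RtoC (2 * nu) * Clog z)
     * (RtoC (2 * nu - c) * CPSeries e (z ^ 4) + RtoC 4 * CPSeries (theta e) (z ^ 4)))%C.
Proof.
  intros Hx.
  assert (Hz : z <> RtoC 0) by (intros ->; simpl in Hx; lra).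
  pose proof (proj1 (Cmod_gt_0 z) Hz) as Hm.
  destruct (is_Cder_e_power 3 z) as [l [Hl1 Hl2]].
  set (E := fun y : C => CPSeries e (y ^ 4)%C) in *.
  set (L := fun y : C => Cexp (RtoC (2 * nu) * Clog y)%C).
  assert (HL : is_Cder L z (RtoC (2 * nu) * / z * L z)%C).
  { apply Cexp_comp_der, is_Cder_scal, is_Cder_Clog, Hx. }
  assert (HP : is_Cder (bessel_Pi nu) z
    (RtoC (pi_factor nu) * (RtoC (2 * nu) * / z * L z * E z + L z * l))%C).
  { apply is_Cder_ext_loc with (fun y => RtoC (pi_factor nu) * (L y * E y))%C (Cmod z).
    - exact Hm.
    - intros y Hy. symmetry. apply bessel_Pi_eq; [exact nu_gt|].
      now apply Cmod_pos_of_near with z.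
    - apply is_Cder_scal, is_Cder_mult; [exact HL|exact Hl1]. }
  rewrite (is_C_derive_unique _ _ _ HP), bessel_Pi_eq by assumption.
  fold (L z). fold (E z).
  transitivity (RtoC (pi_factor nu) * L z
    * ((RtoC (2 * nu) - RtoC c) * E z + z * l))%C; [field; exact Hz|].
  rewrite Hl2, RtoC_minus. simpl INR.
  replace (RtoC (1 + 1 + 1 + 1)) with (RtoC 4) by (f_equal; ring).
  reflexivity.
Qed.

Lemma pi_factor_neq_0 : RtoC (pi_factor nu) <> RtoC 0.
Proof.
  intros H. pose proof (pi_factor_inv nu nu_gt) as H1. rewrite H, Cmult_0_r in H1.
  apply RtoC_inj in H1. lra.
Qed.

(** The power factor never vanishes, and [E] is real on the real line. *)
Lemma bessel_Pi_root_iff (z : C) (c w : R) : 0 < Re z -> (z ^ 4)%C = RtoC w ->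
  ((z * C_derive (bessel_Pi nu) z - RtoC c * bessel_Pi nu z)%C = RtoC 0 <->
   (2 * nu - c) * PSeries e w + 4 * PSeries (theta e) w = 0).
Proof.
  intros Hx Hw. rewrite bessel_Pi_euler, Hw, !CPSeries_real, <- !RtoC_mult, <- RtoC_plus by exact Hx.
  split.
  - intros H. apply NNPP. intros Hn. revert H.
    apply Cmult_neq_0.
    + apply Cmult_neq_0; [apply pi_factor_neq_0|apply Cexp_neq_0].
    + intros H. apply Hn, RtoC_inj, H.
  - intros ->. ring.
Qed.

Lemma PSeries_theta_e_coef (w : R) : 0 <= w -> Rbar_lt w (CV_radius t) ->
  PSeries (theta e) w = - PSeries t w * PSeries e w.
Proof.
  intros H0 Hw. apply RtoC_inj. rewrite RtoC_mult, RtoC_opp, <- !CPSeries_real.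
  rewrite CPSeries_theta_e_coef by (try exact nu_gt; now rewrite Cmod_R, Rabs_pos_eq). ring.
Qed.

Lemma PSeries_e_coef_pos (w : R) : 0 <= w -> Rbar_lt w (CV_radius t) -> 0 < PSeries e w.
Proof. intros H0 Hw. rewrite PSeries_e_coef_exp by assumption. apply exp_pos. Qed.

(** All three normalized functions have the form [z exp (k Q(z^m))]. *)
Lemma log_model_der (k : R) (m : nat) (z : C) :
  Rbar_lt (Cmod z ^ S m) (CV_radius t) ->
  exists l, is_Cder (fun y => y * Cexp (RtoC k * CPSeries (log_coef nu) (y ^ S m)))%C z l /\
    l = (Cexp (RtoC k * CPSeries (log_coef nu) (z ^ S m))
         * (1 + RtoC (k * INR (S m)) * CPSeries t (z ^ S m)))%C.
Proof.
  intros Hz.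
  assert (Hz' : Rbar_lt (Cmod (z ^ S m)%C) (CV_radius (log_coef nu)))
    by (rewrite log_coef_radius, Cmod_pow; exact Hz).
  pose proof (is_Cder_comp _ (fun y => y ^ S m)%C z _ _ (is_Cder_CPSeries _ _ Hz') (is_Cder_pow m z)) as D1.
  pose proof (is_Cder_mult _ _ _ _ _ (is_Cder_id z)
    (Cexp_comp_der _ _ _ (is_Cder_scal (RtoC k) _ _ _ D1))) as D2.
  eexists. split; [exact D2|].
  assert (HT : CPSeries t (z ^ S m)%C = (z ^ S m * CPSeries (PS_derive (log_coef nu)) (z ^ S m))%C).
  { rewrite <- CPSeries_theta by exact Hz'. apply CPSeries_ext. intros [|n].
    - change (t_coef nu 0) with 0. unfold theta. simpl. ring.
    - unfold theta, log_coef. field. apply not_0_INR. lia. }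
  rewrite HT, RtoC_mult. simpl. ring.
Qed.

(** Agreement near [z] is enough, and all that the definition of [u_fun] gives. *)
Lemma log_model_log_der (f : C -> C) (k : R) (m : nat) (z : C) (d : R) :
  z <> RtoC 0 -> Rbar_lt (Cmod z ^ S m) (CV_radius t) -> 0 < d ->
  (forall y, Cmod (y - z)%C < d ->
     f y = (y * Cexp (RtoC k * CPSeries (log_coef nu) (y ^ S m)))%C) ->
  has_log_der f z (1 + RtoC (k * INR (S m)) * CPSeries t (z ^ S m))%C.
Proof.
  intros Hz Hm Hd Hf. destruct (log_model_der k m z Hm) as [l [Hl1 Hl2]].
  assert (Hfz : f z = (z * Cexp (RtoC k * CPSeries (log_coef nu) (z ^ S m)))%C).
  { apply Hf. replace (z - z)%C with (RtoC 0) by ring. now rewrite Cmod_0. }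
  exists l. split; [|split].
  - apply is_Cder_ext_loc with (2 := fun y Hy => eq_sym (Hf y Hy)); assumption.
  - rewrite Hfz. apply Cmult_neq_0; [exact Hz|apply Cexp_neq_0].
  - rewrite Hfz, Hl2. field. split; [apply Cexp_neq_0|exact Hz].
Qed.

Lemma Rbar_lt_pow_near (m : nat) (z : C) (rho : Rbar) : Rbar_lt (Cmod z ^ S m) rho ->
  exists r, Cmod z < r /\ forall y, Cmod y < r -> Rbar_lt (Cmod y ^ S m) rho.
Proof.
  intros H. destruct (Rbar_between _ _ H) as [q [Hq1 Hq2]].
  assert (Hc : continuous (fun x => x ^ S m) (Cmod z)).
  { apply (ex_derive_continuous (fun x : R => x ^ S m)). auto_derive. exact I. }
  assert (He : 0 < q - Cmod z ^ S m) by lra.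
  pose proof (proj1 (filterlim_locally (F:=locally (Cmod z)) _ _) Hc (mkposreal _ He)) as [d Hd].
  pose proof (cond_pos d) as Hd0. pose proof (Cmod_ge_0 z) as Hz0.
  exists (Cmod z + d / 2). split; [lra|]. intros y Hy.
  eapply Rbar_le_lt_trans; [|exact Hq2]. change (Cmod y ^ S m <= q).
  assert (Hb : Rabs (Cmod z + d / 2 - Cmod z) < d) by (rewrite Rabs_pos_eq; lra).
  specialize (Hd _ Hb).
  change (Rabs ((Cmod z + d / 2) ^ S m - Cmod z ^ S m) < q - Cmod z ^ S m) in Hd.
  apply Rabs_lt_between in Hd.
  apply Rle_trans with ((Cmod z + d / 2) ^ S m); [|lra].
  apply pow_incr. split; [apply Cmod_ge_0|lra].
Qed.

Lemma v_fun_eq (z : C) : z <> RtoC 0 -> v_fun nu z = (z * CPSeries e (z ^ 4))%C.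
Proof.
  intros Hz. unfold v_fun. rewrite bessel_Pi_eq, Cpower_nonzero by assumption.
  pose proof (pi_factor_inv nu nu_gt) as HP.
  transitivity ((RtoC (Rpower 2 (2 * nu)) * RtoC (Gamma (nu + 1) ^ 2) * RtoC (pi_factor nu))
    * (Cexp (RtoC (- 2 * nu + 1) * Clog z) * Cexp (RtoC (2 * nu) * Clog z)) * CPSeries e (z ^ 4))%C;
    [ring|].
  rewrite HP, <- Cexp_add, <- Cmult_plus_distr_r, <- RtoC_plus.
  replace (- 2 * nu + 1 + 2 * nu) with 1 by ring.
  rewrite !Cmult_1_l, Cexp_Clog by exact Hz. reflexivity.
Qed.

(** Dividing an argument in [[- pi, pi]] by four keeps it off the cut. *)
Lemma Clog_root (z : C) : z <> RtoC 0 ->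
  Clog (Cpower z (1 / 4)) = (RtoC (1 / 4) * Clog z)%C /\
  Cpower z (1 / 4) <> RtoC 0 /\ (Cpower z (1 / 4) ^ 4)%C = z.
Proof.
  intros Hz. pose proof (Im_Clog_bound z) as Hb. pose proof PI_RGT_0.
  rewrite Cpower_nonzero by exact Hz. repeat split.
  - apply Clog_Cexp.
    replace (Im (RtoC (1 / 4) * Clog z)%C) with (1 / 4 * Im (Clog z))
      by (unfold Im; simpl; ring). lra.
  - apply Cexp_neq_0.
  - rewrite <- Cexp_pow.
    replace (RtoC (INR 4) * (RtoC (1 / 4) * Clog z))%C with (Clog z).
    + now apply Cexp_Clog.
    + rewrite Cmult_assoc, <- RtoC_mult. replace (INR 4 * (1 / 4)) with 1 by (simpl; field).
      ring.
Qed.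

Lemma w_fun_eq (z : C) : z <> RtoC 0 -> w_fun nu z = (z * CPSeries e (z ^ 1))%C.
Proof.
  intros Hz. destruct (Clog_root z Hz) as [HL [H0 H4]].
  unfold w_fun. rewrite bessel_Pi_eq, HL, H4, Cpower_nonzero by assumption.
  pose proof (pi_factor_inv nu nu_gt) as HP.
  transitivity ((RtoC (Rpower 2 (2 * nu)) * RtoC (Gamma (nu + 1) ^ 2) * RtoC (pi_factor nu))
    * (Cexp (RtoC (- nu / 2 + 1) * Clog z) * Cexp (RtoC (2 * nu) * (RtoC (1 / 4) * Clog z)))
    * CPSeries e z)%C; [ring|].
  rewrite HP, <- Cexp_add, Cmult_assoc, <- RtoC_mult, <- Cmult_plus_distr_r, <- RtoC_plus.
  replace (- nu / 2 + 1 + 2 * nu * (1 / 4)) with 1 by field.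
  rewrite !Cmult_1_l, Cexp_Clog, Cpow_1_r by exact Hz. reflexivity.
Qed.

Lemma entire_log_der (f : C -> C) (m : nat) (z : C) :
  (forall y, y <> RtoC 0 -> f y = (y * CPSeries e (y ^ S m))%C) ->
  z <> RtoC 0 -> Rbar_lt (Cmod z ^ S m) (CV_radius t) ->
  has_log_der f z (1 + RtoC (- 1 * INR (S m)) * CPSeries t (z ^ S m))%C.
Proof.
  intros Hf Hz Hm. destruct (Rbar_lt_pow_near m z _ Hm) as [r [Hr1 Hr2]].
  pose proof (proj1 (Cmod_gt_0 z) Hz) as Hz0.
  apply log_model_log_der with (Rmin (Cmod z) (r - Cmod z)); try assumption.
  - apply Rmin_pos; lra.
  - intros y Hy. pose proof (Rmin_l (Cmod z) (r - Cmod z)).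
    pose proof (Rmin_r (Cmod z) (r - Cmod z)).
    assert (Hy0 : y <> RtoC 0) by (apply Cmod_pos_of_near with z; lra).
    assert (Hyr : Cmod y < r).
    { replace y with (z + (y - z))%C by ring.
      eapply Rle_lt_trans; [apply Cmod_triangle|]. lra. }
    rewrite (Hf y Hy0), CPSeries_e_coef_exp; [| exact nu_gt |].
    + do 2 f_equal.
      replace (RtoC (-1)) with (- RtoC 1)%C by (apply injective_projections; simpl; ring).
      ring.
    + rewrite Cmod_pow. now apply Hr2.
Qed.

Lemma v_fun_log_der (z : C) : z <> RtoC 0 -> Rbar_lt (Cmod z ^ 4) (CV_radius t) ->
  has_log_der (v_fun nu) z (1 + RtoC (- 1 * INR 4) * CPSeries t (z ^ 4))%C.
Proof. intros Hz Hm. apply (entire_log_der _ 3); [exact v_fun_eq|exact Hz|exact Hm]. Qed.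

Lemma w_fun_log_der (z : C) : z <> RtoC 0 -> Rbar_lt (Cmod z ^ 1) (CV_radius t) ->
  has_log_der (w_fun nu) z (1 + RtoC (- 1 * INR 1) * CPSeries t (z ^ 1))%C.
Proof. intros Hz Hm. apply (entire_log_der _ 0); [exact w_fun_eq|exact Hz|exact Hm]. Qed.

(** Two branches have the same modulus, as the real part of a logarithm is
    determined; their quotient is constant, and tends to [1] at the centre. *)
Lemma u_branch_unique (r1 r2 : R) (f g : C -> C) (z : C) :
  nu <> 0 -> u_branch nu r1 f -> u_branch nu r2 g ->
  z <> RtoC 0 -> Cmod z < r1 -> Cmod z < r2 -> f z = g z.
Proof.
  intros Hnu [Df [f0 [f1 Lf]]] [Dg [g0 [g1 Lg]]] Hz Hz1 Hz2.
  pose proof (proj1 (Cmod_gt_0 z) Hz) as Hm.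
  assert (Hnu2 : RtoC (2 * nu) <> RtoC 0) by (intros H; apply RtoC_inj in H; lra).
  assert (HRe : forall l, Re (l / RtoC (2 * nu))%C = Re l / (2 * nu)).
  { intros l. unfold Cdiv. rewrite <- RtoC_inv by lra.
    unfold Re; simpl. unfold Rdiv. ring. }
  assert (Hmod : forall y, 0 < Cmod y -> Cmod y < r1 -> Cmod y < r2 ->
     Cmod (f y) = Cmod (g y) /\ g y <> RtoC 0).
  { intros y Hy Hy1 Hy2.
    destruct (Lf y (conj Hy Hy1)) as [l [Hl1 Hl2]].
    destruct (Lg y (conj Hy Hy2)) as [l' [Hl1' Hl2']].
    rewrite Hl2, Hl2'. split; [|apply Cexp_neq_0].
    rewrite !Cmod_Cexp, !HRe. do 2 f_equal.
    apply exp_inv. rewrite <- !Cmod_Cexp. now rewrite Hl1, Hl1'. }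
  set (h := fun y => (f y * / g y)%C).
  assert (Hh1 : forall y, 0 < Cmod y -> Cmod y < r1 -> Cmod y < r2 -> Cmod (h y) = 1).
  { intros y Hy Hy1 Hy2. destruct (Hmod y Hy Hy1 Hy2) as [E N].
    unfold h. rewrite Cmod_mult, Cmod_inv, E by exact N. apply Rinv_r.
    apply Rgt_not_eq. now apply Cmod_gt_0. }
  assert (Hh0 : forall y, 0 < Cmod y -> Cmod y < r1 -> Cmod y < r2 -> is_Cder h y (RtoC 0)).
  { intros y Hy Hy1 Hy2. destruct (Hmod y Hy Hy1 Hy2) as [E N].
    pose proof (C_derive_correct f y (RtoC 0) (Df y Hy1)) as D1.
    pose proof (C_derive_correct g y (RtoC 0) (Dg y Hy2)) as D2.
    pose proof (is_Cder_mult _ _ _ _ _ D1 (is_Cder_inv _ _ _ N D2)) as D.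
    eapply is_Cder_eq; [exact D|].
    apply (unit_modulus_der h y _ (Rmin (Cmod y) (Rmin (r1 - Cmod y) (r2 - Cmod y)))).
    - repeat apply Rmin_pos; lra.
    - intros x Hx.
      pose proof (Rmin_l (Cmod y) (Rmin (r1 - Cmod y) (r2 - Cmod y))).
      pose proof (Rmin_r (Cmod y) (Rmin (r1 - Cmod y) (r2 - Cmod y))).
      pose proof (Rmin_l (r1 - Cmod y) (r2 - Cmod y)).
      pose proof (Rmin_r (r1 - Cmod y) (r2 - Cmod y)).
      assert (Hxy : Cmod x <= Cmod y + Cmod (x - y)%C).
      { replace x with (y + (x - y))%C at 1 by ring. apply Cmod_triangle. }
      apply Hh1; try lra. apply Cmod_gt_0. apply Cmod_pos_of_near with y. lra.
    - exact D. }
  assert (Hconst : forall s, 0 < s <= 1 -> h z = h (s * z)%C).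
  { intros s Hs. apply Cder_zero_segment; [lra|]. intros x Hx.
    assert (Hxz : Cmod (x * z)%C <= Cmod z) by (apply Cmod_scal_le; lra).
    apply Hh0; try lra.
    rewrite Cmod_mult, Cmod_R, Rabs_pos_eq by lra. apply Rmult_lt_0_compat; lra. }
  assert (Hlim : Cmod (h z - 1)%C <= 0).
  { apply Rnot_lt_le. intros Hpos.
    set (eta := Rmin (1 / 2) (Cmod (h z - 1)%C / 8)).
    assert (Heta : 0 < eta) by (apply Rmin_pos; lra).
    pose proof (Rmin_l (1 / 2) (Cmod (h z - 1)%C / 8)) as He1.
    pose proof (Rmin_r (1 / 2) (Cmod (h z - 1)%C / 8)) as He2. fold eta in He1, He2.
    assert (Hd0 : forall (k : C -> C) r, u_branch nu r k -> Cmod z < r ->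
       is_Cder k (RtoC 0) (RtoC 1)).
    { intros k r [Dk [_ [k1 _]]] Hr. rewrite <- k1.
      apply C_derive_correct; [exact (RtoC 0)|]. apply Dk. rewrite Cmod_0. lra. }
    destruct (normalized_near_0 f f0) with (eta := eta) as [d1 [Hd1 N1]].
    { apply (Hd0 f r1); [now repeat split|exact Hz1]. }
    { exact Heta. }
    destruct (normalized_near_0 g g0) with (eta := eta) as [d2 [Hd2 N2]].
    { apply (Hd0 g r2); [now repeat split|exact Hz2]. }
    { exact Heta. }
    set (s := Rmin 1 (Rmin d1 d2 / (2 * Cmod z))).
    assert (Hdd : 0 < Rmin d1 d2) by (now apply Rmin_pos).
    assert (Hs : 0 < s) by (apply Rmin_pos; [lra|apply Rdiv_lt_0_compat; lra]).
    pose proof (Rmin_l 1 (Rmin d1 d2 / (2 * Cmod z))) as Hs1.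
    pose proof (Rmin_r 1 (Rmin d1 d2 / (2 * Cmod z))) as Hs2. fold s in Hs1, Hs2.
    set (y := (s * z)%C).
    assert (Hy : Cmod y = s * Cmod z)
      by (unfold y; rewrite Cmod_mult, Cmod_R, Rabs_pos_eq; lra).
    assert (Hyd : Cmod y <= Rmin d1 d2 / 2).
    { rewrite Hy. apply (Rmult_le_compat_r (Cmod z)) in Hs2; [|lra].
      replace (Rmin d1 d2 / (2 * Cmod z) * Cmod z) with (Rmin d1 d2 / 2) in Hs2
        by (field; lra). exact Hs2. }
    pose proof (Rmin_l d1 d2). pose proof (Rmin_r d1 d2).
    assert (Hy0 : 0 < Cmod y) by (rewrite Hy; now apply Rmult_lt_0_compat).
    assert (Hyz : Cmod y <= Cmod z) by (apply Cmod_scal_le; lra).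
    specialize (N1 y ltac:(lra)). specialize (N2 y ltac:(lra)).
    destruct (Hmod y Hy0 ltac:(lra) ltac:(lra)) as [_ N].
    assert (Hg : Cmod y / 2 <= Cmod (g y)).
    { pose proof (Cmod_triangle (g y) (- (g y - y))%C) as T.
      replace (g y + - (g y - y))%C with y in T by ring. rewrite Cmod_opp in T. nra. }
    assert (Hfg : Cmod (f y - g y)%C <= 2 * eta * Cmod y).
    { replace (f y - g y)%C with ((f y - y) + - (g y - y))%C by ring.
      eapply Rle_trans; [apply Cmod_triangle|]. rewrite Cmod_opp. lra. }
    assert (Hhz : Cmod (h z - 1)%C * Cmod (g y) = Cmod (f y - g y)%C).
    { rewrite (Hconst s) by lra. fold y. rewrite <- Cmod_mult. f_equal.
      unfold h. field. exact N. }
    assert (Cmod (h z - 1)%C * (Cmod y / 2) <= 2 * eta * Cmod y).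
    { eapply Rle_trans; [|exact Hfg]. rewrite <- Hhz. apply Rmult_le_compat_l; lra. }
    assert (Cmod (h z - 1)%C <= 4 * eta).
    { apply (Rmult_le_reg_r (Cmod y)); lra. }
    lra. }
  assert (E : (h z - 1)%C = RtoC 0).
  { apply Cmod_eq_0. pose proof (Cmod_ge_0 (h z - 1)). lra. }
  destruct (Hmod z Hm Hz1 Hz2) as [_ N].
  replace (f z) with (g z + (h z - 1) * g z)%C by (unfold h; field; exact N).
  rewrite E. ring.
Qed.

(** The branch [z E(z^4)^(1 / (2 nu))], through [E = exp (- Q)]. *)
Definition u_model (z : C) : C :=
  (z * Cexp (RtoC (- / (2 * nu)) * CPSeries (log_coef nu) (z ^ 4)))%C.

Lemma u_model_branch (r : R) : nu <> 0 -> 0 < r ->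
  (forall y, Cmod y < r -> Rbar_lt (Cmod y ^ 4) (CV_radius t)) -> u_branch nu r u_model.
Proof.
  intros Hnu Hr Hin.
  assert (Hnu2 : RtoC (2 * nu) <> RtoC 0) by (intros H; apply RtoC_inj in H; lra).
  split; [|split; [|split]].
  - intros z Hz. destruct (log_model_der (- / (2 * nu)) 3 z (Hin z Hz)) as [l [Hl _]].
    now exists l.
  - unfold u_model. ring.
  - destruct (log_model_der (- / (2 * nu)) 3 (RtoC 0)) as [l [Hl1 Hl2]].
    { apply Hin. now rewrite Cmod_0. }
    rewrite (is_C_derive_unique u_model _ _ Hl1), Hl2.
    replace (RtoC 0 ^ 4)%C with (RtoC 0) by (simpl; ring).
    rewrite !CPSeries_0. change (t_coef nu 0) with 0.
    replace (log_coef nu 0) with 0 by (unfold log_coef; change (t_coef nu 0) with 0; unfold Rdiv; ring).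
    rewrite !Cmult_0_r, Cexp_0. ring.
  - intros z [Hz0 Hz].
    assert (Hzn : z <> RtoC 0) by now apply Cmod_gt_0.
    exists (RtoC (2 * nu) * Clog z + - CPSeries (log_coef nu) (z ^ 4))%C. split.
    + rewrite Cexp_add, bessel_Pi_eq, <- CPSeries_e_coef_exp; try assumption.
      2: { rewrite Cmod_pow. now apply Hin. }
      rewrite (RtoC_mult (Rpower 2 (2 * nu))).
      transitivity ((RtoC (Rpower 2 (2 * nu)) * RtoC (Gamma (nu + 1) ^ 2) * RtoC (pi_factor nu))
        * (Cexp (RtoC (2 * nu) * Clog z) * CPSeries e (z ^ 4)))%C; [|ring].
      rewrite (pi_factor_inv nu nu_gt). ring.
    + unfold u_model. rewrite <- (Cexp_Clog z Hzn) at 1. rewrite <- Cexp_add. f_equal.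
      rewrite RtoC_opp, RtoC_inv by lra. field. exact Hnu2.
Qed.

Lemma u_fun_eq (r : R) (z : C) : nu <> 0 -> z <> RtoC 0 -> Cmod z < r ->
  (forall y, Cmod y < r -> Rbar_lt (Cmod y ^ 4) (CV_radius t)) -> u_fun nu z = u_model z.
Proof.
  intros Hnu Hz Hr Hin.
  pose proof (proj1 (Cmod_gt_0 z) Hz) as Hm.
  pose proof (u_model_branch r Hnu ltac:(lra) Hin) as HB.
  apply (iota_unique (V:=C_CompleteNormedModule)).
  - intros y [r' [f [Hr' [Hf <-]]]]. now apply (u_branch_unique r' r).
  - exists r, u_model. auto.
Qed.

Lemma u_fun_log_der (z : C) : nu <> 0 -> z <> RtoC 0 -> Rbar_lt (Cmod z ^ 4) (CV_radius t) ->
  has_log_der (u_fun nu) z (1 + RtoC (- / (2 * nu) * INR 4) * CPSeries t (z ^ 4))%C.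
Proof.
  intros Hnu Hz Hm. destruct (Rbar_lt_pow_near 3 z _ Hm) as [r [Hr1 Hr2]].
  pose proof (proj1 (Cmod_gt_0 z) Hz) as Hz0.
  apply (log_model_log_der _ _ 3) with (Rmin (Cmod z) (r - Cmod z)); try assumption.
  - apply Rmin_pos; lra.
  - intros y Hy. pose proof (Rmin_l (Cmod z) (r - Cmod z)).
    pose proof (Rmin_r (Cmod z) (r - Cmod z)).
    assert (Hy0 : y <> RtoC 0) by (apply Cmod_pos_of_near with z; lra).
    assert (Hyr : Cmod y < r).
    { replace y with (z + (y - z))%C by ring.
      eapply Rle_lt_trans; [apply Cmod_triangle|]. lra. }
    now apply (u_fun_eq r).
Qed.
End BesselFunctions.

(** * Radii of starlikeness *)

Lemma pow_lt_pow (x y : R) (n : nat) : 0 <= x < y -> x ^ S n < y ^ S n.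
Proof.
  intros H. induction n as [|n IH]; [simpl; lra|].
  change (x * x ^ S n < y * y ^ S n).
  apply Rmult_le_0_lt_compat; try lra. apply pow_le; lra.
Qed.

Lemma Rpower_quarter (r : R) : 0 < r -> 0 < Rpower r (1 / 4) /\ Rpower r (1 / 4) ^ 4 = r.
Proof.
  intros Hr. split; [apply exp_pos|].
  rewrite <- Rpower_pow by apply exp_pos. rewrite Rpower_mult.
  replace (1 / 4 * INR 4) with 1 by (simpl; field). now apply Rpower_1.
Qed.

Lemma sqrt_i_facts :
  Cmod sqrt_i = 1 /\ 0 < Re sqrt_i /\ (sqrt_i ^ 4)%C = RtoC (-1).
Proof.
  assert (HR : Re (Ci * RtoC (PI / 4))%C = 0) by (simpl; ring).
  assert (HI : Im (Ci * RtoC (PI / 4))%C = PI / 4) by (simpl; ring).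
  split; [|split].
  - unfold sqrt_i. rewrite Cmod_Cexp, HR. apply exp_0.
  - unfold sqrt_i, Cexp. rewrite HR, HI. simpl. rewrite exp_0, Rmult_1_l.
    pose proof PI_RGT_0. apply cos_gt_0; lra.
  - unfold sqrt_i. rewrite <- Cexp_pow.
    replace (RtoC (INR 4) * (Ci * RtoC (PI / 4)))%C with (0, PI).
    + unfold Cexp; simpl. rewrite exp_0, cos_PI, sin_PI. unfold RtoC. f_equal; ring.
    + apply injective_projections; simpl; field.
Qed.

Section Radii.
Variables (alpha nu : R).
Hypothesis nu_gt : -1 < nu.
Local Notation e := (e_coef nu).
Local Notation t := (t_coef nu).

Lemma Re_affine (k : R) (w : C) : Re (1 + RtoC k * w)%C = 1 + k * Re w.
Proof. destruct w; simpl; ring. Qed.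

(** With [k < 0] the real part of [1 + k T] on a circle is smallest on the positive
    axis, and decreases with the radius. *)
Lemma starlike_radius_level (f : C -> C) (k : R) (m : nat) (delta : R) :
  k < 0 -> 0 < delta -> Rbar_lt (delta ^ S m) (CV_radius t) ->
  1 + k * PSeries t (delta ^ S m) = alpha ->
  (forall z, z <> RtoC 0 -> Rbar_lt (Cmod z ^ S m) (CV_radius t) ->
     has_log_der f z (1 + RtoC k * CPSeries t (z ^ S m))%C) ->
  starlike_radius alpha f = Finite delta.
Proof.
  intros Hk Hd Hrad Hlev HL.
  apply starlike_radius_intro with (fun z => (1 + RtoC k * CPSeries t (z ^ S m))%C).
  - exact Hd.
  - intros z Hz. apply HL; [apply Cmod_gt_0; lra|].
    eapply Rbar_le_lt_trans; [|exact Hrad].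
    change (Cmod z ^ S m <= delta ^ S m). apply pow_incr. lra.
  - intros z Hz. rewrite Re_affine.
    assert (Hp : Cmod z ^ S m < delta ^ S m) by (apply pow_lt_pow; lra).
    assert (Hp0 : 0 <= Cmod z ^ S m) by (apply pow_le, Cmod_ge_0).
    pose proof (t_increasing nu nu_gt _ _ (conj Hp0 Hp) Hrad) as Hinc.
    assert (HR : Re (CPSeries t (z ^ S m)%C) <= PSeries t (Cmod z ^ S m)).
    { rewrite <- Cmod_pow. apply Re_t_le; [exact nu_gt|]. rewrite Cmod_pow.
      eapply Rbar_lt_trans; [|exact Hrad]. exact Hp. }
    nra.
  - exists (RtoC delta). split; [rewrite Cmod_R; apply Rabs_pos_eq; lra|].
    rewrite Re_affine, <- RtoC_pow, CPSeries_real. exact (Req_le _ _ Hlev).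
Qed.

Lemma level_is_root (w : R) (lambda : R) :
  0 < w -> Rbar_lt w (CV_radius t) -> PSeries t w = lambda ->
  4 * lambda * PSeries e w + 4 * PSeries (theta e) w = 0 /\
  (forall v, 0 < v < w -> 4 * lambda * PSeries e v + 4 * PSeries (theta e) v <> 0).
Proof.
  intros Hw Hr Hl. split.
  - rewrite PSeries_theta_e_coef, Hl by (assumption || lra). ring.
  - intros v Hv.
    assert (Hvr : Rbar_lt v (CV_radius t)).
    { eapply Rbar_lt_trans; [|exact Hr]. simpl; lra. }
    rewrite PSeries_theta_e_coef by (assumption || lra).
    pose proof (t_increasing nu nu_gt v w ltac:(lra) Hr) as Hinc. rewrite Hl in Hinc.
    pose proof (PSeries_e_coef_pos nu nu_gt v ltac:(lra) Hvr) as Hp. nra.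
Qed.

(** The equation divides by [4 E > 0] to [T = lambda] before the first zero of
    [E]; the substitution [s] is [r] for the first two functions and [r^(1/4)] for
    the third. *)
Lemma level_smallest_root (c w delta : R) (s : R -> R) (lambda : R) :
  2 * nu - c = 4 * lambda -> Rbar_lt w (CV_radius t) -> PSeries t w = lambda ->
  0 < delta -> s delta ^ 4 = w ->
  (forall y, 0 < y -> 0 < s y) -> (forall y, 0 < y < delta -> s y < s delta) ->
  smallest_pos_root (fun r : R =>
    (RtoC (s r) * C_derive (bessel_Pi nu) (RtoC (s r))
     - RtoC c * bessel_Pi nu (RtoC (s r)))%C) delta.
Proof.
  intros Hc Hr Hl Hd Hw Hs Hm.
  assert (Hroot : forall y, 0 < y ->
    ((RtoC (s y) * C_derive (bessel_Pi nu) (RtoC (s y))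
      - RtoC c * bessel_Pi nu (RtoC (s y)))%C = RtoC 0 <->
     4 * lambda * PSeries e (s y ^ 4) + 4 * PSeries (theta e) (s y ^ 4) = 0)).
  { intros y Hy. rewrite <- Hc. apply bessel_Pi_root_iff; [exact nu_gt|now apply Hs|].
    symmetry. apply RtoC_pow. }
  assert (Hw0 : 0 < w) by (rewrite <- Hw; apply pow_lt, Hs, Hd).
  destruct (level_is_root w lambda Hw0 Hr Hl) as [H1 H2].
  split; [exact Hd|split].
  - apply Hroot; [exact Hd|]. now rewrite Hw.
  - intros y Hy Hy0. apply Rnot_lt_le. intros Hlt.
    apply (Hroot y Hy) in Hy0. revert Hy0. apply H2.
    pose proof (Hs y Hy). split; [now apply pow_lt|]. rewrite <- Hw.
    apply pow_lt_pow. split; [lra|]. apply Hm. lra.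
Qed.

Lemma quarter_level (lambda : R) : 0 < lambda -> exists delta : R,
  0 < delta /\ Rbar_lt (delta ^ 4) (CV_radius t) /\ PSeries t (delta ^ 4) = lambda.
Proof.
  intros Hl. destruct (t_level nu nu_gt lambda Hl) as [w [Hw [Hr Hlev]]].
  destruct (Rpower_quarter w Hw) as [H1 H2].
  exists (Rpower w (1 / 4)). now rewrite H2.
Qed.

Lemma PSeries_excess_opp (kappa r : R) :
  PSeries (excess nu kappa) r = PSeries (theta e) (- r) - kappa * PSeries e (- r).
Proof.
  apply RtoC_inj. rewrite RtoC_minus, RtoC_mult, <- !CPSeries_real, RtoC_opp, <- !CPSeries_alternate.
  unfold excess. rewrite CPSeries_theta_minus.
  - f_equal. apply CPSeries_ext. intros n. unfold theta, alternate. ring.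
  - rewrite CV_radius_alternate. now apply e_in.
Qed.

End Radii.

Theorem theorem5 (alpha : R) (halpha : 0 <= alpha < 1) :
  (* (a) *)
  (forall nu : R, 0 < nu ->
     exists delta : R,
       smallest_pos_root
         (fun r : R =>
            (RtoC r * C_derive (bessel_Pi nu) (RtoC r)
             - RtoC (2 * alpha * nu) * bessel_Pi nu (RtoC r))%C) delta /\
       starlike_radius alpha (u_fun nu) = Finite delta) /\
  (forall nu : R, -1 < nu < 0 ->
     exists delta : R,
       unique_pos_root
         (fun r : R =>
            (sqrt_i * RtoC r * C_derive (bessel_Pi nu) (sqrt_i * RtoC r)
             - RtoC (2 * alpha * nu) * bessel_Pi nu (sqrt_i * RtoC r))%C) delta /\
       starlike_radius alpha (u_fun nu) = Finite delta) /\
  (* (b) *)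
  (forall nu : R, -1 < nu ->
     exists rho : R,
       smallest_pos_root
         (fun r : R =>
            (RtoC r * C_derive (bessel_Pi nu) (RtoC r)
             - RtoC (alpha + 2 * nu - 1) * bessel_Pi nu (RtoC r))%C) rho /\
       starlike_radius alpha (v_fun nu) = Finite rho) /\
  (* (c) *)
  (forall nu : R, -1 < nu ->
     exists sigma : R,
       smallest_pos_root
         (fun r : R =>
            (RtoC (Rpower r (1 / 4))
               * C_derive (bessel_Pi nu) (RtoC (Rpower r (1 / 4)))
             - RtoC (2 * (2 * alpha + nu - 2))
               * bessel_Pi nu (RtoC (Rpower r (1 / 4))))%C) sigma /\
       starlike_radius alpha (w_fun nu) = Finite sigma).
Proof.
  split; [|split; [|split]].
  - intros nu Hnu. assert (Hgt : -1 < nu) by lra.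
    destruct (quarter_level nu Hgt (nu * (1 - alpha) / 2)) as [delta [Hd [Hr Hl]]].
    { apply Rdiv_lt_0_compat; [|lra]. apply Rmult_lt_0_compat; lra. }
    exists delta. split.
    + apply (level_smallest_root nu Hgt (2 * alpha * nu) (delta ^ 4) delta (fun r => r)
        (nu * (1 - alpha) / 2)); try assumption; try reflexivity; intros; try lra.
    + apply (starlike_radius_level alpha nu Hgt _ (- / (2 * nu) * INR 4) 3); try assumption.
      * pose proof (Rinv_0_lt_compat (2 * nu) ltac:(lra)). simpl INR. lra.
      * change (S 3) with 4%nat. rewrite Hl. simpl INR. field. lra.
      * intros z Hz Hm. apply u_fun_log_der; try assumption. lra.
  - intros nu [Hgt Hnu]. destruct sqrt_i_facts as [S1 [S2 S3]].
    set (kappa := - nu * (1 - alpha) / 2).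
    assert (Hk : 0 < kappa < 1 / 2).
    { unfold kappa. split; [apply Rdiv_lt_0_compat; [|lra]; apply Rmult_lt_0_compat; lra|].
      apply Rlt_div_l; [lra|]. nra. }
    (* On the ray of argument [pi / 4] the equation is [excess (r^4) = 0]. *)
    destruct (excess_root nu Hgt kappa Hk) as [d [Hd Hroot]].
    destruct (Rpower_quarter d Hd) as [H1 H2].
    set (delta := Rpower d (1 / 4)) in *.
    assert (Hiff : forall y, 0 < y ->
      ((sqrt_i * RtoC y * C_derive (bessel_Pi nu) (sqrt_i * RtoC y)
       - RtoC (2 * alpha * nu) * bessel_Pi nu (sqrt_i * RtoC y))%C = RtoC 0 <->
       PSeries (excess nu kappa) (y ^ 4) = 0)).
    { intros y Hy. rewrite (bessel_Pi_root_iff nu Hgt _ _ (- y ^ 4)).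
      - rewrite PSeries_excess_opp by exact Hgt.
        replace (2 * nu - 2 * alpha * nu) with (- 4 * kappa) by (unfold kappa; field).
        split; intros H; lra.
      - replace (Re (sqrt_i * RtoC y)%C) with (Re sqrt_i * y) by (unfold Re; simpl; ring).
        now apply Rmult_lt_0_compat.
      - rewrite Cpow_mult_l, S3, <- RtoC_pow, <- RtoC_mult. f_equal. ring. }
    assert (Hneg : forall r, 0 <= r < d -> PSeries (excess nu kappa) r < 0).
    { intros r Hr. rewrite <- Hroot. now apply excess_increasing. }
    assert (Hrad : Rbar_lt d (CV_radius (t_coef nu))).
    { apply t_radius_gt; [exact Hgt|lra|]. intros s Hs.
      apply (excess_nonpos_e_coef_pos nu Hgt kappa Hk); [lra|].
      destruct (Rle_lt_or_eq_dec s d) as [H|H]; [lra| |rewrite H; lra].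
      left. apply Hneg. lra. }
    exists delta. split; [split; [exact H1|split]|].
    + apply Hiff; [exact H1|]. now rewrite H2.
    + intros y Hy Hy0. apply Hiff in Hy0; [|exact Hy].
      destruct (Rtotal_order y delta) as [H|[H|H]]; [exfalso|exact H|exfalso].
      * pose proof (pow_lt_pow y delta 3 ltac:(lra)) as Hp. rewrite H2 in Hp.
        pose proof (Hneg (y ^ 4)) as Hn. pose proof (pow_lt y 4 Hy).
        specialize (Hn ltac:(split; [lra|exact Hp])). lra.
      * pose proof (pow_lt_pow delta y 3 ltac:(lra)) as Hp. rewrite H2 in Hp.
        pose proof (excess_increasing nu Hgt kappa Hk d (y ^ 4)) as Hn.
        specialize (Hn ltac:(split; [lra|exact Hp])). lra.
    + assert (Hkk : (- / (2 * nu) * INR 4) * kappa = 1 - alpha).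
      { unfold kappa. simpl INR. field. lra. }
      assert (Hpos : 0 < - / (2 * nu) * INR 4).
      { pose proof (Rinv_lt_0_compat (2 * nu) ltac:(lra)). simpl INR. lra. }
      apply starlike_radius_intro with
        (fun z => (1 + RtoC (- / (2 * nu) * INR 4) * CPSeries (t_coef nu) (z ^ 4))%C).
      * exact H1.
      * intros z Hz. apply u_fun_log_der; [exact Hgt|lra|apply Cmod_gt_0; lra|].
        eapply Rbar_le_lt_trans; [|exact Hrad].
        change (Cmod z ^ 4 <= d). rewrite <- H2. apply pow_incr. lra.
      * intros z Hz. rewrite Re_affine.
        assert (Hp : Cmod z ^ 4 < d) by (rewrite <- H2; apply pow_lt_pow; lra).
        assert (Hp0 : 0 <= Cmod z ^ 4) by (apply pow_le, Cmod_ge_0).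
        assert (HR : - kappa < Re (CPSeries (t_coef nu) (z ^ 4)%C)).
        { apply Re_t_gt; try assumption; rewrite Cmod_pow.
          - eapply Rbar_lt_trans; [|exact Hrad]. exact Hp.
          - apply Hneg. lra. }
        nra.
      * (* The root equation reads [T(- d) = - kappa], where [1 + k T] is [alpha]. *)
        exists (sqrt_i * RtoC delta)%C. split.
        { rewrite Cmod_mult, S1, Cmod_R, Rabs_pos_eq by lra. ring. }
        rewrite Re_affine, Cpow_mult_l, S3, <- RtoC_pow, H2, <- RtoC_mult.
        replace (-1 * d) with (- d) by ring. rewrite CPSeries_real.
        assert (Hdm : Rbar_lt (Cmod (RtoC (- d))) (CV_radius (t_coef nu))).
        { now rewrite Cmod_R, Rabs_Ropp, Rabs_pos_eq by lra. }
        pose proof (CPSeries_theta_e_coef nu Hgt _ Hdm) as HT.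
        pose proof (CPSeries_e_coef_neq_0 nu Hgt _ Hdm) as HE.
        rewrite !CPSeries_real, <- RtoC_mult, <- RtoC_opp in HT. apply RtoC_inj in HT.
        rewrite CPSeries_real in HE.
        assert (HE' : PSeries (e_coef nu) (- d) <> 0) by (intros H; apply HE; now rewrite H).
        rewrite PSeries_excess_opp, HT in Hroot by exact Hgt.
        assert (HTk : PSeries (t_coef nu) (- d) = - kappa).
        { apply (Rmult_eq_reg_r (PSeries (e_coef nu) (- d))); [lra|exact HE']. }
        rewrite HTk. change (Re (RtoC (- kappa))) with (- kappa). lra.
  - intros nu Hgt.
    destruct (quarter_level nu Hgt ((1 - alpha) / 4)) as [delta [Hd [Hr Hl]]]; [lra|].
    exists delta. split.
    + apply (level_smallest_root nu Hgt (alpha + 2 * nu - 1) (delta ^ 4) delta (fun r => r)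
        ((1 - alpha) / 4)); try assumption; try reflexivity; intros; try lra.
    + apply (starlike_radius_level alpha nu Hgt _ (- 1 * INR 4) 3); try assumption.
      * simpl INR. lra.
      * change (S 3) with 4%nat. rewrite Hl. simpl INR. field.
      * intros z Hz Hm. now apply v_fun_log_der.
  - intros nu Hgt.
    destruct (t_level nu Hgt (1 - alpha)) as [sigma [Hs [Hr Hl]]]; [lra|].
    exists sigma. split.
    + apply (level_smallest_root nu Hgt (2 * (2 * alpha + nu - 2)) sigma sigma
        (fun r => Rpower r (1 / 4)) (1 - alpha)); try assumption; try lra.
      * now apply Rpower_quarter.
      * intros y _. apply exp_pos.
      * intros y Hy. unfold Rpower. apply exp_increasing.
        apply Rmult_lt_compat_l; [lra|]. apply ln_increasing; lra.
    + apply (starlike_radius_level alpha nu Hgt _ (- 1 * INR 1) 0); try assumption.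
      * simpl INR. lra.
      * rewrite pow_1. exact Hr.
      * rewrite pow_1, Hl. simpl INR. ring.
      * intros z Hz Hm. now apply w_fun_log_der.
Qed.
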